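(* Let $C$ be an algebraically closed field of characteristic zero, regarded as a differential field with the zero derivation. If $E$ is an iterated strongly normal extension of $C$, then every differential field $K$ with $C\subseteq K\subseteq E$ and $\mathrm{tr.deg}(K|C)=1$ has an element $t\in K\setminus C$ such that either $t'=1$, or $t'=ct$ for some nonzero $c\in C$, or $t$ is a solution of a Weierstrass differential equation over $C$.
   Context: Derivations are denoted by $'$. A Weierstrass differential equation over $C$ is an equation $(t')^2=\alpha^2(4t^3-g_2t-g_3)$ with $g_2,g_3,\alpha\in C$ and $27g_3^2-g_2^3\neq0$. Strongly normal extension of a differential field $k$ (characteristic zero, algebraically closed field of constants): a differential field extension $E$ of $k$ that is finitely differentially generated over $k$ and such that every differential $k$-isomorphism $\sigma$ of $E$ (into a differential field extension of $E$) satisfies $E\,\sigma E=E\,C(\sigma)=\sigma E\,C(\sigma)$, where $C(\sigma)$ is the field of constants of the compositum $E\,\sigma E$, and $\sigma(c)=c$ for all constants $c$ of $E$. (Such an $E$ has the same field of constants as $k$.) Iterated strongly normal extension of $k$: a differential field extension $E$ of $k$ for which there is a tower of differential fields $k=E_0\subseteq E_1\subseteq\cdots\subseteq E_n=E$ with $E_i$ a strongly normal extension of $E_{i-1}$ for each $i=1,\dots,n$. *)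

(* Defs.v *)
From HB Require Import structures.
From mathcomp Require Import all_boot all_order all_algebra.
From mathcomp Require Import mpoly.
From mathcomp Require Import boolp classical_sets.

Set Implicit Arguments.
Unset Strict Implicit.
Unset Printing Implicit Defensive.

Import GRing.Theory.
Local Open Scope classical_set_scope.
Local Open Scope ring_scope.

HB.mixin Record Field_isDifferential F of GRing.Field F := {
  der : F -> F;
  derD : {morph der : x y / x + y};
  derM : forall x y : F, der (x * y) = der x * y + x * der y
}.

#[short(type="diffFieldType")]
HB.structure Definition DiffField :=
  {F of GRing.Field F & Field_isDifferential F}.

HB.mixin Record isDiffMorphism (K L : diffFieldType) (f : K -> L) := {
  morph_der : {morph f : x / der x}
}.

(* Differential field extensions are represented by embeddings: a morphism of
   fields is automatically injective. *)
#[short(type="diffMorphism")]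
HB.structure Definition DiffMorphism (K L : diffFieldType) :=
  {f of @GRing.RMorphism K L f & @isDiffMorphism K L f}.

Definition subfield (F : fieldType) (A : set F) : Prop :=
  GRing.divring_closed (mem A).

Definition diff_subfield (F : diffFieldType) (A : set F) : Prop :=
  subfield A /\ (forall x, A x -> A (der x)).

Definition constants (F : diffFieldType) : set F := [set x | der x = 0].

Definition alg_closed (F : fieldType) (A : set F) : Prop :=
  forall p : {poly F}, p \is a polyOver (mem A) -> (1 < size p)%N ->
  exists2 x, A x & root p x.

Definition compositum (F : fieldType) (A B : set F) : set F :=
  smallest (@subfield F) (A `|` B).

Definition fin_diff_generated (k E : diffFieldType) (i : k -> E) : Prop :=
  exists s : seq E,
    smallest (@diff_subfield E) (range i `|` [set` s]) = setT.

(* [M] is an extension of [E] through [j], so that [E] is [range j] inside [M]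
   and "sigma fixes x" reads [sigma x = j x]. *)
Definition strongly_normal (k E : diffFieldType) (i : diffMorphism k E) : Prop :=
  [/\ [pchar k] =i pred0,
      alg_closed (@constants k),
      fin_diff_generated i
    & forall (M : diffFieldType) (j sigma : diffMorphism E M),
      (forall x : k, sigma (i x) = j (i x)) ->
      let EsE := compositum (range j) (range sigma) in
      let Csigma := EsE `&` @constants M in
      [/\ EsE = compositum (range j) Csigma,
          EsE = compositum (range sigma) Csigma
        & forall c : E, @constants E c -> sigma c = j c]].

Inductive iterated_strongly_normal (k : diffFieldType) :
    forall E : diffFieldType, diffMorphism k E -> Prop :=
  | isn_base (E : diffFieldType) (i : diffMorphism k E) :
      range i = setT -> iterated_strongly_normal i
  | isn_step (L E : diffFieldType) (f : diffMorphism k L)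
      (g : diffMorphism L E) (i : diffMorphism k E) :
      iterated_strongly_normal f -> strongly_normal g ->
      (forall x, i x = g (f x)) -> iterated_strongly_normal i.

Definition alg_independent (k E : fieldType) (i : {rmorphism k -> E}) n
    (t : 'I_n -> E) : Prop :=
  forall p : {mpoly k[n]}, mmap i t p = 0 -> p = 0.

Definition algebraic_over (F : fieldType) (A : set F) (x : F) : Prop :=
  exists p : {poly F}, [/\ p \is a polyOver (mem A), p != 0 & root p x].

(* [K], a subfield of [E] containing [range i], has a transcendence basis over
   [k] with [n] elements. *)
Definition trdeg_eq (k E : fieldType) (i : {rmorphism k -> E}) (K : set E)
    (n : nat) : Prop :=
  exists t : 'I_n -> E,
    [/\ range t `<=` K,
        alg_independent i t
      & forall x, K x -> algebraic_over (smallest (@subfield E) (range i `|` range t)) x].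

Definition weierstrass_solution (C E : diffFieldType) (i : C -> E) (t : E) :
    Prop :=
  exists g2 g3 alpha : C,
    27%:R * g3 ^+ 2 - g2 ^+ 3 != 0 /\
    der t ^+ 2 = i alpha ^+ 2 * (4%:R * t ^+ 3 - i g2 * t - i g3).

(* Main.v *)
Require Import Defs.
From HB Require Import structures.
From mathcomp Require Import all_boot all_order all_algebra.
From mathcomp Require Import generic_quotient ring_quotient fraction mpoly.
From mathcomp Require Import boolp classical_sets.
From mathcomp Require Import ring zify.

(** Pick t in K transcendental over C.  Going down the tower to the step at which t
    becomes transcendental, and using that a strongly normal extension is generated by
    constants over either of its conjugates, one gets a differential field M and two
    embeddings of E in M that agree on C, such that the second image of t is transcendental
    over the first copy of E but algebraic over E(constants of M).  A Wronskian argument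
    then yields a constant, not in C, in the compositum W of E and K1 = C(t, t').
    Besides the derivation D of M, the field W has the E-linear derivation d that extends
    the derivation of K1; the two commute, so that d acts on the field of constants of D.
    That field contains f, not in C, with (d f)^2 = P(f) and deg P <= 4: if it meets the
    ring E.K1 outside C, because a constant in this ring satisfies a linear differential
    equation over C; otherwise take f with as few poles as possible.  Since the ring E.K1
    has no proper d-stable ideal, d acts without zeros, as an invariant vector field on a
    curve of genus at most one: duality for the trace over C(f) shows that the constants of
    D that are regular away from the poles of f have rank at most 2 over C[f], and that
    (d f)^2 is a polynomial in f.
    Specializing the coefficients of f from E to C preserves the equation and gives t in K
    outside C with t'^2 = P(t), which is solved by elementary substitutions. *)

Set Implicit Arguments.
Unset Strict Implicit.
Unset Printing Implicit Defensive.

Import GRing.Theory.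
Local Open Scope classical_set_scope.
Local Open Scope ring_scope.

(** * Derivations, subfields, fraction fields *)

(** [D] kills the constant [f] and so gives no equation for it. The [E]-linear [d] does, and it is
    also the derivation that survives when coefficients in [E] are replaced by elements of [C]. The
    geometry of curves is replaced by algebra in the ring E.K1. Nonzero elements of [C[t]] are units
    there, so the Gram matrix of a basis over [C(t)] can be inverted inside the ring; this makes the
    ring completely integrally closed, and denominator ideals then behave like invertible ideals.
    Poles are counted by the codimension over [E] of these ideals. Having as few poles as possible
    forces the constants of [D] with at most the poles of [f] into [C + C f], so every further
    generator over [C[f]] has pole order at least 2. The members of the trace-dual basis other than
    the one dual to 1 then play the part of regular differentials. These are stable under [d], and
    simplicity of the ring leaves only the [C]-multiples of a single one, whence rank 1 or 2. The
    degree 4 comes from [d], which turns the poles of [f], counted with order 1, into poles of order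
    at most 2. *)

Definition derivation (R : comNzRingType) (d : R -> R) : Prop :=
  {morph d : x y / x + y} /\ (forall x y, d (x * y) = d x * y + x * d y).

Lemma der_derivation (F : diffFieldType) : derivation (@der F).
Proof. by split; [exact: derD | exact: derM]. Qed.

Section Derivation.
Variables (R : comNzRingType) (d : R -> R).
Hypothesis dD : derivation d.

Lemma drvD : {morph d : x y / x + y}. Proof. exact: dD.1. Qed.
Lemma drvM x y : d (x * y) = d x * y + x * d y. Proof. exact: dD.2. Qed.
Lemma drv0 : d 0 = 0.
Proof. by apply: (addrI (d 0)); rewrite -drvD !addr0. Qed.
Lemma drvN : {morph d : x / - x}.
Proof. by move=> x; apply: (addrI (d x)); rewrite -drvD !subrr drv0. Qed.
Lemma drvB : {morph d : x y / x - y}.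
Proof. by move=> x y; rewrite drvD drvN. Qed.
Lemma drv1 : d 1 = 0.
Proof. by apply: (addrI (d 1)); rewrite addr0 -{3}[1]mulr1 drvM mulr1 mul1r. Qed.
Lemma drvMn x n : d (x *+ n) = d x *+ n.
Proof. by elim: n => [|n IH]; rewrite ?mulr0n ?drv0 // !mulrS drvD IH. Qed.
Lemma drv_nat n : d n%:R = 0.
Proof. by rewrite drvMn drv1 mul0rn. Qed.
Lemma drvX x n : d (x ^+ n) = n%:R * x ^+ n.-1 * d x.
Proof.
elim: n => [|n IH]; first by rewrite expr0 drv1 !mul0r.
rewrite exprS drvM IH /=; case: n {IH} => [|n] /=; first by rewrite expr0; ring.
by rewrite exprS -[n.+2]addn1 natrD; ring.
Qed.
Lemma drv_sum I (r : seq I) (P : pred I) (F : I -> R) :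
  d (\sum_(i <- r | P i) F i) = \sum_(i <- r | P i) d (F i).
Proof. exact: (big_morph d drvD drv0). Qed.
End Derivation.

Section FieldDerivation.
Variables (F : fieldType) (d : F -> F).
Hypothesis dD : derivation d.

Lemma drvV x : d x^-1 = - d x / x ^+ 2.
Proof.
have [->|x0] := eqVneq x 0; first by rewrite invr0 (drv0 dD) oppr0 mul0r.
apply: (mulfI x0); apply: (addrI (d x * x^-1)).
by rewrite -(drvM dD) divff // (drv1 dD); field.
Qed.

Lemma drv_div x y : y != 0 -> d (x / y) = (d x * y - x * d y) / y ^+ 2.
Proof. by move=> y0; rewrite (drvM dD) drvV; field. Qed.
End FieldDerivation.

Section SubfieldType.
Variables (M : fieldType) (N : set M).
Hypothesis hN : subfield N.

Definition subfield_mem : {pred M} := fun x => `[< N x >].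

Lemma subfield_memP : GRing.divring_closed subfield_mem. Proof. exact: hN. Qed.
HB.instance Definition _ := GRing.isDivringClosed.Build M subfield_mem subfield_memP.

Record subfield_sort := SubfieldSort { subfield_val :> M; _ : subfield_val \in subfield_mem }.
HB.instance Definition _ := [isSub for subfield_val].
HB.instance Definition _ := [Choice of subfield_sort by <:].
HB.instance Definition _ := [SubChoice_isSubIntegralDomain of subfield_sort by <:].
HB.instance Definition _ := [SubIntegralDomain_isSubField of subfield_sort by <:].

Lemma subfield_type_sub : exists (W : fieldType) (f : {rmorphism W -> M}),
  forall x, N x <-> exists w, f w = x.
Proof.
exists (subfield_sort : fieldType); exists (val : {rmorphism subfield_sort -> M}) => x.
split=> [Nx | [w <-]]; last by move: (valP w) => /asboolP.
have Nx' : x \in subfield_mem by apply/asboolP.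
by exists (SubfieldSort Nx').
Qed.
End SubfieldType.

Section FractionImage.
Variables (A : idomainType) (W : fieldType) (ev : {rmorphism A -> W}).
Hypothesis ev_inj : injective ev.

Definition frac_image : set W := [set w | exists P Q, Q != 0 /\ w = ev P / ev Q].

Lemma ev_eq0 P : (ev P == 0) = (P == 0).
Proof. by rewrite -(inj_eq ev_inj) rmorph0. Qed.

Lemma frac_image_subfield : subfield frac_image.
Proof.
split.
- by rewrite in_setE; exists 1, 1; rewrite oner_neq0 !rmorph1 divr1.
- move=> u v; rewrite !in_setE => -[P [Q [Q0 ->]]] [P' [Q' [Q'0 ->]]].
  exists (P * Q' - P' * Q), (Q * Q'); rewrite mulf_neq0 //; split=> //.
  by rewrite rmorphB !rmorphM /=; field; rewrite !ev_eq0 Q0 Q'0.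
- move=> u v; rewrite !in_setE => -[P [Q [Q0 ->]]] [P' [Q' [Q'0 ->]]].
  have [P'0|P'0] := eqVneq P' 0.
    by exists 0, 1; rewrite oner_neq0 P'0 !rmorph0 !mul0r invr0 mulr0.
  exists (P * Q'), (Q * P'); rewrite mulf_neq0 //; split=> //.
  by rewrite !rmorphM /=; field; rewrite !ev_eq0 Q0 Q'0 P'0.
Qed.

Variables (k : fieldType) (io : {rmorphism k -> W}).
Hypothesis ioP : forall w, frac_image w <-> exists x, io x = w.

Lemma frac_imageP x : exists P Q, Q != 0 /\ io x = ev P / ev Q.
Proof. by have : frac_image (io x) by apply/ioP; exists x. Qed.
Lemma frac_image_ex P Q : Q != 0 -> exists x, io x = ev P / ev Q.
Proof. by move=> Q0; apply/ioP; exists P, Q. Qed.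
Lemma frac_image_ev P : exists x, io x = ev P.
Proof. by have [x] := frac_image_ex P (oner_neq0 _); rewrite rmorph1 divr1; exists x. Qed.

Lemma common_denominator (I : finType) (c : I -> k) :
  exists (P : I -> A) (Q : A), Q != 0 /\ forall i, io (c i) = ev (P i) / ev Q.
Proof.
have /choice[f Hf] i : exists pq : A * A, pq.2 != 0 /\ io (c i) = ev pq.1 / ev pq.2.
  by have [P [Q [Q0 e]]] := frac_imageP (c i); exists (P, Q).
exists (fun i => (f i).1 * \prod_(j | j != i) (f j).2), (\prod_j (f j).2); split.
  by apply/prodf_neq0 => i _; have [] := Hf i.
move=> i /=; have [Q0 ->] := Hf i.
have -> : \prod_j (f j).2 = (f i).2 * \prod_(j | j != i) (f j).2 by rewrite (bigD1 i).
rewrite !rmorphM /=.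
have : \prod_(j | j != i) (f j).2 != 0 by apply/prodf_neq0 => j _; have [] := Hf j.
by rewrite -ev_eq0 => h; field; rewrite h ev_eq0 Q0.
Qed.
End FractionImage.

(** * Trace form of a finite extension *)

Section FiniteExtension.
Variables (k W : fieldType) (io : {rmorphism k -> W}) (n : nat) (e : 'I_n -> W).

Definition lincomb (c : 'rV[k]_n) : W := \sum_i io (c 0 i) * e i.
Definition in_span (w : W) : Prop := exists c, w = lincomb c.

Lemma lincombD c d : lincomb (c + d) = lincomb c + lincomb d.
Proof. by rewrite -big_split; apply: eq_bigr => i _; rewrite mxE rmorphD mulrDl. Qed.
Lemma lincombZ a c : lincomb (a *: c) = io a * lincomb c.
Proof. by rewrite mulr_sumr; apply: eq_bigr => i _; rewrite mxE rmorphM mulrA. Qed.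
Lemma lincomb0 : lincomb 0 = 0.
Proof. by apply: big1 => i _; rewrite mxE rmorph0 mul0r. Qed.
Lemma lincombN c : lincomb (- c) = - lincomb c.
Proof. by rewrite -scaleN1r lincombZ rmorphN1 mulN1r. Qed.
Lemma lincomb_sum I (r : seq I) (P : pred I) (F : I -> 'rV[k]_n) :
  lincomb (\sum_(i <- r | P i) F i) = \sum_(i <- r | P i) lincomb (F i).
Proof. exact: (big_morph lincomb lincombD lincomb0). Qed.
Lemma lincomb_delta i : lincomb (delta_mx 0 i) = e i.
Proof.
rewrite /lincomb (bigD1 i) //= mxE !eqxx rmorph1 mul1r big1 ?addr0 // => j ji.
by rewrite mxE (negbTE ji) andbF rmorph0 mul0r.
Qed.

Lemma in_spanD u v : in_span u -> in_span v -> in_span (u + v).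
Proof. by move=> [c ->] [d ->]; exists (c + d); rewrite lincombD. Qed.
Lemma in_span0 : in_span 0.
Proof. by exists 0; rewrite lincomb0. Qed.
Lemma in_spanZ a u : in_span u -> in_span (io a * u).
Proof. by move=> [c ->]; exists (a *: c); rewrite lincombZ. Qed.
Lemma in_spanN u : in_span u -> in_span (- u).
Proof. by move=> [c ->]; exists (- c); rewrite lincombN. Qed.
Lemma in_span_sum I (r : seq I) (P : pred I) (F : I -> W) :
  (forall i, P i -> in_span (F i)) -> in_span (\sum_(i <- r | P i) F i).
Proof. by move=> H; elim/big_ind: _ => //; [exact: in_span0 | exact: in_spanD]. Qed.
Lemma in_span_basis i : in_span (e i).
Proof. by exists (delta_mx 0 i); rewrite lincomb_delta. Qed.

Hypothesis indep : forall c, lincomb c = 0 -> c = 0.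

Lemma lincomb_inj : injective lincomb.
Proof. by move=> c d cd; apply/eqP; rewrite -subr_eq0; apply/eqP/indep; rewrite lincombD lincombN cd subrr. Qed.

Definition coord (w : W) : 'rV[k]_n :=
  if pselect (in_span w) is left h then projT1 (cid h) else 0.

Lemma coordK w : in_span w -> lincomb (coord w) = w.
Proof. by rewrite /coord => h; case: pselect => // h'; case: cid. Qed.
Lemma lincombK c : coord (lincomb c) = c.
Proof. by apply: lincomb_inj; rewrite coordK //; exists c. Qed.

Hypothesis span1 : in_span 1.
Hypothesis spanM_basis : forall i j, in_span (e i * e j).

Lemma in_spanM u v : in_span u -> in_span v -> in_span (u * v).
Proof.
move=> [c ->] [d ->]; rewrite /lincomb mulr_suml; apply: in_span_sum => i _.
rewrite mulr_sumr; apply: in_span_sum => j _.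
rewrite (_ : _ * _ = io (c 0 i * d 0 j) * (e i * e j)); first exact: in_spanZ.
by rewrite rmorphM; ring.
Qed.
Lemma in_spanX u m : in_span u -> in_span (u ^+ m).
Proof. by move=> hu; elim: m => [|m IH]; rewrite ?expr0 // exprS; exact: in_spanM. Qed.

Definition mulmat (w : W) : 'M[k]_n := \matrix_i coord (w * e i).

Lemma mulmatP w i : in_span w -> w * e i = lincomb (row i (mulmat w)).
Proof. by move=> h; rewrite rowK coordK //; apply: in_spanM => //; exact: in_span_basis. Qed.

Lemma mulmat_uniq w (A : 'M[k]_n) : (forall i, w * e i = lincomb (row i A)) -> mulmat w = A.
Proof. by move=> h; apply/row_matrixP => i; rewrite rowK h lincombK. Qed.

Lemma mulr_lincomb w c : in_span w -> w * lincomb c = lincomb (c *m mulmat w).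
Proof.
move=> h; rewrite mulmx_sum_row lincomb_sum mulr_sumr; apply: eq_bigr => i _.
by rewrite lincombZ -mulmatP //; ring.
Qed.

Lemma mulmatM u v : in_span u -> in_span v -> mulmat (u * v) = mulmat u *m mulmat v.
Proof.
move=> hu hv; apply: mulmat_uniq => i.
by rewrite row_mul -mulr_lincomb // -mulmatP //; ring.
Qed.
Lemma mulmatD u v : in_span u -> in_span v -> mulmat (u + v) = mulmat u + mulmat v.
Proof. by move=> hu hv; apply: mulmat_uniq => i; rewrite linearD lincombD -!mulmatP // mulrDl. Qed.
Lemma mulmatZ a u : in_span u -> mulmat (io a * u) = a *: mulmat u.
Proof. by move=> hu; apply: mulmat_uniq => i; rewrite linearZ lincombZ -mulmatP // mulrA. Qed.
Lemma mulmat1 : mulmat 1 = 1%:M.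
Proof. by apply: mulmat_uniq => i; rewrite row1 lincomb_delta mul1r. Qed.
Lemma mulmat_scalar a : mulmat (io a) = a%:M.
Proof. by rewrite -[io a]mulr1 mulmatZ // mulmat1 scalemx1. Qed.
Lemma det_mulmatX u m : in_span u -> \det (mulmat (u ^+ m)) = \det (mulmat u) ^+ m.
Proof.
move=> hu; elim: m => [|m IH]; first by rewrite !expr0 mulmat1 det1.
by rewrite exprS mulmatM ?det_mulmx ?IH ?exprS //; exact: in_spanX.
Qed.

Lemma mulmat_unit w : in_span w -> w != 0 -> mulmat w \in unitmx.
Proof.
move=> hw w0; rewrite -row_free_unit; apply: inj_row_free => v hv.
apply: indep; apply: (mulfI w0); rewrite mulr0.
by rewrite mulr_lincomb // hv lincomb0.
Qed.

(** Multiplication by a nonzero [w] is an injective, hence bijective, linear map of the span, so it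
    reaches 1. *)
Lemma in_spanV w : in_span w -> in_span w^-1.
Proof.
move=> hw; have [->|w0] := eqVneq w 0; first by rewrite invr0; exact: in_span0.
exists (coord 1 *m invmx (mulmat w)); apply: (mulfI w0).
by rewrite divff // mulr_lincomb // mulmxKV ?mulmat_unit // coordK.
Qed.

Lemma mulmat_eigen w : in_span w -> root (map_poly io (char_poly (mulmat w))) w.
Proof.
move=> hw; rewrite map_char_poly -eigenvalue_root_char.
(* The rows of [mulmat w] expand the products [w * e i], so the tuple of the [e i], written as a
   row, is an eigenvector of the transpose. *)
have -> : eigenvalue (map_mx io (mulmat w)) w = eigenvalue (map_mx io (mulmat w))^T w.
  rewrite !eigenvalue_root_char /char_poly -[in RHS]det_tr /char_poly_mx.
  by rewrite linearB /= tr_scalar_mx -map_trmx trmxK.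
apply/eigenvalueP; exists (\row_i e i); last first.
  apply/eqP => e0; have /eqP := oner_neq0 W; apply.
  rewrite -(coordK span1) /lincomb big1 // => i _.
  by move/rowP: e0 => /(_ i); rewrite !mxE => ->; rewrite mulr0.
apply/rowP => i; rewrite !mxE mulmatP //; apply: eq_bigr => j _.
by rewrite !mxE mulrC.
Qed.

Definition ext_trace (w : W) : k := \tr (mulmat w).

Lemma ext_traceD u v : in_span u -> in_span v ->
  ext_trace (u + v) = ext_trace u + ext_trace v.
Proof. by move=> hu hv; rewrite /ext_trace mulmatD // mxtraceD. Qed.
Lemma ext_traceZ a u : in_span u -> ext_trace (io a * u) = a * ext_trace u.
Proof. by move=> hu; rewrite /ext_trace mulmatZ // mxtraceZ. Qed.
Lemma ext_trace0 : ext_trace 0 = 0.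
Proof. by rewrite -[0](mul0r 1) -(rmorph0 io) ext_traceZ // mul0r. Qed.
Lemma ext_trace_sum I (r : seq I) (F : I -> W) :
  (forall i, in_span (F i)) -> ext_trace (\sum_(i <- r) F i) = \sum_(i <- r) ext_trace (F i).
Proof.
move=> H; elim: r => [|i r IH]; first by rewrite !big_nil ext_trace0.
by rewrite !big_cons ext_traceD ?IH //; apply: in_span_sum.
Qed.
Lemma ext_trace_lincomb u c : in_span u ->
  ext_trace (u * lincomb c) = \sum_i c 0 i * ext_trace (u * e i).
Proof.
move=> hu; rewrite /lincomb mulr_sumr.
have hb i : in_span (u * e i) by apply: in_spanM => //; exact: in_span_basis.
under eq_bigr do rewrite mulrCA.
rewrite ext_trace_sum; last by move=> i; exact: in_spanZ.
by apply: eq_bigr => i _; rewrite ext_traceZ.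
Qed.

Hypothesis char0 : [pchar k] =i pred0.

Lemma ext_dim_gt0 : (0 < n)%N.
Proof.
rewrite lt0n; apply/negP => /eqP n0; have /eqP := oner_neq0 W; apply.
by rewrite -(coordK span1) /lincomb big1 // => [[i hi]] _; exfalso; rewrite n0 in hi.
Qed.

(** A nonzero [w] orthogonal to everything would be orthogonal to its own inverse, but the trace of
    1 is [n], nonzero in characteristic 0. *)
Lemma ext_trace_nondeg w : in_span w ->
  (forall i, ext_trace (w * e i) = 0) -> w = 0.
Proof.
move=> hw h; apply/eqP; apply: contraT => w0.
have : ext_trace (w * w^-1) = 0.
  rewrite -[w^-1](coordK (in_spanV hw)) ext_trace_lincomb //.
  by apply: big1 => i _; rewrite h mulr0.
rewrite divff // /ext_trace mulmat1 mxtrace1 => /eqP.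
have /pcharf0P natr0 := char0; by rewrite natr0 eqn0Ngt ext_dim_gt0.
Qed.

Definition gram : 'M[k]_n := \matrix_(i, j) ext_trace (e i * e j).

Lemma mul_gram c : c *m gram = \row_j ext_trace (lincomb c * e j).
Proof.
apply/rowP => j; rewrite !mxE mulrC ext_trace_lincomb; last exact: in_span_basis.
by apply: eq_bigr => i _; rewrite !mxE [e j * _]mulrC.
Qed.

Lemma gram_unit : gram \in unitmx.
Proof.
rewrite -row_free_unit; apply: inj_row_free => c hc; apply: indep.
apply: ext_trace_nondeg; first by exists c.
by move=> i; move/rowP: hc => /(_ i); rewrite mul_gram !mxE.
Qed.

Lemma ext_trace_dual (b : 'rV[k]_n) :
  exists2 z, in_span z & forall i, ext_trace (z * e i) = b 0 i.
Proof.
exists (lincomb (b *m invmx gram)) => [|i]; first by exists (b *m invmx gram).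
have /rowP/(_ i) := mul_gram (b *m invmx gram).
by rewrite mulmxKV ?gram_unit // !mxE => ->.
Qed.

Section TraceDerivation.
Variables (dk : k -> k) (d : W -> W).
Hypotheses (dD : derivation d) (d_io : forall a, d (io a) = io (dk a)).
Hypothesis d_basis : forall i, in_span (d (e i)).

Lemma drv_lincomb c : d (lincomb c) =
  lincomb (map_mx dk c) + lincomb (c *m \matrix_i coord (d (e i))).
Proof.
rewrite mulmx_sum_row lincomb_sum /lincomb (drv_sum dD) -big_split /=.
apply: eq_bigr => i _; rewrite (drvM dD) d_io mxE; congr (_ + _).
by rewrite rowK -/(lincomb _) lincombZ coordK.
Qed.

Lemma in_span_drv w : in_span w -> in_span (d w).
Proof. by move=> [c ->]; rewrite drv_lincomb; apply: in_spanD; [exists (map_mx dk c)|exists (c *m \matrix_i coord (d (e i)))]. Qed.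

Lemma dk_add : {morph dk : a b / a + b}.
Proof. by move=> a b; apply: (fmorph_inj io); rewrite -d_io !rmorphD (drvD dD) !d_io. Qed.
Lemma dk0 : dk 0 = 0.
Proof. by apply: (addrI (dk 0)); rewrite -dk_add !addr0. Qed.

(** The matrix of [d w] is the entrywise derivative of the matrix of [w] plus a commutator with the
    matrix [N] of [d] on the basis, and commutators have trace 0. *)
Lemma ext_trace_drv w : in_span w -> ext_trace (d w) = dk (ext_trace w).
Proof.
move=> hw; set N := \matrix_i coord (d (e i)).
have -> : ext_trace (d w) = \tr (map_mx dk (mulmat w) + mulmat w *m N - N *m mulmat w).
  congr (\tr _); apply: mulmat_uniq => i.
  apply: (addIr (w * d (e i))); rewrite -(drvM dD) mulmatP // drv_lincomb.
  have -> : w * d (e i) = lincomb (row i N *m mulmat w).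
    by rewrite -mulr_lincomb // rowK coordK.
  rewrite -!lincombD -!row_mul -raddfD subrK raddfD; congr lincomb; congr (_ + _).
  by apply/rowP => j; rewrite !mxE.
rewrite mxtraceD mxtraceD raddfN /= mxtrace_mulC addrK /ext_trace /mxtrace.
rewrite (big_morph dk dk_add dk0); apply: eq_bigr => i _; by rewrite mxE.
Qed.
End TraceDerivation.
End FiniteExtension.

(** * Constants and linear disjointness *)

Section ConstantsDisjoint.
Variables (C N W : fieldType) (iN : {rmorphism C -> N}) (nu : {rmorphism N -> W}).
Variables (dN : N -> N) (d : W -> W).
Hypotheses (dD : derivation d) (d_nu : forall x, d (nu x) = nu (dN x)).
Hypothesis constN : forall x, dN x = 0 -> exists c, x = iN c.

(** The Wronskian argument: normalise the first coefficient to 1 and differentiate; the relation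
    gets shorter unless all its coefficients are constants. Working modulo an [N]-subspace [V]
    stable under [d] costs nothing: [V = 0] gives the usual disjointness, and a step of the pole
    filtration is used in [lead_indep_bound]. *)
Lemma constants_disjoint_mod (V : set W) l (g : nat -> W) (x : nat -> N) :
    (forall n u, V u -> V (nu n * u)) -> (forall u, V u -> V (d u)) ->
    (forall i, d (g i) = 0) -> (exists2 i, (i < l)%N & x i != 0) ->
    V (\sum_(i < l) g i * nu (x i)) ->
  exists2 c : nat -> C, (exists2 i, (i < l)%N & c i != 0) &
    V (\sum_(i < l) g i * nu (iN (c i))).
Proof.
move=> VM Vd; elim: l g x => [|l IH] g x g0 [i0 i0l xi0] rel; first by [].
have shift (y : nat -> N) : (exists2 i, (i < l)%N & y i.+1 != 0) ->
    V (\sum_(i < l) g i.+1 * nu (y i.+1)) ->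
    exists2 c : nat -> C, (exists2 i, (i < l.+1)%N & c i != 0) &
    V (\sum_(i < l.+1) g i * nu (iN (c i))).
  move=> y0 yrel.
  have [c [i il ci] crel] := IH _ (fun i => y i.+1) (fun i => g0 i.+1) y0 yrel.
  exists (fun i => if i is i'.+1 then c i' else 0); first by exists i.+1.
  by rewrite big_ord_recl /= !rmorph0 mulr0 add0r.
rewrite big_ord_recl in rel.
have [x00|x00] := eqVneq (x 0%N) 0.
  apply: (shift x).
    by case: i0 i0l xi0 => [|i] //; [rewrite x00 eqxx | exists i].
  by move: rel; rewrite x00 rmorph0 mulr0 add0r.
pose y i := x i / x 0%N.
have yrel : V (g 0%N + \sum_(i < l) g i.+1 * nu (y i.+1)).
  have := VM (x 0%N)^-1 _ rel; congr (V _).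
  rewrite mulrDr mulr_sumr mulrCA -rmorphM mulVf // rmorph1 mulr1; congr (_ + _).
  by apply: eq_bigr => i _; rewrite /y rmorphM; ring.
have [yconst | ] := pselect (forall i, (i < l)%N -> dN (y i.+1) = 0).
  have H i : exists c, (i < l)%N -> y i.+1 = iN c.
    case: (ltnP i l) => [il|]; last by exists 0.
    by have [c ->] := constN (yconst i il); exists c.
  have /choice[c Hc] := H.
  exists (fun i => if i is i'.+1 then c i' else 1); first by exists 0%N; rewrite ?oner_neq0.
  rewrite big_ord_recl /= !rmorph1 mulr1.
  by have := yrel; congr (V (_ + _)); apply: eq_bigr => i _; rewrite Hc.
move/existsNP=> [i /not_implyP[il /eqP dyi]].
apply: (shift (fun i => dN (y i))); first by exists i.
have := Vd _ yrel; rewrite (drvD dD) g0 add0r (drv_sum dD); congr (V _).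
by apply: eq_bigr => j _; rewrite (drvM dD) g0 mul0r add0r d_nu.
Qed.

Lemma constants_disjoint l (g : nat -> W) (x : nat -> N) :
    (forall i, d (g i) = 0) -> (exists2 i, (i < l)%N & x i != 0) ->
    \sum_(i < l) g i * nu (x i) = 0 ->
  exists2 c : nat -> C, (exists2 i, (i < l)%N & c i != 0) &
    \sum_(i < l) g i * nu (iN (c i)) = 0.
Proof.
apply: (@constants_disjoint_mod [set 0]) => [n u -> | u ->] /=; first by rewrite mulr0.
exact: drv0.
Qed.
End ConstantsDisjoint.

(** * The ring generated by two fields linearly disjoint over [C] *)

Section Compositum.
Variables (C K E W : fieldType) (iK : {rmorphism C -> K}) (iE : {rmorphism C -> E}).
Variables (a : {rmorphism E -> W}) (b : {rmorphism K -> W}).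
Hypothesis ab : forall c, a (iE c) = b (iK c).

(** A list of pairs is a formal sum of tensors; [comp_ring] is thus the image in [W] of the tensor
    product of [E] and [K] over [C]. *)
Definition comp_sum (s : seq (E * K)) : W := \sum_(p <- s) a p.1 * b p.2.
Definition comp_ring (w : W) : Prop := exists s, w = comp_sum s.

Lemma comp_ring0 : comp_ring 0.
Proof. by exists [::]; rewrite /comp_sum big_nil. Qed.
Lemma comp_ringD u v : comp_ring u -> comp_ring v -> comp_ring (u + v).
Proof. by move=> [s ->] [t ->]; exists (s ++ t); rewrite /comp_sum big_cat. Qed.
Lemma comp_ring_tensor e x : comp_ring (a e * b x).
Proof. by exists [:: (e, x)]; rewrite /comp_sum big_seq1. Qed.
Lemma comp_ring_sum I (r : seq I) (P : pred I) (F : I -> W) :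
  (forall i, P i -> comp_ring (F i)) -> comp_ring (\sum_(i <- r | P i) F i).
Proof. by move=> H; elim/big_ind: _ => //; [exact: comp_ring0 | exact: comp_ringD]. Qed.
Lemma comp_ringM u v : comp_ring u -> comp_ring v -> comp_ring (u * v).
Proof.
move=> [s ->] [t ->]; rewrite /comp_sum mulr_suml; apply: comp_ring_sum => p _.
rewrite mulr_sumr; apply: comp_ring_sum => q _.
by rewrite mulrACA -!rmorphM; exact: comp_ring_tensor.
Qed.
Lemma comp_ringl e : comp_ring (a e).
Proof. by rewrite -[a e]mulr1 -(rmorph1 b); exact: comp_ring_tensor. Qed.
Lemma comp_ringr x : comp_ring (b x).
Proof. by rewrite -[b x]mul1r -(rmorph1 a); exact: comp_ring_tensor. Qed.
Lemma comp_ring1 : comp_ring 1.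
Proof. by rewrite -(rmorph1 a); exact: comp_ringl. Qed.
Lemma comp_ringN u : comp_ring u -> comp_ring (- u).
Proof. by move=> hu; rewrite -mulN1r -(rmorphN1 a); apply: comp_ringM => //; exact: comp_ringl. Qed.
Lemma comp_ringB u v : comp_ring u -> comp_ring v -> comp_ring (u - v).
Proof. by move=> hu hv; apply: comp_ringD => //; exact: comp_ringN. Qed.
Lemma comp_ringX u n : comp_ring u -> comp_ring (u ^+ n).
Proof. by move=> hu; elim: n => [|n IH]; rewrite ?expr0 ?exprS; [exact: comp_ring1|exact: comp_ringM]. Qed.

Lemma comp_sum_coords m (y : 'I_m -> K) (s : seq (E * K)) :
  (forall p, p \in s -> exists r : 'I_m -> C, p.2 = \sum_j iK (r j) * y j) ->
  exists U : 'I_m -> E, comp_sum s = \sum_j a (U j) * b (y j).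
Proof.
elim: s => [|p s IH] H.
  by exists (fun=> 0); rewrite /comp_sum big_nil big1 // => j _; rewrite rmorph0 mul0r.
have [|U UE] := IH; first by move=> q qs; apply: H; rewrite inE qs orbT.
have [r rE] := H p (mem_head _ _).
exists (fun j => p.1 * iE (r j) + U j); rewrite /comp_sum big_cons -/(comp_sum s) UE rE.
rewrite rmorph_sum mulr_sumr -big_split; apply: eq_bigr => j _ /=.
by rewrite rmorphD !rmorphM /= ab; ring.
Qed.

Definition comp_frac : set W := [set w | exists u v,
  [/\ comp_ring u, comp_ring v, v != 0 & w = u / v]].

Lemma comp_frac_subfield : subfield comp_frac.
Proof.
split.
- by rewrite in_setE; exists 1, 1; rewrite oner_neq0 divr1; split=> //; exact: comp_ring1.
- move=> w w'; rewrite !in_setE => -[u [v [uR vR v0 ->]]] [u' [v' [uR' vR' v'0 ->]]].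
  exists (u * v' - u' * v), (v * v'); rewrite mulf_neq0 //; split=> //.
  + by apply: comp_ringB; exact: comp_ringM.
  + exact: comp_ringM.
  + by field; rewrite v0 v'0.
- move=> w w'; rewrite !in_setE => -[u [v [uR vR v0 ->]]] [u' [v' [uR' vR' v'0 ->]]].
  have [->|u'0] := eqVneq u' 0.
    exists 0, 1; rewrite oner_neq0 mul0r invr0 mulr0 mul0r.
    by split=> //; [exact: comp_ring0 | exact: comp_ring1].
  exists (u * v'), (v * u'); rewrite mulf_neq0 //; split; try exact: comp_ringM; first by [].
  by field; rewrite v0 v'0 u'0.
Qed.

Lemma comp_common_denominator (I : finType) (w : I -> W) : (forall i, comp_frac (w i)) ->
  exists r, [/\ comp_ring r, r != 0 & forall i, comp_ring (r * w i)].
Proof.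
move=> wF; have /choice[v Hv] i : exists v, [/\ comp_ring v, v != 0 & comp_ring (v * w i)].
  have [u [v [Ru Rv v0 ->]]] := wF i.
  by exists v; split=> //; rewrite mulrC divfK.
exists (\prod_i v i); split.
- by elim/big_ind: _ => [|u1 u2|i _]; [exact: comp_ring1 | exact: comp_ringM | have [] := Hv i].
- by apply/prodf_neq0 => i _; have [] := Hv i.
move=> i; rewrite (bigD1 i) //= mulrAC; apply: comp_ringM; first by have [] := Hv i.
by elim/big_ind: _ => [|u1 u2|j _]; [exact: comp_ring1 | exact: comp_ringM | have [] := Hv j].
Qed.

Variables (dK : K -> K) (d : W -> W).
Hypotheses (dD : derivation d).
Hypotheses (da : forall e, d (a e) = 0) (db : forall x, d (b x) = b (dK x)).
Hypothesis constK : forall x, dK x = 0 -> exists c, x = iK c.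

Lemma drv_comp_sum s : d (comp_sum s) = comp_sum [seq (p.1, dK p.2) | p <- s].
Proof.
rewrite /comp_sum (drv_sum dD) big_map; apply: eq_bigr => p _.
by rewrite (drvM dD) da mul0r add0r db.
Qed.
Lemma comp_ring_drv w : comp_ring w -> comp_ring (d w).
Proof. by move=> [s ->]; rewrite drv_comp_sum; eexists. Qed.

(** Induction on the number of tensors: a term whose right factor is not a constant can be
    eliminated with the help of [d w = 0]; when all right factors are constants they move into
    [E]. *)
Lemma comp_ring_kernel w : comp_ring w -> d w = 0 -> exists e, w = a e.
Proof.
move=> [s ->]; have [n] := ubnP (size s); elim: n s => // n IH s sn dw.
have [hs | ] := pselect (forall p, p \in s -> dK p.2 = 0).
  elim: s hs {sn dw} => [|[e x] s IHs] hs.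
    by exists 0; rewrite rmorph0 /comp_sum big_nil.
  have [p ps|e' He'] := IHs; first by apply: hs; rewrite inE ps orbT.
  have [//|c /= ->] := constK (hs (e, x) _); first by rewrite mem_head.
  exists (e * iE c + e').
  by rewrite /comp_sum big_cons -/(comp_sum _) He' rmorphD rmorphM ab.
move=> /existsNP[[e x]] /not_implyP[/= /perm_to_rem ps /eqP dx].
have sz : (size (rem (e, x) s) < n)%N by move: (perm_size ps) sn => /= ->.
have splitE F : \sum_(p <- s) F p = F (e, x) + \sum_(p <- rem (e, x) s) F p :> W.
  by rewrite (perm_big _ ps) big_cons.
(* Subtracting [b (x / dK x) * d w], which is 0, cancels the term [(e, x)] and alters only the right
   factors of the others. *)
pose s' := [seq (p.1, p.2 - x * (dK p.2 / dK x)) | p <- rem (e, x) s].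
have -> : comp_sum s = comp_sum s'.
  have : comp_sum s = comp_sum s - b (x / dK x) * d (comp_sum s) by rewrite dw mulr0 subr0.
  rewrite drv_comp_sum /comp_sum !big_map !splitE /= => ->.
  rewrite mulrDr mulr_sumr opprD addrACA -sumrB.
  rewrite [X in X + _](_ : _ = 0) ?add0r.
    by apply: eq_bigr => p _; rewrite rmorphB !rmorphM !fmorphV; ring.
  by rewrite mulrCA -rmorphM divfK // subrr.
apply: IH; first by rewrite size_map.
rewrite -dw; congr (d _).
have : comp_sum s = comp_sum s - b (x / dK x) * d (comp_sum s) by rewrite dw mulr0 subr0.
rewrite drv_comp_sum /comp_sum !big_map !splitE /= => ->.
rewrite mulrDr mulr_sumr opprD addrACA -sumrB.
rewrite [X in _ = X + _](_ : _ = 0) ?add0r.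
  by apply: eq_bigr => p _; rewrite rmorphB !rmorphM !fmorphV; ring.
by rewrite mulrCA -rmorphM divfK // subrr.
Qed.

(* [comp_ring] has no proper nonzero [d]-stable ideal: differentiating a shortest
   nonzero element normalised to have a leading [b 1] shortens it. *)
Lemma comp_ring_simple (J : set W) :
    (forall u v, J u -> J v -> J (u + v)) ->
    (forall r u, comp_ring r -> J u -> J (r * u)) ->
    (forall u, J u -> comp_ring u) -> (forall u, J u -> J (d u)) ->
  (exists2 u, J u & u != 0) -> J 1.
Proof.
move=> JD JM JR Jd [u Ju u0]; have [s us] := JR _ Ju.
have [n] := ubnP (size s); elim: n s u us Ju u0 => // n IH s u us Ju u0.
case: s us => [|[e x] s] us sn; first by rewrite us /comp_sum big_nil eqxx in u0.
have [x0|x0] := eqVneq x 0.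
  apply: (IH s u) => //; by rewrite us /comp_sum big_cons x0 rmorph0 mulr0 add0r.
pose v := b x^-1 * u.
have Jv : J v by apply: JM => //; exact: comp_ringr.
have v0 : v != 0 by rewrite mulf_neq0 // fmorph_eq0 invr_eq0.
have vE : v = comp_sum ((e, 1) :: [seq (p.1, p.2 / x) | p <- s]).
  rewrite /v us /comp_sum !big_cons big_map /= mulrDr mulr_sumr.
  rewrite mulrCA -rmorphM mulVf //; congr (_ + _).
  by apply: eq_bigr => p _; rewrite rmorphM; ring.
have [dv0|dv0] := eqVneq (d v) 0.
  have [e' ve] := comp_ring_kernel (JR _ Jv) dv0.
  rewrite -(mulVf v0); apply: JM => //.
  by rewrite ve -fmorphV; exact: comp_ringl.
have dK1 : dK 1 = 0 by apply: (fmorph_inj b); rewrite -db !rmorph1 rmorph0 (drv1 dD).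
apply: (IH [seq (p.1, dK (p.2 / x)) | p <- s] (d v)) => //; last by rewrite size_map.
  rewrite vE drv_comp_sum /comp_sum /= big_cons !big_map /= dK1 rmorph0 mulr0 add0r.
  by [].
exact: Jd.
Qed.

Lemma linear_disjoint l (e : nat -> E) (x : nat -> K) :
    (exists2 i, (i < l)%N & x i != 0) -> \sum_(i < l) a (e i) * b (x i) = 0 ->
  exists2 c : nat -> C, (exists2 i, (i < l)%N & c i != 0) & \sum_(i < l) e i * iE (c i) = 0.
Proof.
move=> x0 rel.
have [c c0 crel] := constants_disjoint dD db constK (fun i => da (e i)) x0 rel.
exists c => //; apply: (fmorph_inj a); rewrite rmorph0 -[RHS]crel rmorph_sum.
by apply: eq_bigr => i _; rewrite rmorphM ab.
Qed.

(** Linear disjointness in the form used to specialize coefficients: an assignment of [y i] to [e i]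
    that respects the [C]-linear relations also respects the [K]-linear ones. An [e j'] that depends
    on the others over [C] is eliminated from both sides. *)
Lemma comp_functional l (e : 'I_l -> E) (y : 'I_l -> K) :
    (forall c : 'I_l -> C, \sum_i e i * iE (c i) = 0 -> \sum_i y i * iK (c i) = 0) ->
  forall x : 'I_l -> K, \sum_i a (e i) * b (x i) = 0 -> \sum_i y i * x i = 0.
Proof.
elim: l e y => [|l IH] e y H x rel; first by rewrite big_ord0.
have [x0 | ] := pselect (forall i, x i = 0).
  by apply: big1 => i _; rewrite x0 mulr0.
move=> /existsNP[i0 /eqP xi0].
have [||c [j jl cj] crel] := @linear_disjoint l.+1 (fun i => e (inord i)) (fun i => x (inord i)).
- by exists i0 => //; rewrite inord_val.
- by rewrite -[RHS]rel; apply: eq_bigr => i _; rewrite inord_val.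
pose j' := Ordinal jl; pose g (i : 'I_l.+1) := c (nat_of_ord i) / c j.
have split (V : nmodType) (F : 'I_l.+1 -> V) : \sum_i F i = F j' + \sum_i F (lift j' i).
  by rewrite (bigD1_ord j').
have grel : \sum_i e i * iE (g i) = 0.
  apply: (mulIf (x := iE (c j))); first by rewrite fmorph_eq0.
  rewrite mul0r -[RHS]crel mulr_suml; apply: eq_bigr => i _.
  by rewrite inord_val -mulrA -rmorphM divfK.
have gj : g j' = 1 by rewrite /g divff.
have ej : e j' = - \sum_i e (lift j' i) * iE (g (lift j' i)).
  by apply/eqP; rewrite -addr_eq0; apply/eqP; rewrite -[RHS]grel split gj rmorph1 mulr1.
have yj : y j' = - \sum_i y (lift j' i) * iK (g (lift j' i)).
  by apply/eqP; rewrite -addr_eq0; apply/eqP; rewrite -[RHS](H _ grel) split gj rmorph1 mulr1.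
rewrite split yj mulNr mulr_suml addrC -sumrB.
rewrite (eq_bigr (fun i => y (lift j' i) * (x (lift j' i) - iK (g (lift j' i)) * x j'))); last first.
  by move=> i _; ring.
apply: (IH (fun i => e (lift j' i)) (fun i => y (lift j' i)) _
           (fun i => x (lift j' i) - iK (g (lift j' i)) * x j')).
  move=> h hrel.
  pose h' i := if unlift j' i is Some i' then h i' else 0.
  have := H h'; rewrite !split /h' unlift_none !rmorph0 !mulr0 !add0r.
  have liftE (V : nmodType) (F : 'I_l -> C -> V) :
      \sum_i F i (if unlift j' (lift j' i) is Some i' then h i' else 0) = \sum_i F i (h i).
    by apply: eq_bigr => i _; rewrite liftK.
  by rewrite (liftE _ (fun i c => e (lift j' i) * iE c)) (liftE _ (fun i c => y (lift j' i) * iK c)); apply.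
rewrite -[RHS]rel split ej rmorphN mulNr rmorph_sum mulr_suml addrC -sumrB.
by apply: eq_bigr => i _; rewrite rmorphB !rmorphM !ab; ring.
Qed.
End Compositum.

Lemma constants_disjoint_fin (C N W : fieldType) (iN : {rmorphism C -> N})
    (nu : {rmorphism N -> W}) (dN : N -> N) (d : W -> W) :
    derivation d -> (forall x, d (nu x) = nu (dN x)) ->
    (forall x, dN x = 0 -> exists c, x = iN c) ->
  forall (I : finType) (g : I -> W) (x : I -> N),
    (forall i, d (g i) = 0) -> \sum_i g i * nu (x i) = 0 -> (exists i, x i != 0) ->
  exists2 c : I -> C, (exists i, c i != 0) & \sum_i g i * nu (iN (c i)) = 0.
Proof.
move=> dD d_nu constN I g x g0 rel [i0 xi0].
pose f (m : nat) := nth i0 (enum I) m.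
have fE (i : I) : f (enum_rank i) = i by rewrite /f nth_enum_rank.
have sumE (F : I -> W) : \sum_i F i = \sum_(m < #|I|) F (f m).
  rewrite (reindex (@enum_val I predT)) /=; last by apply: onW_bij; exact: enum_val_bij.
  by apply: eq_bigr => m _; congr F; rewrite /f; exact: enum_val_nth.
have [|||c [m ml cm] crel] := constants_disjoint dD d_nu constN
    (l := #|I|) (g := fun m => g (f m)) (x := fun m => x (f m)).
- by move=> m.
- by exists (enum_rank i0); rewrite ?fE.
- by rewrite -(sumE (fun i => g i * nu (x i))).
exists (fun i => c (enum_rank i)).
  by exists (enum_val (Ordinal ml)); rewrite enum_valK.
rewrite sumE -[RHS]crel; apply: eq_bigr => i _; congr (_ * nu (iN (c _))).
by rewrite /f -(enum_val_nth i0) enum_valK.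
Qed.

(** * Polynomials over an extension of an algebraically closed field *)

Section ClosedField.
Variables (C : fieldType).
Hypothesis closedC : GRing.closed_field_axiom C.

Lemma closed_root (p : {poly C}) : (1 < size p)%N -> exists x, root p x.
Proof.
move=> sp; set n := (size p).-1.
have n0 : (0 < n)%N by rewrite /n; case: (size p) sp => [|[|]].
have lc0 : lead_coef p != 0 by rewrite lead_coef_eq0 -size_poly_gt0 ltnW.
have [x xn] := closedC (fun i => - p`_i / lead_coef p) n0.
exists x; rewrite /root horner_coef.
have -> : size p = n.+1 by rewrite /n prednK // ltnW.
rewrite big_ord_recr /= -[p`_n]/(lead_coef p) xn mulr_sumr -big_split /=.
by apply/eqP/big1 => i _; field.
Qed.

Variables (E : fieldType) (iE : {rmorphism C -> E}).

(** Separates the part of a denominator that becomes a unit once [C[t]] is inverted from a part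
    coprime to all nonzero polynomials over [C], which is the one that has to be excluded in
    [B0_integral]. *)
Lemma split_const_roots (Q : {poly E}) : Q != 0 ->
  exists (q : {poly C}) (R : {poly E}),
    [/\ q != 0, Q = map_poly iE q * R & forall c, ~~ root R (iE c)].
Proof.
have [n] := ubnP (size Q); elim: n Q => // n IH Q sQ Q0.
have [[c /factor_theorem[R QE]] | noroot] := pselect (exists c, root Q (iE c)); last first.
  exists 1, Q; split; rewrite ?oner_neq0 ?rmorph1 ?mul1r // => c.
  by apply/negP => rc; apply: noroot; exists c.
have R0 : R != 0 by apply: contraNneq Q0 => R0; rewrite QE R0 mul0r.
have [|q [S [q0 RE Sc]]] := IH R _ R0.
  by move: sQ; rewrite QE size_Mmonic ?monicXsubC // size_XsubC addnC.
exists (('X - c%:P) * q), S; split => //.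
  by rewrite mulf_neq0 // polyXsubC_eq0.
by rewrite rmorphM rmorphB /= map_polyX map_polyC QE RE /=; ring.
Qed.

Lemma no_const_root_coprime (R : {poly E}) (q : {poly C}) :
  (forall c, ~~ root R (iE c)) -> q != 0 -> coprimep R (map_poly iE q).
Proof.
move=> Rc; have [n] := ubnP (size q); elim: n q => // n IH q sq q0.
have [sq1 | /closed_root[c /factor_theorem[q' qE]]] := leqP (size q) 1%N.
  have /eqP : size q = 1%N by apply/eqP; rewrite eqn_leq sq1 size_poly_gt0.
  move/size_poly1P => [c c0 ->].
  by rewrite map_polyC /= -[(iE c)%:P]mulr1 mul_polyC coprimepZr ?fmorph_eq0 // coprimep1.
have q'0 : q' != 0 by apply: contraNneq q0 => q'0; rewrite qE q'0 mul0r.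
rewrite qE rmorphM rmorphB /= map_polyX map_polyC coprimepMr IH //=.
  by rewrite coprimep_XsubC Rc.
by move: sq; rewrite qE size_Mmonic ?monicXsubC // size_XsubC addnC.
Qed.
End ClosedField.

(** * Denominators in the compositum *)

(* [W] is the compositum of [E] and [K], [D] its total derivation, and [d] the [E]-linear
   derivation extending that of [K]. *)
Record bidifferential (C K E W : fieldType) (iK : {rmorphism C -> K})
    (iE : {rmorphism C -> E}) (a : {rmorphism E -> W}) (b : {rmorphism K -> W})
    (dK : K -> K) (dE : E -> E) (D d : W -> W) : Prop := Bidifferential {
  bd_ab : forall c, a (iE c) = b (iK c);
  bd_derD : derivation D;
  bd_derd : derivation d;
  bd_Da : forall e, D (a e) = a (dE e);
  bd_Db : forall x, D (b x) = b (dK x);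
  bd_da : forall e, d (a e) = 0;
  bd_db : forall x, d (b x) = b (dK x);
  bd_comm : forall w, D (d w) = d (D w);
  bd_constE : forall e, dE e = 0 -> exists c, e = iE c;
  bd_constK : forall x, dK x = 0 -> exists c, x = iK c;
  bd_frac : forall w, exists u v,
    [/\ comp_ring a b u, comp_ring a b v, v != 0 & w = u / v]
}.

(** The elements [bas j] form a basis of [K] over [C(t)]; clearing denominators lets this be said
    with polynomials evaluated at [t]. *)
Record finite_over_rational (C K : fieldType) (iK : {rmorphism C -> K}) (t : K) n
    (bas : 'I_n -> K) : Prop := FiniteOverRational {
  fr_span : forall x, exists (p : 'I_n -> {poly C}) (q : {poly C}),
    q != 0 /\ x * (map_poly iK q).[t] = \sum_j (map_poly iK (p j)).[t] * bas j;
  fr_indep : forall p : 'I_n -> {poly C},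
    \sum_j (map_poly iK (p j)).[t] * bas j = 0 -> forall j, p j = 0
}.

Section RationalSubfield.
Variables (C K E W : fieldType) (iK : {rmorphism C -> K}) (iE : {rmorphism C -> E}).
Variables (a : {rmorphism E -> W}) (b : {rmorphism K -> W}).
Variables (dK : K -> K) (dE : E -> E) (D d : W -> W).
Hypothesis bd : bidifferential iK iE a b dK dE D d.
Hypotheses (closedC : GRing.closed_field_axiom C) (char0 : [pchar C] =i pred0).
Variables (t : K) (n : nat) (bas : 'I_n -> K).
Hypothesis fr : finite_over_rational iK t bas.
Hypothesis transT : forall p : {poly E}, (map_poly a p).[b t] = 0 -> p = 0.

Local Notation R := (comp_ring a b).

Definition evT : {poly E} -> W := horner_eval (b t) \o map_poly a.
HB.instance Definition _ := GRing.RMorphism.copy evT (horner_eval (b t) \o map_poly a).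
Definition evC : {poly C} -> K := horner_eval t \o map_poly iK.
HB.instance Definition _ := GRing.RMorphism.copy evC (horner_eval t \o map_poly iK).
Arguments evT : simpl never.
Arguments evC : simpl never.

Lemma b_evC q : b (evC q) = evT (map_poly iE q).
Proof.
rewrite /evT /evC /= /horner_eval -horner_map -!map_poly_comp; congr (_.[_]).
by apply: eq_map_poly => c /=; rewrite (bd_ab bd).
Qed.
Lemma evT_inj : injective evT.
Proof.
move=> p q pq; apply/eqP; rewrite -subr_eq0; apply/eqP/transT.
by rewrite -[LHS]/(evT (p - q)) rmorphB /= pq subrr.
Qed.
Lemma evT_eq0 p : (evT p == 0) = (p == 0).
Proof. by rewrite -(inj_eq evT_inj) rmorph0. Qed.
Lemma evT_ring p : R (evT p).
Proof.
rewrite /evT /= /horner_eval horner_coef; apply: comp_ring_sum => i _.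
by rewrite coef_map -rmorphXn; exact: comp_ring_tensor.
Qed.

(** * Coordinates over [E(t)], represented by the abstract field [k] *)

Section RationalType.
Variables (k : fieldType) (io : {rmorphism k -> W}).
Hypothesis ioP : forall w, frac_image evT w <-> exists x, io x = w.

Lemma char0k : [pchar k] =i pred0.
Proof.
move=> p; rewrite -(char0 p) !inE; congr (_ && _).
by rewrite -(fmorph_eq0 io) -(fmorph_eq0 iE) -(fmorph_eq0 a) !rmorph_nat.
Qed.

Definition wbas j : W := b (bas j).

(** The difference [dl] of [D] and [d] kills [b K] and restricts to [dE] on [E]. The elements
    [t ^+ l * bas j] are therefore constants of [dl], and a relation between them over [E] yields
    one over [C]. *)
Lemma poly_indep (P : 'I_n -> {poly E}) :
  \sum_j evT (P j) * wbas j = 0 -> forall j, P j = 0.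
Proof.
move=> rel; have [//|/existsNP[j0 Pj0]] := pselect (forall j, P j = 0).
pose S := \max_j size (P j).
have PS j : (size (P j) <= S.+1)%N by apply: leqW; exact: leq_bigmax.
pose dl w := D w - d w.
have dlD : derivation dl.
  split=> u v; rewrite /dl ?(drvD (bd_derD bd)) ?(drvD (bd_derd bd)).
    by ring.
  by rewrite (drvM (bd_derD bd)) (drvM (bd_derd bd)); ring.
pose g (p : 'I_n * 'I_S.+1) : W := b (t ^+ p.2 * bas p.1).
pose x (p : 'I_n * 'I_S.+1) := (P p.1)`_p.2.
have [|||| c [[j l] cjl] crel] := @constants_disjoint_fin _ _ _ iE a dE dl dlD _ (bd_constE bd) _ g x.
- by move=> e; rewrite /dl (bd_Da bd) (bd_da bd) subr0.
- by move=> p; rewrite /dl (bd_Db bd) (bd_db bd) subrr.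
- rewrite -[RHS]rel -(pair_bigA _ (fun j l => g (j, l) * a (x (j, l)))) /=.
  apply: eq_bigr => j _; rewrite /evT /= /horner_eval (horner_coef_wide _ (n := S.+1)) ?size_map_poly //.
  rewrite mulr_suml; apply: eq_bigr => l _.
  by rewrite /g /x /wbas coef_map rmorphM rmorphXn /=; ring.
- have /eqP := Pj0; rewrite -lead_coef_eq0 => lc.
  have sz : ((size (P j0)).-1 < S.+1)%N by rewrite (leq_ltn_trans (leq_pred _)) // ltnS; exact: leq_bigmax.
  by exists (j0, Ordinal sz).
have : \sum_j (map_poly iK (\poly_(l < S.+1) c (j, inord l))).[t] * bas j = 0.
  apply: (fmorph_inj b); rewrite rmorph0 -[RHS]crel rmorph_sum.
  transitivity (\sum_j \sum_l g (j, l) * a (iE (c (j, l)))); last first.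
    by rewrite pair_bigA; apply: eq_bigr => -[].
  apply: eq_bigr => j' _; rewrite (horner_coef_wide _ (n := S.+1)); last first.
    by rewrite (leq_trans (size_poly _ _)) ?size_poly.
  rewrite mulr_suml rmorph_sum; apply: eq_bigr => l' _.
  rewrite coef_map coef_poly ltn_ord (bd_ab bd) /g -rmorphM; congr (b _).
  by rewrite inord_val /=; ring.
move=> /(fr_indep fr)/(_ j)/polyP/(_ l); rewrite coef_poly ltn_ord coef0 inord_val.
by move/eqP; rewrite (negbTE cjl).
Qed.

Lemma wbas_indep (c : 'rV[k]_n) : lincomb io wbas c = 0 -> c = 0.
Proof.
move=> rel; have [P [Q [Q0 cE]]] := common_denominator evT_inj ioP (fun j => c 0 j).
have Pz := @poly_indep P.
apply/rowP => j; apply: (fmorph_inj io); rewrite mxE rmorph0 cE Pz ?rmorph0 ?mul0r //.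
transitivity (evT Q * lincomb io wbas c); last by rewrite rel mulr0.
rewrite mulr_sumr; apply: eq_bigr => i _; rewrite cE; field.
by rewrite evT_eq0.
Qed.

Definition evq (q : {poly C}) : W := evT (map_poly iE q).
HB.instance Definition _ := GRing.RMorphism.copy evq (evT \o map_poly iE).
Arguments evq : simpl never.
Lemma evq_eq0 q : (evq q == 0) = (q == 0).
Proof. by rewrite evT_eq0 map_poly_eq0. Qed.
Lemma evq_b q : evq q = b (evC q). Proof. by rewrite b_evC. Qed.

(** [B0] is [E[t]] with the nonzero elements of [C[t]] inverted, and [Ct] is [C(t)]. By
    [ring_coords] and [coords_ring], membership in [R] means having coordinates in [B0]. *)
Definition semirational (c : k) : Prop := exists P q, q != 0 /\ io c = evT P / evq q.
Definition const_rational (c : k) : Prop := exists p q, q != 0 /\ io c = evq p / evq q.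
Local Notation B0 := semirational.
Local Notation Ct := const_rational.

Lemma Ct_B0 c : Ct c -> B0 c.
Proof. by move=> [p [q [q0 e]]]; exists (map_poly iE p), q. Qed.
Lemma io_ringP c : B0 c -> R (io c).
Proof.
move=> [P [q [q0 ->]]]; apply: comp_ringM; first exact: evT_ring.
by rewrite evq_b -fmorphV; exact: comp_ringr.
Qed.
Lemma B0_poly P : exists2 c, B0 c & io c = evT P.
Proof.
have [c cE] := frac_image_ev ioP P; exists c => //; exists P, 1.
by rewrite oner_neq0 rmorph1 divr1.
Qed.

Lemma B0_D u v : B0 u -> B0 v -> B0 (u + v).
Proof.
move=> [P [q [q0 e]]] [P' [q' [q'0 e']]].
exists (P * map_poly iE q' + P' * map_poly iE q), (q * q'); rewrite mulf_neq0 //; split=> //.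
by rewrite rmorphD e e' !(rmorphM, rmorphD) /= -!/(evq _); field; rewrite !evq_eq0 q0 q'0.
Qed.
Lemma B0_M u v : B0 u -> B0 v -> B0 (u * v).
Proof.
move=> [P [q [q0 e]]] [P' [q' [q'0 e']]].
exists (P * P'), (q * q'); rewrite mulf_neq0 //; split=> //.
by rewrite !rmorphM e e' /=; field; rewrite !evq_eq0 q0 q'0.
Qed.
Lemma Ct_D u v : Ct u -> Ct v -> Ct (u + v).
Proof.
move=> [P [q [q0 e]]] [P' [q' [q'0 e']]].
exists (P * q' + P' * q), (q * q'); rewrite mulf_neq0 //; split=> //.
by rewrite rmorphD e e' !(rmorphM, rmorphD) /=; field; rewrite !evq_eq0 q0 q'0.
Qed.
Lemma Ct_M u v : Ct u -> Ct v -> Ct (u * v).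
Proof.
move=> [P [q [q0 e]]] [P' [q' [q'0 e']]].
exists (P * P'), (q * q'); rewrite mulf_neq0 //; split=> //.
by rewrite !rmorphM e e' /=; field; rewrite !evq_eq0 q0 q'0.
Qed.
Lemma Ct_N1 : Ct (-1).
Proof. by exists (-1), 1; rewrite oner_neq0 !rmorphN !rmorph1 /= divr1. Qed.
Lemma Ct_1 : Ct 1.
Proof. by exists 1, 1; rewrite oner_neq0 !rmorph1 divr1. Qed.
Lemma Ct_V u : Ct u -> Ct u^-1.
Proof.
move=> [P [q [q0 e]]]; have [P0|P0] := eqVneq P 0.
  exists 0, 1; rewrite oner_neq0 fmorphV e P0 !rmorph0 !mul0r invr0; split=> //.
by exists q, P; split=> //; rewrite fmorphV e; field; rewrite !evq_eq0 q0 P0.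
Qed.

Lemma sub_det (S : k -> Prop) m (M : 'M[k]_m) :
    (forall u v, S u -> S v -> S (u + v)) -> (forall u v, S u -> S v -> S (u * v)) ->
    S 1 -> S (-1) -> (forall i j, S (M i j)) -> S (\det M).
Proof.
move=> SD SM S1 SN SMij; have S0 : S 0 by rewrite -(subrr 1); apply: SD.
rewrite /determinant; elim/big_ind: _ => // s _; apply: (SM).
  by case: (perm.odd_perm s); rewrite ?expr1 ?expr0.
by elim/big_ind: _ => // u v; exact: SM.
Qed.
Lemma B0_1 : B0 1. Proof. exact/Ct_B0/Ct_1. Qed.
Lemma B0_N1 : B0 (-1). Proof. exact/Ct_B0/Ct_N1. Qed.
Lemma B0_0 : B0 0. Proof. rewrite -(subrr 1); exact: B0_D B0_1 B0_N1. Qed.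
Lemma B0_sum I (r : seq I) (P : pred I) (F : I -> k) :
  (forall i, P i -> B0 (F i)) -> B0 (\sum_(i <- r | P i) F i).
Proof. by move=> H; elim/big_ind: _ => //; [exact: B0_0 | exact: B0_D]. Qed.
Lemma Ct_0 : Ct 0. Proof. rewrite -(subrr 1); exact: Ct_D Ct_1 Ct_N1. Qed.

Lemma b_coords x : exists2 c, b x = lincomb io wbas c & forall j, Ct (c 0 j).
Proof.
have [p [q [q0 xq]]] := fr_span fr x.
have Q0 : map_poly iE q != 0 by rewrite map_poly_eq0.
have /choice[f Hf] j : exists c, io c = evq (p j) / evq q by exact: (frac_image_ex ioP).
exists (\row_j f j) => [|j]; last by exists (p j), q; rewrite mxE Hf.
apply: (mulIf (x := evq q)); first by rewrite evq_eq0.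
transitivity (b (\sum_j evC (p j) * bas j)); first by rewrite evq_b -rmorphM; congr (b _).
rewrite rmorph_sum /lincomb mulr_suml; apply: eq_bigr => j _.
by rewrite mxE Hf rmorphM -evq_b /wbas; field; rewrite evq_eq0.
Qed.

Lemma span1 : in_span io wbas 1.
Proof. by have [c e _] := b_coords 1; exists c; rewrite -e rmorph1. Qed.
Lemma spanM_basis i j : in_span io wbas (wbas i * wbas j).
Proof. by rewrite /wbas -rmorphM; have [c e _] := b_coords (bas i * bas j); exists c. Qed.

Lemma ring_coords w : R w -> exists2 c, w = lincomb io wbas c & forall j, B0 (c 0 j).
Proof.
move=> [s ->]; rewrite /comp_sum; elim: s => [|[e x] s [c cE cB]].
  by exists 0; rewrite ?big_nil ?lincomb0 // => j; rewrite mxE; exact: B0_0.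
have [c' c'E c'C] := b_coords x; have [z zB zE] := B0_poly e%:P.
exists (z *: c' + c) => [|j].
  rewrite big_cons cE lincombD lincombZ zE c'E.
  by rewrite /evT /= /horner_eval map_polyC hornerC.
by rewrite !mxE; apply: B0_D => //; apply: B0_M => //; exact: Ct_B0.
Qed.

Lemma coords_ring (c : 'rV[k]_n) : (forall j, B0 (c 0 j)) -> R (lincomb io wbas c).
Proof.
move=> H; apply: comp_ring_sum => j _; apply: comp_ringM; last exact: comp_ringr.
exact: io_ringP.
Qed.

Lemma span_full w : in_span io wbas w.
Proof.
have [u [v [uR vR v0 ->]]] := bd_frac bd w.
have [c cE _] := ring_coords uR; have [c' c'E _] := ring_coords vR.
apply: in_spanM => //; [exact: spanM_basis | by exists c |].
by apply: in_spanV => //; [exact: wbas_indep|exact: span1|exact: spanM_basis|exists c'].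
Qed.

Local Notation mulmatW := (mulmat io wbas).

Lemma mulmatW_B0 w i j : R w -> B0 (mulmatW w i j).
Proof.
move=> Rw; rewrite mxE; have [|c -> cB] := @ring_coords (w * wbas i).
  by apply: comp_ringM => //; exact: comp_ringr.
by rewrite lincombK //; exact: wbas_indep.
Qed.
Lemma mulmatW_Ct x i j : Ct (mulmatW (b x) i j).
Proof.
rewrite mxE /wbas -rmorphM; have [c -> cC] := b_coords (x * bas i).
by rewrite lincombK //; exact: wbas_indep.
Qed.
Lemma det_mulmatW_B0 w : R w -> B0 (\det (mulmatW w)).
Proof. by move=> Rw; apply: sub_det B0_D B0_M B0_1 B0_N1 _ => i j; exact: mulmatW_B0. Qed.

(** [B0] is completely integrally closed. In lowest terms the denominator of [beta] is a polynomial
    over [C] times some [S] without roots in [C], and a fixed numerator [Dl] would have to be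
    divisible by large powers of [S]. *)
Lemma B0_integral delta beta : B0 delta -> delta != 0 ->
  (forall m, B0 (delta * beta ^+ m)) -> B0 beta.
Proof.
move=> [Dl [q0 [q00 dE']]] delta0 Bm.
have Dl0 : Dl != 0.
  by apply: contraNneq delta0 => Dl0; rewrite -(fmorph_eq0 io) dE' Dl0 rmorph0 mul0r.
have [P0 [Q0 [Q00 bE]]] := frac_imageP ioP beta.
pose g := gcdp P0 Q0; pose P := P0 %/ g; pose Q := Q0 %/ g.
have g0 : g != 0 by rewrite gcdp_eq0 negb_and Q00 orbT.
have P0E : P0 = P * g by rewrite divpK // dvdp_gcdl.
have Q0E : Q0 = Q * g by rewrite divpK // dvdp_gcdr.
have Q1 : Q != 0 by apply: contraNneq Q00 => Q1; rewrite Q0E Q1 mul0r.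
have cop : coprimep P Q by rewrite coprimep_div_gcd // Q00 orbT.
have {}bE : io beta = evT P / evT Q.
  by rewrite bE P0E Q0E !rmorphM /=; field; rewrite !evT_eq0 Q1 g0.
have [qc [S [qc0 QE Sroot]]] := split_const_roots iE Q1.
(* This exponent exceeds the degree of [Dl], so a divisor [S ^+ m] of [Dl] forces [S] to be a
   constant. *)
pose m := size Dl.
have [S' [q1 [q10 eqm]]] := Bm m.
have polyeq : Dl * (P ^+ m * map_poly iE q1) = S' * map_poly iE q0 * Q ^+ m.
  apply: evT_inj; rewrite !rmorphM !rmorphXn /= -/(evq q1) -/(evq q0).
  move: eqm; rewrite rmorphM rmorphXn dE' bE => eqm.
  have : evT Dl / evq q0 * (evT P / evT Q) ^+ m * (evq q1 * evq q0 * evT Q ^+ m)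
       = evT S' / evq q1 * (evq q1 * evq q0 * evT Q ^+ m) by rewrite eqm.
  rewrite expr_div_n => eqm'.
  have Qm0 : evT Q ^+ m != 0 by rewrite expf_neq0 // evT_eq0.
  transitivity (evT Dl / evq q0 * (evT P ^+ m / evT Q ^+ m) * (evq q1 * evq q0 * evT Q ^+ m)).
    by field; rewrite Qm0 evq_eq0.
  by rewrite eqm'; field; rewrite evq_eq0.
have copS : coprimep (S ^+ m) (P ^+ m * map_poly iE q1).
  rewrite coprimepMr; apply/andP; split; apply: coprimep_expl; last first.
    exact: no_const_root_coprime.
  apply: coprimep_expr; rewrite coprimep_sym; apply: coprimep_dvdl cop.
  by rewrite QE dvdp_mull.
have S0 : S != 0 by apply: contraNneq Q1 => S0; rewrite QE S0 mulr0.
have : S ^+ m %| Dl.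
  rewrite -(Gauss_dvdpl _ copS) polyeq QE exprMn !mulrA; exact: dvdp_mull.
move=> /(dvdp_leq Dl0); rewrite -/m => szS.
have sz1 : (size S <= 1)%N.
  have := size_exp S m; have S1 : (0 < size S)%N by rewrite size_poly_gt0.
  have m0 : (0 < m)%N by rewrite size_poly_gt0.
  have Sm0 : (0 < size (S ^+ m))%N by rewrite size_poly_gt0 expf_neq0.
  move: szS; rewrite -{1}(prednK Sm0) => szS E1; rewrite E1 in szS.
  rewrite leqNgt; apply/negP => sz2.
  have : (m <= (size S).-1 * m)%N by rewrite leq_pmull // -ltnS prednK.
  by move/(leq_trans szS); rewrite ltnn.
exists ((S`_0)^-1 *: P), qc; split=> //.
have SE : S = (S`_0)%:P by exact: size1_polyC.
have s0 : S`_0 != 0 by rewrite -polyC_eq0 -SE.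
rewrite bE QE SE coefC eqxx -mul_polyC !rmorphM /= -/(evq qc).
have -> : evT ((S`_0)^-1)%:P = (evT (S`_0)%:P)^-1.
  apply: (mulfI (x := evT (S`_0)%:P)); first by rewrite evT_eq0 polyC_eq0.
  rewrite divff ?evT_eq0 ?polyC_eq0 //.
  by rewrite -rmorphM -polyCM divff // rmorph1.
by field; rewrite evq_eq0 qc0 evT_eq0 polyC_eq0 s0.
Qed.

Definition almost_integral (w : W) : Prop :=
  exists d0, [/\ R d0, d0 != 0 & forall m, R (d0 * w ^+ m)].

(** The norm is multiplicative, so the norm of [d0] is a common denominator of all powers of the
    norm of [w]. The trace has no such property and is recovered from the norms of [m - w]. *)
Lemma almost_integral_det w : almost_integral w -> B0 (\det (mulmatW w)).
Proof.
move=> [d0 [Rd d00 Rm]]; apply: (@B0_integral (\det (mulmatW d0))).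
- exact: det_mulmatW_B0.
- rewrite -unitfE -unitmxE; apply: mulmat_unit d00.
  + exact: wbas_indep.
  + exact: spanM_basis.
  + exact: span_full.
move=> m; rewrite -det_mulmatX; try solve [exact: wbas_indep | exact: span1 | exact: spanM_basis | exact: span_full].
rewrite -det_mulmx -mulmatM; try solve [exact: wbas_indep | exact: span1 | exact: spanM_basis | exact: span_full].
exact: det_mulmatW_B0.
Qed.

Lemma almost_integral_shift w c : almost_integral w -> almost_integral (c%:R - w).
Proof.
move=> [d0 [Rd d00 Rm]]; exists d0; split=> // m.
have Rc : R c%:R by rewrite -(rmorph_nat a); exact: comp_ringl.
suff H : forall l, R (d0 * ((c%:R - w) ^+ m * w ^+ l)) by have := H 0%N; rewrite expr0 mulr1.
elim: m => [|m IH] l; first by rewrite expr0 mul1r.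
rewrite (_ : _ * _ = c%:R * (d0 * ((c%:R - w) ^+ m * w ^+ l)) - d0 * ((c%:R - w) ^+ m * w ^+ l.+1)).
  by apply: comp_ringB => //; apply: comp_ringM.
by rewrite !exprS; ring.
Qed.

(** Newton interpolation: remove the value at [m0], divide by [X - m0] and continue from [m0.+1], so
    that the integers [m - m0] divided by stay nonzero and hence invertible in [B0]. *)
Lemma B0_interpolation (p : {poly k}) m0 :
  (forall m, (m0 <= m)%N -> B0 p.[m%:R]) -> forall i, B0 p`_i.
Proof.
have [N] := ubnP (size p); elim: N p m0 => // N IH p m0 sp H.
have [/size1_polyC pC i|sp1] := leqP (size p) 1.
  rewrite pC coefC; case: eqP => _; last exact: B0_0.
  by have := H m0 (leqnn _); rewrite pC hornerC coefC eqxx.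
pose c := p.[m0%:R].
have /factor_theorem[q qE] : root (p - c%:P) m0%:R by rewrite /root hornerD hornerN hornerC subrr.
have pE : p = q * ('X - m0%:R%:P) + c%:P by rewrite -qE subrK.
have Bc : B0 c by exact: H.
have Bnat m : B0 m%:R.
  by elim: m => [|m IHm]; [exact: B0_0 | rewrite -natr1; apply: B0_D => //; exact: B0_1].
have qB : forall i, B0 q`_i.
  apply: (IH q m0.+1).
    have [->|q0] := eqVneq q 0; first by rewrite size_poly0; case: (N) sp => //; rewrite ltnS leqn0 => /eqP s0; rewrite s0 in sp1.
    have : size (p - c%:P) = (size q).+1 by rewrite qE size_Mmonic ?monicXsubC // size_XsubC addn2.
    have -> : size (p - c%:P) = size p by rewrite size_polyDl // size_polyN (leq_ltn_trans (size_polyC_leq1 _)).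
    by move=> sq; move: sp; rewrite sq.
  move=> m mm; have mm0 : (m%:R - m0%:R : k) != 0.
    have /pcharf0P natr0 := char0k.
    by rewrite -natrB ?(ltnW mm) // natr0 -lt0n subn_gt0.
  have -> : q.[m%:R] = (p.[m%:R] - c) / (m%:R - m0%:R).
    by rewrite pE !hornerE; field.
  apply: B0_M; first by apply: B0_D; [exact/H/ltnW | rewrite -mulN1r; apply: B0_M => //; exact: B0_N1].
  rewrite -natrB ?(ltnW mm) //; apply/Ct_B0/Ct_V.
  by elim: (_ - _)%N => [|l IHl]; [exact: Ct_0 | rewrite -natr1; apply: Ct_D => //; exact: Ct_1].
move=> i; rewrite pE coefD coefC mulrBr coefB coefMX coefMC.
apply: B0_D; last by case: eqP => _ //; exact: B0_0.
apply: B0_D; first by case: eqP => _ //; exact: B0_0.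
rewrite -mulN1r; apply: B0_M; first exact: B0_N1.
exact: B0_M.
Qed.

Lemma horner_char_poly m (A : 'M[k]_m) x : (char_poly A).[x] = \det (x%:M - A).
Proof.
rewrite /char_poly -[LHS]/(horner_eval x _) -det_map_mx; congr (\det _).
apply/matrixP => i j; rewrite !mxE /= /horner_eval hornerD hornerN hornerC.
by case: (i == j); rewrite ?mulr1n ?mulr0n ?hornerX ?horner0.
Qed.

(** The values of the characteristic polynomial at natural numbers [m] are the norms of [m - w];
    interpolation gives all its coefficients, among them the trace. *)
Lemma almost_integral_trace w : almost_integral w -> B0 (ext_trace io wbas w).
Proof.
move=> ai; have n0 : (0 < n)%N by apply: ext_dim_gt0 span1.
have := char_poly_trace (mulmatW w) n0; rewrite -/(ext_trace io wbas w) => trE.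
rewrite -[ext_trace _ _ _]opprK -trE -mulN1r; apply: B0_M; first exact: B0_N1.
apply: (@B0_interpolation _ 0%N) => m _; rewrite horner_char_poly.
have -> : (m%:R)%:M - mulmatW w = mulmatW (m%:R - w).
  have hs := span_full; have hi := wbas_indep; have hM := spanM_basis.
  have -> : mulmatW (m%:R - w) = mulmatW m%:R - mulmatW w.
    by rewrite mulmatD // -[- w]mulN1r -(rmorphN1 io) mulmatZ // scaleN1r.
  congr (_ - _).
  by rewrite -(rmorph_nat io) mulmat_scalar //; exact: span1.
exact/almost_integral_det/almost_integral_shift.
Qed.

(* The coordinates of [w] are obtained from traces of [w * wbas j], which are [E]-polynomials
   in [t] up to denominators in [C[t]], by inverting a Gram matrix over [C(t)]. *)
Lemma almost_integral_ring w : almost_integral w -> R w.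
Proof.
move=> ai; have hs := span_full; have hi := wbas_indep; have hM := spanM_basis; have h1 := span1.
have [c wE] := hs w.
have cE : c = (\row_j ext_trace io wbas (w * wbas j)) *m invmx (gram io wbas).
  by rewrite wE -mul_gram // mulmxK // gram_unit //; exact: char0k.
rewrite wE; apply: coords_ring => j; rewrite cE mxE; apply: B0_sum => i _.
apply: B0_M.
  rewrite mxE; apply: almost_integral_trace.
  have [d0 [Rd d00 Rm]] := ai; exists d0; split=> // m.
  rewrite exprMn mulrA; apply: comp_ringM => //; apply: comp_ringX; exact: comp_ringr.
have Gu : gram io wbas \in unitmx by apply: gram_unit => //; exact: char0k.
have gC i' j' : Ct (gram io wbas i' j').
  rewrite mxE /ext_trace /mxtrace /wbas -rmorphM.
  by elim/big_ind: _ => [|u v|l _]; [exact: Ct_0|exact: Ct_D|exact: mulmatW_Ct].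
apply: Ct_B0; rewrite /invmx Gu !mxE; apply: Ct_M.
  by apply: Ct_V; apply: sub_det Ct_D Ct_M Ct_1 Ct_N1 _.
rewrite /cofactor; apply: Ct_M.
  by elim: (_ + _)%N => [|l IHl]; rewrite ?expr0 ?exprS; [exact: Ct_1|apply: Ct_M => //; exact: Ct_N1].
by apply: sub_det Ct_D Ct_M Ct_1 Ct_N1 _ => i' j'; rewrite 2!mxE; exact: gC.
Qed.

Lemma ev_relation (x : W) : exists2 P : {poly {poly E}}, P != 0 & (map_poly evT P).[x] = 0.
Proof.
pose chi := char_poly (mulmatW x).
have chi0 : chi != 0 by rewrite monic_neq0 // char_poly_monic.
have rx : root (map_poly io chi) x.
  have hs := span_full; have hi := wbas_indep; have hM := spanM_basis; have h1 := span1.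
  exact: mulmat_eigen.
have [P [Q [Q0 PE]]] := common_denominator evT_inj ioP (fun i : 'I_(size chi) => chi`_i).
pose p := \poly_(i < size chi) (if insub i is Some i' then P i' else 0).
have pE : map_poly evT p = evT Q *: map_poly io chi.
  apply/polyP => i; rewrite coefZ !coef_map coef_poly; case: ltnP => [il|il].
    rewrite insubT /= -[nth 0 chi i]/(nth 0 chi (Ordinal il)) PE; field.
    by rewrite evT_eq0.
  by rewrite /= (nth_default _ il) !rmorph0 mulr0.
exists p; last by rewrite pE hornerZ (rootP rx) mulr0.
apply/eqP => p0; move/eqP: pE; rewrite p0 rmorph0 eq_sym scaler_eq0 evT_eq0 (negbTE Q0) /=.
by rewrite map_poly_eq0 (negbTE chi0).
Qed.

Definition denominator (x r : W) : Prop := R r /\ R (r * x).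

Lemma denominatorD x r s : denominator x r -> denominator x s -> denominator x (r + s).
Proof. by move=> [r1 r2] [s1 s2]; split; rewrite ?mulrDl; exact: comp_ringD. Qed.
Lemma denominatorM x r s : R r -> denominator x s -> denominator x (r * s).
Proof. by move=> Rr [s1 s2]; split; rewrite -?mulrA; exact: comp_ringM. Qed.
Lemma denominatorN x r : denominator x r -> denominator x (- r).
Proof. by move=> [r1 r2]; split; rewrite ?mulNr; exact: comp_ringN. Qed.
Lemma denominator0 x : denominator x 0.
Proof. by split; rewrite ?mul0r; exact: comp_ring0. Qed.

(** With [N] the degree of [P], the [E[t]]-module [H] spanned by the powers of [x] below [N] is
    stable under multiplication by the tail. All powers of the tail thus have the denominator
    [v ^+ N], and an almost integral element lies in [R]. *)
Lemma relation_tail_ring (x : W) (P : {poly {poly E}}) m :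
  (1 < size P)%N -> (map_poly evT P).[x] = 0 -> R (map_poly evT (drop_poly m P)).[x].
Proof.
move=> sP Px; set N := (size P).-1.
have [u [v [Ru Rv v0 xE]]] := bd_frac bd x.
pose hx : {rmorphism {poly {poly E}} -> W} := horner_eval x \o map_poly evT.
pose H w := exists2 f : {poly {poly E}}, (size f <= N)%N & w = hx f.
have HD w1 w2 : H w1 -> H w2 -> H (w1 + w2).
  move=> [f sf ->] [g sg ->]; exists (f + g); last by rewrite rmorphD.
  by rewrite (leq_trans (size_polyD _ _)) // geq_max sf.
have HZ p w : H w -> H (evT p * w).
  move=> [f sf ->]; exists (p *: f); first by rewrite (leq_trans (size_scale_leq _ _)).
  by rewrite -mul_polyC rmorphM /= /horner_eval map_polyC hornerC.
have hxZ p : hx p%:P = evT p by rewrite /= /horner_eval map_polyC hornerC.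
have hxX j : hx 'X^j = x ^+ j by rewrite /= /horner_eval map_polyXn hornerXn.
have hxE (f : {poly {poly E}}) : (size f <= N)%N -> hx f = \sum_(j < N) evT f`_j * x ^+ j.
  move=> sf; rewrite /= /horner_eval (horner_coef_wide _ (n := N)); last first.
    by rewrite (leq_trans (size_poly _ _)).
  by apply: eq_bigr => j _; rewrite coef_map.
have HR w : H w -> R (v ^+ N * w).
  move=> [f sf ->]; rewrite hxE // mulr_sumr; apply: comp_ring_sum => j _.
  rewrite mulrCA; apply: comp_ringM; first exact: evT_ring.
  have -> : v ^+ N * x ^+ j = v ^+ (N - j) * u ^+ j.
    rewrite -{1}(subnK (ltnW (ltn_ord j))) exprD xE expr_div_n.
    by field; rewrite expf_neq0.
  by apply: comp_ringM; exact: comp_ringX.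
have Hb w : H w -> H ((map_poly evT (drop_poly m P)).[x] * w).
  move=> [f sf ->]; rewrite hxE //.
  have H0 : H 0 by exists 0; rewrite ?size_poly0 ?rmorph0.
  rewrite mulr_sumr; elim/big_ind: _ => // j _.
  rewrite mulrCA; apply: HZ; rewrite -hxX -[X in X * _]/(hx (drop_poly m P)) -rmorphM.
  have sdrop : size (drop_poly m P) = (size P - m)%N by rewrite size_drop_poly.
  have sN : size P = N.+1 by rewrite /N prednK // ltnW.
  case: (ltnP j m) => jm.
    exists (drop_poly m P * 'X^j) => //.
    rewrite (leq_trans (size_polyMleq _ _)) // sdrop size_polyXn sN.
    have := ltn_ord j; lia.
  (* For [j >= m] the product would have too high a degree; the relation [P] multiplied by [X] to
     the power [j - m] trades the tail for minus the head. *)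
  exists (- (take_poly m P * 'X^(j - m))).
    rewrite size_polyN (leq_trans (size_polyMleq _ _)) // size_polyXn.
    have st : (size (take_poly m P) <= m)%N by exact: size_take_poly.
    move: st (ltn_ord j) jm; move: (size (take_poly m P)) (nat_of_ord j) => sz j0; lia.
  rewrite rmorphN /=; apply/eqP; rewrite -addr_eq0 -[X in X + _]/(hx _) -[X in _ + X]/(hx _) -rmorphD.
  have -> : drop_poly m P * 'X^j + take_poly m P * 'X^(j - m) = P * 'X^(j - m).
    have -> : P * 'X^(j - m) = (take_poly m P + drop_poly m P * 'X^m) * 'X^(j - m).
      by rewrite poly_take_drop.
    by rewrite mulrDl -mulrA -exprD subnKC // addrC.
  by rewrite rmorphM [hx P]Px mul0r.
apply: almost_integral_ring; exists (v ^+ N); split; rewrite ?expf_neq0 //; first exact: comp_ringX.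
move=> l; apply: HR; elim: l => [|l IH]; last by rewrite exprS; exact: Hb.
by exists 1; rewrite ?rmorph1 ?expr0 // size_poly1 /N -ltnS prednK // ltnW.
Qed.

(* The tails [b' m = p_m + x * b' m.+1] of a relation [P] for [x] lie in [R], so that each
   coefficient [p_m] is in the ideal [I + x * I] with [I] the denominators of [x]; if their
   gcd is not constant, it can be divided out of [P]. *)
Lemma denominator_comaximal x :
  exists i0 i1, [/\ denominator x i0, denominator x i1 & i0 + x * i1 = 1].
Proof.
have [P P0 Px] := ev_relation x.
have [n0] := ubnP (size (lead_coef P)); elim: n0 P P0 Px => // n0 IH P P0 Px slc.
have sP : (1 < size P)%N.
  rewrite ltnNge; apply/negP => sP1; have PC := size1_polyC sP1.
  move: Px; rewrite PC map_polyC hornerC => /eqP; rewrite evT_eq0 => /eqP P00.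
  by rewrite PC P00 polyC0 eqxx in P0.
pose good p := exists i0 i1, [/\ denominator x i0, denominator x i1 & i0 + x * i1 = evT p].
have goodB p q : good p -> good q -> good (p - q).
  move=> [i0 [i1 [h0 h1 e]]] [j0 [j1 [k0 k1 e']]]; exists (i0 - j0), (i1 - j1); split.
  - by apply: denominatorD => //; exact: denominatorN.
  - by apply: denominatorD => //; exact: denominatorN.
  - by rewrite rmorphB /= -e -e'; ring.
have goodM p q : good q -> good (p * q).
  move=> [i0 [i1 [h0 h1 e]]]; exists (evT p * i0), (evT p * i1); split.
  - by apply: denominatorM => //; exact: evT_ring.
  - by apply: denominatorM => //; exact: evT_ring.
  - by rewrite rmorphM /= -e; ring.
pose b' m := (map_poly evT (drop_poly m P)).[x].
have Rb m : R (b' m) by exact: relation_tail_ring.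
have b'S m : b' m = evT P`_m + x * b' m.+1.
  have dropE : drop_poly m P = drop_poly m.+1 P * 'X + (P`_m)%:P.
    apply/polyP => i; rewrite coef_drop_poly coefD coefMX coefC.
    by case: i => [|i] /=; rewrite ?add0n ?add0r // addr0 coef_drop_poly addSnnS.
  by rewrite /b' dropE rmorphD rmorphM /= map_polyX map_polyC hornerD hornerM hornerX hornerC; ring.
have db m : denominator x (b' m.+1).
  split=> //; rewrite (_ : _ * _ = b' m - evT P`_m); last by rewrite (b'S m); ring.
  by apply: comp_ringB => //; exact: evT_ring.
have good_coef m : good P`_m.
  case: m => [|m].
    exists 0, (- b' 1%N); split; [exact: denominator0 | exact/denominatorN/db |].
    have b0 : b' 0%N = 0 by rewrite /b' drop_poly0l Px.
    by move: (b'S 0%N); rewrite b0 => /esym/eqP; rewrite addr_eq0 => /eqP ->; ring.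
  exists (b' m.+1), (- b' m.+2); split; [exact: db | exact/denominatorN/db |].
  by rewrite (b'S m.+1); ring.
have exg : exists l, `[< exists g, [/\ good g, g != 0 & size g = l] >].
  by exists (size (lead_coef P)); apply/asboolP; exists (lead_coef P); rewrite lead_coef_eq0; split=> //; exact: good_coef.
have [l /asboolP[g [gg g0 gl]] lmin] := ex_minnP exg.
have gdvd p : good p -> g %| p.
  move=> gp; rewrite /dvdp; apply: contraT => r0.
  have gr : good (p %% g).
    rewrite (_ : p %% g = p - (p %/ g) * g); first exact/goodB/goodM.
    by rewrite {2}(divp_eq p g) addrC addKr.
  have := lmin (size (p %% g)); rewrite leqNgt -gl ltn_modp g0 => /(_ _)/negP.
  by case=> //; apply/asboolP; exists (p %% g).
have [sg1|sg1] := leqP (size g) 1.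
  have gC : g = (g`_0)%:P by exact: size1_polyC.
  have c0 : g`_0 != 0 by rewrite -polyC_eq0 -gC.
  have [i0 [i1 [h0 h1 e]]] := goodM ((g`_0)^-1)%:P _ gg.
  exists i0, i1; split=> //; rewrite e gC coefC eqxx -polyCM mulVf //.
  by rewrite rmorph1.
pose P' := map_poly (fun p => p %/ g) P.
have PE : P = g *: P'.
  apply/polyP => i; rewrite coefZ coef_map_id0 ?div0p // mulrC divpK //.
  exact/gdvd/good_coef.
have P'0 : P' != 0 by apply: contraNneq P0 => P'0; rewrite PE P'0 scaler0.
apply: (IH P') => //.
  have := Px; rewrite PE -mul_polyC rmorphM /= map_polyC hornerM hornerC => /eqP.
  by rewrite mulf_eq0 evT_eq0 (negbTE g0) => /eqP.
have lc0 : lead_coef P' != 0 by rewrite lead_coef_eq0.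
move: slc; rewrite PE lead_coefZ size_mul //; move: sg1.
have : (0 < size (lead_coef P'))%N by rewrite size_poly_gt0.
by move: (size g) (size (lead_coef P')) => *; lia.
Qed.

(** Up to a unit from [C[t]], [p] is the norm of [v], which the characteristic equation of [v]
    exhibits as a multiple of [v] in [R]. *)
Lemma ring_divides_poly v : R v -> v != 0 ->
  exists p v', [/\ p != 0, R v' & evT p = v * v'].
Proof.
move=> Rv v0; have hs := span_full; have hi := wbas_indep; have hM := spanM_basis; have h1 := span1.
pose chi := char_poly (mulmatW v).
have chiB i : B0 chi`_i.
  apply: (@B0_interpolation _ 0%N) => m _; rewrite horner_char_poly.
  apply: sub_det B0_D B0_M B0_1 B0_N1 _ => i' j'; rewrite mxE [X in X + _]mxE [X in _ + X]mxE.
  apply: B0_D; last by rewrite -mulN1r; apply: B0_M; [exact: B0_N1 | exact: mulmatW_B0].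
  case: (i' == j'); rewrite ?mulr0n ?mulr1n; last exact: B0_0.
  by elim: m => [|m IH]; [exact: B0_0 | rewrite -natr1; apply: B0_D => //; exact: B0_1].
have chi0 : chi`_0 != 0.
  rewrite char_poly_det mulf_neq0 ?signr_eq0 // -unitfE -unitmxE.
  exact: mulmat_unit.
have : (map_poly io chi).[v] = 0 by apply/rootP; exact: mulmat_eigen.
rewrite horner_coef size_map_poly size_char_poly big_ord_recl coef_map expr0 mulr1 /= => rel.
have [p [q [q0 pq]]] := chiB 0%N.
pose v' := - \sum_(i < n) io chi`_i.+1 * v ^+ i.
have Rv' : R v'.
  apply: comp_ringN; apply: comp_ring_sum => i _; apply: comp_ringM; last exact: comp_ringX.
  exact: io_ringP.
exists p, (v' * evq q); split.
- by apply: contraNneq chi0 => p0; rewrite -(fmorph_eq0 io) pq p0 rmorph0 mul0r.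
- by apply: comp_ringM => //; exact: evT_ring.
have -> : evT p = io chi`_0 * evq q by rewrite pq divfK // evq_eq0.
rewrite mulrA; congr (_ * _); apply/eqP; rewrite /v' mulrN -addr_eq0 -[X in _ == X]rel.
apply/eqP; congr (_ + _); rewrite mulr_sumr; apply: eq_bigr => i _.
by rewrite coef_map /= /bump leq0n add1n exprS; ring.
Qed.

(** The denominator ideal of [x] has codimension less than [N] in [R] over [E]; this is the measure
    of the number of poles of [x]. *)
Definition dependent_mod (x : W) N := forall r : 'I_N -> W, (forall l, R (r l)) ->
  exists2 c : 'I_N -> E, (exists l, c l != 0) & denominator x (\sum_l a (c l) * r l).

(** The ideal contains a nonzero polynomial [p] in [t], and [R] modulo [p] has finite dimension over
    [E]. *)
Lemma denominator_cofinite x : exists N, dependent_mod x N.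
Proof.
have [u [v [Ru Rv v0 xE]]] := bd_frac bd x.
have [p [v' [p0 Rv' pE]]] := ring_divides_poly Rv v0.
have dp : denominator x (evT p).
  split; first exact: evT_ring.
  rewrite pE xE (_ : _ * _ = u * v'); first exact: comp_ringM.
  by field.
pose m := (size p).-1.
exists (n * m).+1 => r Rr.
have /choice[f Hf] (l : 'I_(n * m).+1) : exists f : ('I_n -> {poly E}) * {poly C},
    f.2 != 0 /\ r l * evq f.2 = \sum_j evT (f.1 j) * wbas j.
  have [c cE cB] := ring_coords (Rr l).
  have /choice[g Hg] j : exists g : {poly E} * {poly C}, g.2 != 0 /\ io (c 0 j) = evT g.1 / evq g.2.
    by have [P [q [q0 e]]] := cB j; exists (P, q).
  exists (fun j => (g j).1 * \prod_(i | i != j) map_poly iE (g i).2, \prod_j (g j).2) => /=; split.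
    by apply/prodf_neq0 => j _; have [] := Hg j.
  rewrite cE /lincomb mulr_suml; apply: eq_bigr => j _.
  have [gj0 ->] := Hg j; rewrite (bigD1 j) //= !rmorphM /=.
  have -> : evq (\prod_(i | i != j) (g i).2) = evT (\prod_(i | i != j) map_poly iE (g i).2).
    by rewrite /evq /= rmorph_prod.
  by field; rewrite evq_eq0.
(* Over a common denominator in [C[t]], a unit of [R], only the remainders modulo [p] of the [n]
   coordinates count: [n * m] coefficients for [n * m + 1] elements. *)
pose F (l : 'I_(n * m).+1) : 'rV[E]_(n * m) :=
  mxvec (\matrix_(j < n, i < m) (((f l).1 j * map_poly iE (\prod_(l' | l' != l) (f l').2)) %% p)`_i).
have : ~~ row_free (\matrix_l F l).
  rewrite -row_leq_rank -ltnNge; exact: leq_ltn_trans (rank_leq_col _) _.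
rewrite -kermx_eq0 => /rowV0Pn[c /sub_kermxP cF c0].
exists (fun l => c 0 l).
  by have [l cl|c00] := pickP (fun l => c 0 l != 0); [exists l | case/eqP: c0; apply/rowP => l; rewrite mxE; move/negbFE/eqP: (c00 l)].
pose q := \prod_l (f l).2.
have q0 : q != 0 by apply/prodf_neq0 => l _; have [] := Hf l.
pose G j := \sum_l (c 0 l)%:P * ((f l).1 j * map_poly iE (\prod_(l' | l' != l) (f l').2)).
have pG j : p %| G j.
  rewrite /dvdp; apply/eqP/polyP => i; rewrite coef0.
  have -> : G j %% p = \sum_l (c 0 l) *: (((f l).1 j * map_poly iE (\prod_(l' | l' != l) (f l').2)) %% p).
    rewrite /G (big_morph (fun r => r %% p) (modpD p) (mod0p p)).
    by apply: eq_bigr => l _; rewrite mul_polyC modpZl.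
  have [im|im] := ltnP i m; last first.
    rewrite coef_sum big1 // => l _; rewrite coefZ nth_default ?mulr0 //.
    rewrite (leq_trans _ im) // -ltnS /m prednK ?size_poly_gt0 //.
    by rewrite ltn_modp.
  move/rowP: cF => /(_ (mxvec_index j (Ordinal im))); rewrite !mxE => rel.
  rewrite coef_sum -[RHS]rel; apply: eq_bigr => l _.
  by rewrite coefZ !mxE mxvecE !mxE.
have sE : (\sum_l a (c 0 l) * r l) * evq q = \sum_j evT (G j) * wbas j.
  rewrite mulr_suml.
  transitivity (\sum_l \sum_j evT ((c 0 l)%:P * ((f l).1 j * map_poly iE (\prod_(l' | l' != l) (f l').2))) * wbas j).
    apply: eq_bigr => l _; have [_ rl] := Hf l.
    rewrite /q (bigD1 l) //= rmorphM /=.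
    rewrite (_ : _ * _ = a (c 0 l) * evq (\prod_(i | i != l) (f i).2) * (r l * evq (f l).2)); last by ring.
    rewrite rl mulr_sumr; apply: eq_bigr => j _.
    rewrite !rmorphM /= -/(evq _).
    have -> : evT (c 0 l)%:P = a (c 0 l) by rewrite /evT /= /horner_eval map_polyC hornerC.
    by ring.
  rewrite exchange_big /=; apply: eq_bigr => j _.
  by rewrite /G rmorph_sum mulr_suml.
have -> : \sum_l a (c 0 l) * r l = (b (evC q)^-1 * \sum_j evT (G j %/ p) * wbas j) * evT p.
  apply: (mulIf (x := evq q)); first by rewrite evq_eq0.
  rewrite sE fmorphV -evq_b.
  rewrite (_ : _ * _ * _ * _ = evT p * (\sum_j evT (G j %/ p) * wbas j)); last by field; rewrite evq_eq0.
  rewrite mulr_sumr; apply: eq_bigr => j _.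
  by rewrite -{1}(divpK (pG j)) rmorphM /=; ring.
apply: denominatorM => //; apply: comp_ringM; first exact: comp_ringr.
apply: comp_ring_sum => j _; apply: comp_ringM; first exact: evT_ring.
exact: comp_ringr.
Qed.
End RationalType.
End RationalSubfield.

(** * Functions with the fewest poles *)

Lemma drv_horner (R : comNzRingType) (d : R -> R) : derivation d ->
  forall (p : {poly R}) x, d p.[x] = (map_poly d p).[x] + p^`().[x] * d x.
Proof.
move=> dD p x; elim/poly_ind: p => [|p c IH].
  have -> : map_poly d 0 = 0 by apply/polyP => i; rewrite coef_map_id0 ?coef0 (drv0 dD).
  by rewrite deriv0 !horner0 (drv0 dD) mul0r addr0.
have -> : map_poly d (p * 'X + c%:P) = map_poly d p * 'X + (d c)%:P.
  apply/polyP => i; rewrite coef_map_id0 ?(drv0 dD) // !coefD (drvD dD) !coefMX !coefC.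
  by rewrite coef_map_id0 ?(drv0 dD) //; case: i => [|i] /=; rewrite (drv0 dD).
rewrite derivD derivM derivX derivC addr0 mulr1 !(hornerD, hornerM, hornerX, hornerC).
by rewrite (drvD dD) (drvM dD) IH; ring.
Qed.

Section Core.
Variables (C K E W : fieldType) (iK : {rmorphism C -> K}) (iE : {rmorphism C -> E}).
Variables (a : {rmorphism E -> W}) (b : {rmorphism K -> W}).
Variables (dK : K -> K) (dE : E -> E) (D d : W -> W).
Hypothesis bd : bidifferential iK iE a b dK dE D d.
Hypotheses (closedC : GRing.closed_field_axiom C) (char0 : [pchar C] =i pred0).

Local Notation R := (comp_ring a b).
Local Notation den := (denominator a b).

Definition cst : C -> W := a \o iE.
HB.instance Definition _ := GRing.RMorphism.copy cst (a \o iE).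
Definition evp (p : {poly C}) (x : W) : W := (map_poly cst p).[x].

Lemma cst_b c : cst c = b (iK c). Proof. exact: bd_ab bd c. Qed.
Lemma d_cst c : d (cst c) = 0. Proof. exact: bd_da bd _. Qed.
Lemma dE_iE c : dE (iE c) = 0.
Proof. by apply: (fmorph_inj a); rewrite -(bd_Da bd) (bd_ab bd) (bd_Db bd) -(bd_db bd) -(bd_ab bd) (bd_da bd) rmorph0. Qed.
Lemma D_cst c : D (cst c) = 0.
Proof. by rewrite /cst /= (bd_Da bd) dE_iE rmorph0. Qed.
Lemma R_cst c : R (cst c). Proof. exact: comp_ringl. Qed.
Lemma R_d w : R w -> R (d w).
Proof. exact: comp_ring_drv (bd_derd bd) (bd_da bd) (bd_db bd) _. Qed.
Lemma R_D w : R w -> R (D w).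
Proof.
move=> [s ->]; rewrite /comp_sum (drv_sum (bd_derD bd)); apply: comp_ring_sum => p _.
rewrite (drvM (bd_derD bd)) (bd_Da bd) (bd_Db bd).
by apply: comp_ringD; exact: comp_ring_tensor.
Qed.

Lemma evpD p q x : evp (p + q) x = evp p x + evp q x.
Proof. by rewrite /evp rmorphD hornerD. Qed.
Lemma evpB p q x : evp (p - q) x = evp p x - evp q x.
Proof. by rewrite /evp rmorphB hornerD hornerN. Qed.
Lemma evpM p q x : evp (p * q) x = evp p x * evp q x.
Proof. by rewrite /evp rmorphM hornerM. Qed.
Lemma evp0 x : evp 0 x = 0. Proof. by rewrite /evp rmorph0 horner0. Qed.
Lemma evpC c x : evp c%:P x = cst c. Proof. by rewrite /evp map_polyC hornerC. Qed.
Lemma evpX x : evp 'X x = x. Proof. by rewrite /evp map_polyX hornerX. Qed.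
Lemma evpXn n x : evp 'X^n x = x ^+ n. Proof. by rewrite /evp map_polyXn hornerXn. Qed.
Lemma evpZ c p x : evp (c *: p) x = cst c * evp p x.
Proof. by rewrite -mul_polyC evpM evpC. Qed.
Lemma D_evp p x : D x = 0 -> D (evp p x) = 0.
Proof.
move=> Dx; rewrite /evp (drv_horner (bd_derD bd)) Dx mulr0 addr0.
rewrite horner_coef big1 // => i _.
by rewrite coef_map_id0 ?(drv0 (bd_derD bd)) // coef_map D_cst mul0r.
Qed.
Lemma d_evp p x : d (evp p x) = evp p^`() x * d x.
Proof.
rewrite /evp (drv_horner (bd_derd bd)) deriv_map [X in X + _](_ : _ = 0) ?add0r //.
rewrite horner_coef big1 // => i _.
by rewrite coef_map_id0 ?(drv0 (bd_derd bd)) // coef_map d_cst mul0r.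
Qed.

Definition is_const (w : W) : Prop := exists c, w = cst c.

Lemma evp_eq0 p x : ~ is_const x -> evp p x = 0 -> p = 0.
Proof.
move=> xC; have [n] := ubnP (size p); elim: n p => // n IH p sp px.
have [/size1_polyC pC | /(closed_root closedC)[r /factor_theorem[q pE]]] := leqP (size p) 1.
  by move: px; rewrite pC evpC => /eqP; rewrite fmorph_eq0 => /eqP ->.
move: px; rewrite pE evpM evpB evpX evpC => /eqP; rewrite mulf_eq0 => /orP[/eqP qx|].
  have [->|q0] := eqVneq q 0; first by rewrite mul0r.
  rewrite (IH q) ?mul0r //.
  by move: sp; rewrite pE size_Mmonic ?monicXsubC // size_XsubC addn2.
by rewrite subr_eq0 => /eqP xr; case: xC; exists r.
Qed.

Definition quartic_solution : Prop := exists f (P : {poly C}),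
  [/\ D f = 0, ~ is_const f, (size P <= 5)%N & d f ^+ 2 = evp P f].

Definition diff_op (p : {poly C}) (w : W) : W := \sum_(k < size p) cst p`_k * iter k d w.

Lemma diff_op_wide (p : {poly C}) w n : (size p <= n)%N -> diff_op p w = \sum_(k < n) cst p`_k * iter k d w.
Proof.
move=> pn; rewrite /diff_op (big_ord_widen n (fun k => cst p`_k * iter k d w)) //.
rewrite big_mkcond /=; apply: eq_bigr => k _; case: ltnP => // pk.
by rewrite (nth_default _ pk) rmorph0 mul0r.
Qed.
Lemma diff_opD p q w : diff_op (p + q) w = diff_op p w + diff_op q w.
Proof.
pose n := maxn (size p) (size q).
rewrite (diff_op_wide w (size_polyD p q)) (@diff_op_wide p w n (leq_maxl _ _)) (@diff_op_wide q w n (leq_maxr _ _)).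
by rewrite -big_split; apply: eq_bigr => k _; rewrite coefD rmorphD mulrDl.
Qed.
Lemma diff_opZ c p w : diff_op (c *: p) w = cst c * diff_op p w.
Proof.
rewrite !(@diff_op_wide _ _ (size p)) ?size_scale_leq // mulr_sumr.
by apply: eq_bigr => k _; rewrite coefZ rmorphM mulrA.
Qed.
Lemma diff_opX p w : diff_op (p * 'X) w = d (diff_op p w).
Proof.
rewrite (@diff_op_wide _ _ (size p).+1); last first.
  by rewrite (leq_trans (size_polyMleq _ _)) // size_polyX addn2.
rewrite big_ord_recl coefMX eqxx rmorph0 mul0r add0r /diff_op (drv_sum (bd_derd bd)).
by apply: eq_bigr => k _; rewrite coefMX (drvM (bd_derd bd)) d_cst mul0r add0r.
Qed.
Lemma D_iter k w : D w = 0 -> D (iter k d w) = 0.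
Proof. by move=> Dw; elim: k => //= k IH; rewrite (bd_comm bd) IH (drv0 (bd_derd bd)). Qed.
Lemma D_diff_op p w : D w = 0 -> D (diff_op p w) = 0.
Proof.
move=> Dw; rewrite /diff_op (drv_sum (bd_derD bd)) big1 // => k _.
by rewrite (drvM (bd_derD bd)) D_cst D_iter // mul0r mulr0 addr0.
Qed.

(** The iterates [iter k d w] are combinations over [K] of the same [l] elements of [E], so [l + 1]
    of them are dependent over [K]. They are also constants of [D], because [d] commutes with [D],
    and hence dependent over [C]. *)
Lemma diff_op_annihilated w : R w -> D w = 0 -> exists2 p, p != 0 & diff_op p w = 0.
Proof.
move=> [s ws] Dw; pose l := size s; pose x0 : E * K := (0, 0).
have iterE k : iter k d w = \sum_(i < l) a (nth x0 s i).1 * b (iter k dK (nth x0 s i).2).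
  elim: k => [|k IH] /=; first by rewrite ws /comp_sum (big_nth x0) big_mkord.
  rewrite IH (drv_sum (bd_derd bd)); apply: eq_bigr => i _.
  by rewrite (drvM (bd_derd bd)) (bd_da bd) mul0r add0r (bd_db bd).
pose X : 'M[K]_(l.+1, l) := \matrix_(k, i) iter k dK (nth x0 s i).2.
have : ~~ row_free X by rewrite -row_leq_rank -ltnNge; exact: leq_ltn_trans (rank_leq_col _) _.
rewrite -kermx_eq0 => /rowV0Pn[nu /sub_kermxP nuX nu0].
have [|||c [k kl ck] crel] := constants_disjoint (bd_derD bd) (bd_Db bd) (bd_constK bd)
    (l := l.+1) (g := fun k => iter k d w) (x := fun k => nu 0 (inord k)).
- by move=> k; exact: D_iter.
- have [k nuk|nu00] := pickP (fun k => nu 0 k != 0); first by exists k => //; rewrite inord_val.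
  by case/eqP: nu0; apply/rowP => k; rewrite mxE; move/negbFE/eqP: (nu00 k).
- transitivity (\sum_(k < l.+1) \sum_(i < l) a (nth x0 s i).1 * b (nu 0 k * X k i)).
    apply: eq_bigr => k _; rewrite iterE mulr_suml; apply: eq_bigr => i _.
    by rewrite inord_val mxE rmorphM; ring.
  rewrite exchange_big big1 //= => i _; rewrite -mulr_sumr -rmorph_sum.
  by move/rowP: nuX => /(_ i); rewrite !mxE => ->; rewrite rmorph0 mulr0.
exists (\poly_(j < l.+1) c j).
  by apply: contraNneq ck => /polyP/(_ k); rewrite coef_poly kl coef0 => ->.
rewrite (@diff_op_wide _ _ l.+1) ?size_poly // -[RHS]crel.
by apply: eq_bigr => j _; rewrite coef_poly ltn_ord cst_b mulrC.
Qed.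

(** Split linear factors off an operator of least order killing [w]. After one factor, [g] satisfies
    [d g = r g]; if [g] lies in [C], a second factor gives [f] with [d f = r' f + c], and [f] is
    nonconstant since otherwise an operator of lower order would kill [w]. *)
Lemma quartic_from_ring w : R w -> D w = 0 -> ~ is_const w -> quartic_solution.
Proof.
move=> Rw Dw wC.
have exn : exists n, `[< exists p : {poly C}, [/\ p != 0, diff_op p w = 0 & size p = n] >].
  by have [p p0 pw] := diff_op_annihilated Rw Dw; exists (size p); apply/asboolP; exists p.
have [n /asboolP[p [p0 pw sp]] pmin] := ex_minnP exn.
have nz (q : {poly C}) : q != 0 -> (size q < n)%N -> diff_op q w != 0.
  move=> q0 sq; apply: contraL sq => /eqP qw; rewrite -leqNgt; apply: pmin.
  by apply/asboolP; exists q.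
have opC c : diff_op c%:P w = cst c * w.
  rewrite (@diff_op_wide _ _ 1) ?size_polyC_leq1 // big_ord_recl big_ord0 addr0 /=.
  by rewrite coefC.
have w0 : w != 0 by apply/eqP => w0; apply: wC; exists 0; rewrite rmorph0.
have lin q r : diff_op (q * ('X - r%:P)) w = d (diff_op q w) - cst r * diff_op q w.
  by rewrite mulrBr mulrC [_ * r%:P]mulrC mul_polyC mulrC -scaleN1r diff_opD diff_opX !diff_opZ rmorphN1 mulN1r.
have [r /factor_theorem[q pE]] : exists r, root p r.
  apply: (closed_root closedC); rewrite ltnNge; apply/negP => /size1_polyC pC.
  move: pw p0; rewrite pC opC polyC_eq0 => /eqP; rewrite mulf_eq0 (negbTE w0) orbF fmorph_eq0 => /eqP ->.
  by rewrite eqxx.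
have q0 : q != 0 by apply: contraNneq p0 => q0; rewrite pE q0 mul0r.
have sq : size p = (size q).+1 by rewrite pE size_Mmonic ?monicXsubC // size_XsubC addn2.
pose g := diff_op q w.
have g0 : g != 0 by apply: nz => //; rewrite -sp sq.
have dg : d g = cst r * g by move: pw; rewrite pE lin => /eqP; rewrite subr_eq0 => /eqP.
have [[c gc] | gC] := pselect (is_const g); last first.
  exists g, ('X^2 * (r ^+ 2)%:P); split=> //; first exact: D_diff_op.
    by rewrite (leq_trans (size_polyMleq _ _)) // size_polyXn (leq_trans _ (ltnW (ltnSn 4))) // -subn1 leq_subLR (leq_trans (leq_add (leqnn _) (size_polyC_leq1 _))).
  by rewrite evpM evpXn evpC rmorphXn dg; ring.
have [r' /factor_theorem[q' qE]] : exists r, root q r.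
  apply: (closed_root closedC); rewrite ltnNge; apply/negP => /size1_polyC qC.
  have qc0 : q`_0 != 0 by rewrite -polyC_eq0 -qC.
  apply: wC; exists (c / q`_0); apply: (mulfI (x := cst q`_0)); first by rewrite fmorph_eq0.
  by rewrite -opC -qC -/g gc -rmorphM mulrC divfK.
have q'0 : q' != 0 by apply: contraNneq q0 => q'0; rewrite qE q'0 mul0r.
have sq' : size q = (size q').+1 by rewrite qE size_Mmonic ?monicXsubC // size_XsubC addn2.
pose f := diff_op q' w.
have df : d f = cst r' * f + cst c.
  by move: gc; rewrite /g qE lin => <-; rewrite -/f; ring.
exists f, ((r' *: 'X + c%:P) ^+ 2); split; first exact: D_diff_op.
- move=> [c' fc]; have qX0 : q' * 'X != 0 by rewrite mulf_neq0 ?polyX_eq0.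
  have sqX : (size (q' * 'X)%R < n)%N by rewrite size_mulX // -sp sq sq'.
  by have := nz _ qX0 sqX; rewrite diff_opX -/f fc d_cst eqxx.
- rewrite expr2 (leq_trans (size_polyMleq _ _)) //.
  have : (size (r' *: 'X + c%:P)%R <= 2)%N.
    rewrite (leq_trans (size_polyD _ _)) // geq_max (leq_trans (size_polyC_leq1 _)) // andbT.
    by rewrite (leq_trans (size_scale_leq _ _)) // size_polyX.
  by move: (size _) => m; lia.
by rewrite df !expr2 evpM evpD evpZ evpX evpC.
Qed.

Lemma den_D x r : D x = 0 -> den x r -> den x (D r).
Proof.
move=> Dx [Rr Rrx]; split; first exact: R_D.
have -> : D r * x = D (r * x) by rewrite (drvM (bd_derD bd)) Dx mulr0 addr0.
exact: R_D.
Qed.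

Section NoRingConstants.
Hypothesis comax : forall x, exists i0 i1, [/\ den x i0, den x i1 & i0 + x * i1 = 1].
Hypothesis cofin : forall x, exists N, dependent_mod a b x N.
Hypothesis RC : forall w, R w -> D w = 0 -> is_const w.

(* The denominator ideal of [f] is maximal among those of nonconstant constants of [D],
   i.e. [f] has as few poles as possible. *)
Lemma minimal_pole_function : (exists c, D c = 0 /\ ~ is_const c) ->
  exists f, [/\ D f = 0, ~ is_const f &
    forall x, D x = 0 -> ~ is_const x -> (forall r, den f r -> den x r) ->
      forall r, den x r -> den f r].
Proof.
move=> [c [Dc cC]].
have exn : exists n, `[< exists f, [/\ D f = 0, ~ is_const f & dependent_mod a b f n] >].
  by have [n cn] := cofin c; exists n; apply/asboolP; exists c.
have [n /asboolP[f [Df fC fn]] nmin] := ex_minnP exn.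
exists f; split=> // x Dx xC fx r0 xr0; apply: contrapT => fr0.
case: n fn nmin {exn} => [|n] fn nmin.
  by have [cc [[m hm] _]] := fn (fun _ => 0) (fun _ => comp_ring0 a b).
suff : (n.+1 <= n)%N by rewrite ltnn.
apply: nmin; apply/asboolP; exists x; split=> // r Rr.
(* [r0] vanishes modulo the denominators of [x] but not modulo those of [f], so it uses up one
   dimension and leaves codimension less than [n] for [x]. *)
pose r' (l : 'I_n.+1) := if unlift ord0 l is Some l' then r l' else r0.
have [|e e0 eden] := fn r'.
  by move=> l; rewrite /r'; case: unlift => [l'|]; [exact: Rr | case: xr0].
exists (fun l => e (lift ord0 l)); last first.
  have -> : \sum_(l < n) a (e (lift ord0 l)) * r l = \sum_l a (e l) * r' l - a (e ord0) * r0.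
    rewrite big_ord_recl /r' unlift_none addrC addKr.
    by apply: eq_bigr => l _; rewrite liftK.
  apply: denominatorD; first exact: fx.
  by apply: denominatorN; apply: denominatorM => //; exact: comp_ringl.
have [[l el]|nol] := pselect (exists l, e (lift ord0 l) != 0); first by exists l.
have el0 l : e (lift ord0 l) = 0.
  by apply/eqP; apply: contraT => el; case: nol; exists l.
have e00 : e ord0 != 0.
  have [l el] := e0; case: (unliftP ord0 l) => [l' ll|ll]; last by rewrite -ll.
  by move: el; rewrite ll el0 eqxx.
case: fr0; move: eden; rewrite big_ord_recl /r' unlift_none big1 ?addr0; last first.
  by move=> l _; rewrite el0 rmorph0 mul0r.
move=> h; have -> : r0 = a (e ord0)^-1 * (a (e ord0) * r0) by rewrite mulrA -rmorphM mulVf // rmorph1 mul1r.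
by apply: denominatorM => //; exact: comp_ringl.
Qed.

Section Pole.
Variable f : W.
Hypotheses (Df : D f = 0) (fC : ~ is_const f).
Hypothesis fmin : forall x, D x = 0 -> ~ is_const x -> (forall r, den f r -> den x r) ->
  forall r, den x r -> den f r.
Variables i0 i1 : W.
Hypotheses (den0 : den f i0) (den1 : den f i1) (i01 : i0 + f * i1 = 1).

Lemma f_notR : ~ R f. Proof. by move=> Rf; apply/fC/RC. Qed.
Lemma den_f1 : ~ den f 1.
Proof. by move=> [_]; rewrite mul1r; exact: f_notR. Qed.
(** If [d f = 0], the denominators of [f] form a nonzero [d]-stable ideal of [R], which contains 1
    by simplicity; then [f] lies in [R], against the assumption on constants there. *)
Lemma df0 : d f != 0.
Proof.
apply/eqP => df; have [] := den_f1.
apply: (comp_ring_simple (bd_ab bd) (bd_derd bd) (bd_da bd) (bd_db bd) (bd_constK bd) (J := den f)).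
- exact: denominatorD.
- by move=> r u; exact: denominatorM.
- by move=> u [].
- move=> u [Ru Ruf]; split; first exact: R_d.
  have -> : d u * f = d (u * f) by rewrite (drvM (bd_derd bd)) df mulr0 addr0.
  exact: R_d.
- have [i0z|?] := eqVneq i0 0; last by exists i0.
  exists i1 => //; apply/eqP => i1z; have /eqP := oner_neq0 W; apply.
  by rewrite -i01 i0z i1z mulr0 addr0.
Qed.

Local Notation evE p u := (map_poly a p).[u].

(** Modulo [den f] the quotient of [x] by [f] is represented by [u] in [R], and it is a constant of
    [D]. It is algebraic over [E] because [R] modulo [den f] is finite dimensional, hence its
    minimal polynomial has coefficients in [C] and a root [r] in [C]. Then [x - r f] should have
    fewer poles than [f], so it must lie in [C]. *)
Lemma simple_pole_space x : D x = 0 -> (forall i, den f i -> R (i * x)) ->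
  exists c0 c1, x = cst c0 + cst c1 * f.
Proof.
move=> Dx xI; pose u := i1 * x.
have Ru : R u by exact: xI.
(* This is the sense in which [x] equals [u f] modulo the denominators of [f]. *)
have I_x i : den f i -> den f (x * i - u * (f * i)).
  move=> di; have -> : x * i - u * (f * i) = (i0 * x) * i.
    have -> : i0 = 1 - f * i1 by rewrite -i01 addrK.
    by rewrite /u; ring.
  by apply: denominatorM => //; exact: xI.
have IRf i : den f i -> R (f * i) by move=> []; rewrite mulrC.
have dDu : den f (D u).
  have key i : den f i -> den f (D u * (f * i)).
    move=> di; have h1 := I_x _ (den_D Df di); have h2 := den_D Df (I_x _ di).
    have -> : D u * (f * i) = (x * D i - u * (f * D i)) - D (x * i - u * (f * i)).
      by rewrite (drvB (bd_derD bd)) !(drvM (bd_derD bd)) Dx Df; ring.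
    by apply: denominatorD => //; exact: denominatorN.
  have -> : D u = D u * (f * i1) + D u * i0 by rewrite -mulrDr addrC i01 mulr1.
  by apply: denominatorD; [exact: key | apply: denominatorM => //; exact: R_D].
have exn : exists n, `[< exists p : {poly E}, [/\ p != 0, den f (evE p u) & size p = n] >].
  have [N Ndep] := cofin f.
  have [|e [l el] eden] := Ndep (fun l => u ^+ l); first by move=> l; exact: comp_ringX.
  pose p := \poly_(l < N) (if insub l is Some l' then e l' else 0).
  exists (size p); apply/asboolP; exists p; split=> //.
    apply: contraNneq el => /polyP/(_ l); rewrite coef_poly ltn_ord coef0.
    by rewrite valK => ->.
  have -> : evE p u = \sum_(l0 < N) a (e l0) * u ^+ l0; last by [].
  rewrite (horner_coef_wide _ (n := N)); last by rewrite (leq_trans (size_poly _ _)) ?size_poly.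
  by apply: eq_bigr => l' _; rewrite coef_map coef_poly ltn_ord valK.
have [n /asboolP[p0 [p00 dp0 sp0]] nmin] := ex_minnP exn.
have small (q : {poly E}) : (size q < n)%N -> den f (evE q u) -> q = 0.
  move=> sq dq; apply/eqP; apply: contraT => q0; move: sq; rewrite ltnNge nmin //.
  by apply/asboolP; exists q.
pose p := (lead_coef p0)^-1 *: p0.
have lc0 : (lead_coef p0)^-1 != 0 by rewrite invr_eq0 lead_coef_eq0.
have pm : p \is monic by rewrite monicE lead_coefZ mulVf // lead_coef_eq0.
have sp : size p = n by rewrite size_scale.
have dp : den f (evE p u).
  rewrite /p -mul_polyC rmorphM hornerM /= map_polyC hornerC.
  by apply: denominatorM => //; exact: comp_ringl.
have RevE (q : {poly E}) : R (evE q u).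
  rewrite horner_coef; apply: comp_ring_sum => i _; rewrite coef_map.
  by apply: comp_ringM; [exact: comp_ringl | exact: comp_ringX].
have dE0 : dE 0 = 0 by apply: (fmorph_inj a); rewrite -(bd_Da bd) rmorph0 (drv0 (bd_derD bd)).
have dE1 : dE 1 = 0 by rewrite -(rmorph1 iE) dE_iE.
(* Differentiating the coefficients of a monic relation lowers its degree and gives a relation
   again, as [D u] is a denominator; minimality makes it zero. *)
have pconst : map_poly dE p = 0.
  have lt : (size (map_poly dE p) < n)%N.
    have n0 : (0 < n)%N by rewrite -sp size_poly_gt0 monic_neq0.
    rewrite -(prednK n0) ltnS; apply/leq_sizeP => j; rewrite leq_eqVlt => /orP[/eqP <-|nj].
      by rewrite coef_map_id0 // -sp -/(lead_coef p) (monicP pm) dE1.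
    by rewrite coef_map_id0 // nth_default ?dE0 // sp -(prednK n0).
  apply: small => //.
  have -> : evE (map_poly dE p) u = D (evE p u) - (map_poly a p)^`().[u] * D u.
    rewrite (drv_horner (bd_derD bd)) addrK; congr (_.[u]).
    apply/polyP => i; rewrite coef_map coef_map_id0 // coef_map_id0 ?(drv0 (bd_derD bd)) //.
    by rewrite coef_map (bd_Da bd).
  apply: denominatorD; first exact: den_D.
  by apply: denominatorN; apply: denominatorM => //; rewrite deriv_map.
have /choice[cf Hcf] i : exists c, p`_i = iE c.
  by apply: (bd_constE bd); move/polyP: pconst => /(_ i); rewrite coef_map_id0 // coef0.
pose q := \poly_(i < size p) cf i.
have pq : p = map_poly iE q.
  apply/polyP => i; rewrite coef_map coef_poly; case: ltnP => ip; first by rewrite Hcf.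
  by rewrite /= nth_default // rmorph0.
have sq : size q = n by rewrite -sp pq size_map_poly.
have sz2 : (1 < size q)%N.
  rewrite sq -sp ltnNge; apply/negP => sp1.
  have p1 : p = 1.
    have pC := size1_polyC sp1; have p01 : p`_0 = 1 by move/monicP: pm; rewrite {1}pC lead_coefC.
    by rewrite pC p01.
  by apply: den_f1; move: dp; rewrite p1 rmorph1 hornerC.
have [r /factor_theorem[q1 qE]] := closed_root closedC sz2.
pose x1 := x - cst r * f.
have [[c x1c]|x1C] := pselect (is_const x1).
  by exists c, r; rewrite -x1c /x1 subrK.
exfalso.
have Dx1 : D x1 = 0 by rewrite (drvB (bd_derD bd)) (drvM (bd_derD bd)) D_cst Dx Df mulr0 mul0r addr0 subrr.
have den_x1 s : den f s -> den x1 s.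
  move=> ds; split; first by case: ds.
  rewrite /x1 mulrBr; apply: comp_ringB; first exact: xI.
  by rewrite mulrCA; apply: comp_ringM; [exact: R_cst | case: ds].
(* If [x1] were nonconstant, it would have exactly the denominators of [f]; comaximality for [x1]
   would then make the proper factor [q1] of the minimal polynomial a relation for [u]. *)
have [k0 [k1 [dk0 dk1 k01]]] := comax x1.
have dk0' := fmin Dx1 x1C den_x1 dk0; have dk1' := fmin Dx1 x1C den_x1 dk1.
pose m1 := evE (map_poly iE q1) u.
have m1E : m1 * (u - cst r) = evE p u.
  by rewrite pq qE rmorphM rmorphB /= map_polyX map_polyC rmorphM rmorphB /= map_polyX map_polyC hornerM hornerD hornerN hornerX hornerC.
have q10 : q1 != 0 by apply: contraTneq sz2 => q10; rewrite qE q10 mul0r size_poly0.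
have dm1 : den f m1.
  have -> : m1 = k0 * m1 + m1 * (x * k1 - u * (f * k1)) + (f * k1) * (m1 * (u - cst r)).
    transitivity (m1 * (k0 + x1 * k1)); first by rewrite k01 mulr1.
    by rewrite /x1; ring.
  apply: denominatorD; first apply: denominatorD.
  - by rewrite mulrC; apply: denominatorM => //; exact: RevE.
  - by apply: denominatorM; [exact: RevE | exact: I_x].
  - by rewrite m1E; apply: denominatorM => //; exact: IRf.
have /eqP := q10; apply; apply/eqP; rewrite -(map_poly_eq0 iE); apply/eqP; apply: small dm1.
rewrite size_map_poly -sq qE size_Mmonic ?monicXsubC // size_XsubC addn2.
exact: ltnSn.
Qed.

End Pole.
End NoRingConstants.
End Core.

(** * Filtration by the order of the poles *)

Section Filtration.
Variables (C K E W : fieldType) (iK : {rmorphism C -> K}) (iE : {rmorphism C -> E}).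
Variables (a : {rmorphism E -> W}) (b : {rmorphism K -> W}).
Variables (dK : K -> K) (dE : E -> E) (D d : W -> W).
Hypothesis bd : bidifferential iK iE a b dK dE D d.
Hypotheses (closedC : GRing.closed_field_axiom C) (char0 : [pchar C] =i pred0).

Local Notation R := (comp_ring a b).
Local Notation den := (denominator a b).
Local Notation cst := (cst iE a).
Local Notation evp := (evp iE a).
Local Notation is_const := (is_const iE a).

Hypothesis RC : forall w, R w -> D w = 0 -> is_const w.
Variable f : W.
Hypotheses (Df : D f = 0) (fC : ~ is_const f).
Variables i0 i1 : W.
Hypotheses (den0 : den f i0) (den1 : den f i1) (i01 : i0 + f * i1 = 1).

(* [fil m] is the [R]-module spanned by [1, f, .., f ^+ m.-1]: at most [m.-1] times
   the poles of [f] are allowed. *)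
Definition fil (m : nat) (w : W) : Prop := exists2 p : {poly W},
  (size p <= m)%N & (forall i, R p`_i) /\ w = p.[f].

Lemma R_nat n : R n%:R.
Proof. by rewrite -(rmorph_nat a); exact: comp_ringl. Qed.

Lemma fil0 w : fil 0 w -> w = 0.
Proof. by move=> [p]; rewrite leqn0 size_poly_eq0 => /eqP -> [_ ->]; rewrite horner0. Qed.
Lemma fil1 w : fil 1 w -> R w.
Proof. by move=> [p /size1_polyC pC [pR ->]]; rewrite pC hornerC. Qed.
Lemma fil_ring w : R w -> fil 1 w.
Proof.
move=> Rw; exists w%:P; first exact: size_polyC_leq1.
by split=> [i|]; rewrite ?hornerC // coefC; case: eqP => _ //; exact: comp_ring0.
Qed.
Lemma fil_le m m' w : (m <= m')%N -> fil m w -> fil m' w.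
Proof. by move=> mm [p sp ?]; exists p => //; exact: leq_trans mm. Qed.
Lemma fil_0 m : fil m 0.
Proof. by exists 0; rewrite ?size_poly0 // horner0; split=> // i; rewrite coef0; exact: comp_ring0. Qed.
Lemma filD m u v : fil m u -> fil m v -> fil m (u + v).
Proof.
move=> [p sp [pR ->]] [q sq [qR ->]]; exists (p + q).
  by rewrite (leq_trans (size_polyD _ _)) // geq_max sp.
by split=> [i|]; rewrite ?hornerD // coefD; exact: comp_ringD.
Qed.
Lemma filM m m' u v : fil m.+1 u -> fil m' v -> fil (m + m') (u * v).
Proof.
move=> [p sp [pR ->]] [q sq [qR ->]]; exists (p * q).
  by move: (size_polyMleq p q); move: sp sq; move: (size p) (size q) (size (p * q)) => *; lia.
split=> [i|]; rewrite ?hornerM // coefM; apply: comp_ring_sum => j _.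
exact: comp_ringM.
Qed.
Lemma filR m r w : R r -> fil m w -> fil m (r * w).
Proof. by move=> /fil_ring Rr; exact: (filM Rr). Qed.
Lemma filN m w : fil m w -> fil m (- w).
Proof. by rewrite -mulN1r => h; apply: filR => //; apply/comp_ringN/comp_ring1. Qed.
Lemma fil_sum m I (r : seq I) (P : pred I) (F : I -> W) :
  (forall i, P i -> fil m (F i)) -> fil m (\sum_(i <- r | P i) F i).
Proof. by move=> H; elim/big_ind: _ => //; [exact: fil_0 | exact: filD]. Qed.
Lemma fil_f : fil 2 f.
Proof.
exists 'X; rewrite ?size_polyX // hornerX; split=> // i; rewrite coefX.
by case: eqP => _; [exact: comp_ring1 | exact: comp_ring0].
Qed.
Lemma fil_fX j : fil j.+1 (f ^+ j).
Proof.
elim: j => [|j IH]; first by rewrite expr0; exact/fil_ring/comp_ring1.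
by rewrite exprS; exact: (filM fil_f IH).
Qed.

Lemma fil_den m i w : den f i -> fil m.+1 w -> fil m.-1.+1 (i * w).
Proof.
move=> [Ri Rif] [p sp [pR ->]].
case: m sp => [|m] sp /=.
  by rewrite (size1_polyC sp) hornerC; apply: fil_ring; exact: comp_ringM.
have -> : i * p.[f] = i * p`_0 + (i * f) * (drop_poly 1 p).[f].
  have -> : p.[f] = p`_0 + f * (drop_poly 1 p).[f].
    rewrite -{1}(poly_take_drop 1 p) hornerD hornerM hornerXn expr1.
    have -> : take_poly 1 p = (p`_0)%:P.
      by apply/polyP => j; rewrite coef_take_poly coefC; case: j.
    by rewrite hornerC mulrC.
  by ring.
apply: filD.
  by apply: (@fil_le 1) => //; apply: fil_ring; exact: comp_ringM.
apply: filR => //; exists (drop_poly 1 p); last by split=> // j; rewrite coef_drop_poly.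
by rewrite size_drop_poly leq_subLR.
Qed.

Lemma fil_shift m w : fil m.+2 w -> fil m.+2 (f * w) -> fil m.+1 w.
Proof.
move=> fw ffw; have -> : w = i0 * w + i1 * (f * w).
  by rewrite -[LHS]mul1r -i01; ring.
by apply: filD; exact: (@fil_den m.+1).
Qed.

(** Multiplication by [f] raises the pole order by exactly one: any crude bound for [w] is improved
    step by step through [w = i0 w + i1 (f w)]. *)
Lemma fil_cancel1 m w : (exists n, fil n w) -> fil m.+2 (f * w) -> fil m.+1 w.
Proof.
move=> [n fw] ffw; elim: n fw => [|n IH] fw; first exact: fil_le fw.
have [nm|mn] := leqP n.+1 m.+1; first exact: fil_le fw.
case: n IH fw mn => // n IH fw mn; apply: IH; apply: fil_shift => //.
by apply: fil_le ffw; lia.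
Qed.

(** The constants of [D] whose only poles are those of [f]; they form a ring containing [C[f]]. *)
Definition reg w : Prop := D w = 0 /\ exists n, fil n w.

Lemma reg_const c : reg (cst c).
Proof. by split; [exact: D_cst bd c | exists 1%N; exact/fil_ring/R_cst]. Qed.

Lemma fil_cancel m w : reg w -> fil m.+1 (f * w) -> fil m w.
Proof.
move=> [Dw nw]; case: m => [|m]; last exact: fil_cancel1.
(* In the case [m = 0] both [w] and [f * w] lie in [R], hence in [C]; as [f] does not, [w] is 0. *)
move=> ffw; have : fil 1 w by apply: fil_cancel1 => //; exact: fil_le ffw.
move=> /fil1 /RC /(_ Dw)[c wc].
have [w0|w0] := eqVneq w 0; first by rewrite w0; exact: fil_0.
exfalso; have [|c' fc] := RC (fil1 ffw); first by rewrite (drvM (bd_derD bd)) Df Dw mul0r mulr0 addr0.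
apply: fC; exists (c' / c); rewrite rmorphM fmorphV /=.
apply: (mulIf w0); rewrite fc wc divfK //.
by rewrite -wc.
Qed.

Lemma fil_cancelX m j w : reg w -> fil (m + j) (f ^+ j * w) -> fil m w.
Proof.
elim: j m w => [|j IH] m w rw; first by rewrite addn0 expr0 mul1r.
rewrite exprSr -mulrA -addSnnS => /IH h; apply: fil_cancel => //; apply: h.
by have [Dw [n nw]] := rw; split; [rewrite (drvM (bd_derD bd)) Df Dw mul0r mulr0 addr0 | exists n.+1; exact: (filM fil_f nw)].
Qed.

Lemma regD u v : reg u -> reg v -> reg (u + v).
Proof.
move=> [Du [n nu]] [Dv [m mv]]; split; first by rewrite (drvD (bd_derD bd)) Du Dv addr0.
by exists (maxn n m); apply: filD; [apply: fil_le nu; exact: leq_maxl | apply: fil_le mv; exact: leq_maxr].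
Qed.
Lemma regM u v : reg u -> reg v -> reg (u * v).
Proof.
move=> [Du [n nu]] [Dv [m mv]]; split; first by rewrite (drvM (bd_derD bd)) Du Dv mul0r mulr0 addr0.
by exists (n + m)%N; apply: filM => //; exact: fil_le nu.
Qed.
Lemma reg0 : reg 0. Proof. by split; [exact: drv0 (bd_derD bd) | exists 0%N; exact: fil_0]. Qed.
Lemma reg_sum I (r : seq I) (P : pred I) (F : I -> W) :
  (forall i, P i -> reg (F i)) -> reg (\sum_(i <- r | P i) F i).
Proof. by move=> H; elim/big_ind: _ => //; [exact: reg0 | exact: regD]. Qed.

(** For two denominators [i], [i'] of [f] the product [i * i' * d f] lies in [R]; inserting
    [1 = (i0 + f i1)^2] expresses [d f] as a quadratic polynomial in [f] over [R]. *)
Lemma fil_df : fil 3 (d f).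
Proof.
have key i i' : den f i -> den f i' -> R (i * i' * d f).
  move=> [Ri Rif] [Ri' Rif'].
  have -> : i * i' * d f = i * d (i' * f) - (i * f) * d i' by rewrite (drvM (bd_derd bd)); ring.
  by apply: comp_ringB; apply: comp_ringM => //; exact: (R_d bd).
have -> : d f = i0 * i0 * d f + f * ((i0 * i1 * d f) *+ 2) + f ^+ 2 * (i1 * i1 * d f).
  rewrite -[LHS]mul1r -[1](expr1n _ 2) -i01; ring.
apply: filD; first apply: filD.
- by apply: (@fil_le 1) => //; exact/fil_ring/key.
- apply: (@fil_le 2) => //; apply: (filM fil_f (fil_ring _)).
  by rewrite mulr2n; apply: comp_ringD; exact: key.
- by apply: (filM (fil_fX 2) (fil_ring _)); exact: key.
Qed.

Lemma coef_drv (p : {poly W}) i : (map_poly d p)`_i = d p`_i.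
Proof. by rewrite coef_map_id0 // (drv0 (bd_derd bd)). Qed.

Lemma fil_drv_horner (p : {poly W}) m : (size p <= m)%N -> (forall i, R p`_i) ->
  fil m (map_poly d p).[f].
Proof.
move=> sp pR; exists (map_poly d p); last by split=> // i; rewrite coef_drv; exact: (R_d bd).
by apply/leq_sizeP => j mj; rewrite coef_drv nth_default ?(drv0 (bd_derd bd)) // (leq_trans sp).
Qed.

Lemma fil_deriv m w : fil m w -> fil m.+1 (d w).
Proof.
move=> [p sp [pR ->]]; rewrite (drv_horner (bd_derd bd)); apply: filD.
  by apply: fil_le (fil_drv_horner sp pR).
case: m sp => [|m] sp.
  by move: sp; rewrite leqn0 size_poly_eq0 => /eqP ->; rewrite deriv0 horner0 mul0r; exact: fil_0.
rewrite mulrC (_ : m.+2 = 2 + m)%N //; apply: (filM fil_df).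
exists p^`(); last by split=> // i; rewrite coef_deriv -mulr_natr; apply: comp_ringM => //; exact: R_nat.
by apply/leq_sizeP => j mj; rewrite coef_deriv nth_default ?mul0rn // (leq_trans sp).
Qed.

(* The leading term of [d] on [fil k.+1]: near a pole [d] acts on [f ^+ k] like
   multiplication by [k * d f / f]. *)
Lemma fil_deriv_lead k w : fil k.+1 w -> fil k.+2 (f * d w - k%:R * d f * w).
Proof.
move=> [p sp [pR ->]]; rewrite (drv_horner (bd_derd bd)).
pose g := 'X * p^`() - k%:R *: p.
have -> : f * ((map_poly d p).[f] + p^`().[f] * d f) - k%:R * d f * p.[f] =
          f * (map_poly d p).[f] + d f * g.[f].
  by rewrite /g hornerD hornerN hornerM hornerX hornerZ; ring.
apply: filD; first exact: (filM fil_f (fil_drv_horner sp pR)).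
have gR i : R g`_i.
  rewrite /g coefB coefXM coefZ; apply: comp_ringB.
    case: eqP => _; first exact: comp_ring0.
    rewrite coef_deriv -mulr_natr; apply: comp_ringM => //; exact: R_nat.
  by apply: comp_ringM => //; exact: R_nat.
have sg : (size g <= k)%N.
  apply/leq_sizeP => j kj; rewrite /g coefB coefXM coefZ coef_deriv.
  case: j kj => [|j] /= kj; first by move: kj; rewrite leqn0 => /eqP ->; rewrite mul0r subrr.
  move: kj; rewrite leq_eqVlt => /orP[/eqP <-|kj]; first by rewrite mulr_natl subrr.
  by rewrite nth_default ?mul0rn ?mulr0 ?subrr // (leq_trans sp).
by rewrite (_ : k.+2 = 2 + k)%N //; apply: (filM fil_df); exists g.
Qed.

Lemma fil_D m w : fil m w -> fil m (D w).
Proof.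
move=> [p sp [pR ->]]; rewrite (drv_horner (bd_derD bd)) Df mulr0 addr0.
have cD (q : {poly W}) i : (map_poly D q)`_i = D q`_i by rewrite coef_map_id0 // (drv0 (bd_derD bd)).
exists (map_poly D p); last by split=> // i; rewrite cD; exact: (R_D bd).
by apply/leq_sizeP => j mj; rewrite cD nth_default ?(drv0 (bd_derD bd)) // (leq_trans sp).
Qed.

Lemma fil_denX k w : fil k.+1 w -> R (i1 ^+ k * w).
Proof.
move=> fw; apply: fil1; elim: k w fw => [|k IH] w fw; first by rewrite expr0 mul1r.
by rewrite exprSr -mulrA; apply: IH; exact: (@fil_den k.+1).
Qed.

(** The class of [i1 ^+ k.+1 * w] modulo [den f] plays the role of the leading coefficient of [w]:
    when it vanishes, the pole order drops. *)
Lemma fil_den_lower k w : fil k.+2 w -> den f (i1 ^+ k.+1 * w) -> fil k.+1 w.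
Proof.
elim: k w => [|k IH] w fw dw.
  have -> : w = i0 * w + (i1 ^+ 1 * w) * f by rewrite -[LHS]mul1r -i01; ring.
  by apply: filD; [exact: (@fil_den 1) | apply: fil_ring; case: dw].
have -> : w = i0 * w + f * (i1 * w) by rewrite -[LHS]mul1r -i01; ring.
apply: filD; first exact: (@fil_den k.+2).
apply: (filM fil_f); apply: IH; first exact: (@fil_den k.+2).
by rewrite mulrA -exprSr.
Qed.

(** The [x i], of pole order [g i], are raised by powers of [f] to a common order [k]; no nontrivial
    [C]-combination of their leading terms may cancel. *)
Definition lead_indep n (x : nat -> W) (g : nat -> nat) : Prop := forall k (c : nat -> C),
  (forall i, (i < n)%N -> c i != 0 -> (g i <= k)%N) ->
  fil k (\sum_(i < n) cst (c i) * f ^+ (k - g i) * x i) -> forall i, (i < n)%N -> c i = 0.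

(** No single term may exceed the order allowed to the sum; by truncated subtraction [p i = 0] when
    [g i >= m]. *)
Definition fil_span n (x : nat -> W) (g : nat -> nat) m w : Prop :=
  exists2 p : nat -> {poly C}, (forall i, (i < n)%N -> (size (p i) <= m - g i)%N) &
    w = \sum_(i < n) evp (p i) f * x i.

Variable N : nat.
Hypothesis depN : dependent_mod a b f N.
Hypothesis simple_pole : forall x, D x = 0 -> (forall i, den f i -> R (i * x)) ->
  exists c0 c1, x = cst c0 + cst c1 * f.

(** Leading coefficients live in [R] modulo [den f], of dimension less than [N] over [E]. A relation
    over [E] between leading terms of constants of [D] yields one over [C], by the Wronskian
    argument modulo [fil k]. *)
Lemma lead_indep_bound n x g :
  (forall i, (i < n)%N -> D (x i) = 0 /\ fil (g i).+1 (x i)) -> lead_indep n x g -> (n < N)%N.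
Proof.
move=> xg ind; rewrite ltnNge; apply/negP => Nn.
pose k := (\max_(i < n) g i).+1.
have gk i : (i < n)%N -> (g i <= k)%N.
  by move=> il; apply: leqW; exact: (leq_bigmax (Ordinal il)).
pose y i := f ^+ (k - g i) * x i.
have yk i : (i < n)%N -> fil k.+1 (y i).
  move=> il; rewrite (_ : k.+1 = (k - g i) + (g i).+1)%N; last by rewrite addnS subnK // gk.
  by apply: filM; [exact: fil_fX | case: (xg i il)].
pose r (l : 'I_N) := i1 ^+ k * y l.
have [|e [l el] eden] := depN (r := r).
  by move=> l; apply: fil_denX; apply: yk; exact: leq_trans (ltn_ord l) Nn.
pose x' i := if (i < N)%N then y i else 0.
have Dx' i : D (x' i) = 0.
  rewrite /x'; case: ltnP => [iN|_]; last exact: drv0 (bd_derD bd).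
  have [Dxi _] := xg i (leq_trans iN Nn).
  by rewrite /y (drvM (bd_derD bd)) Dxi (drvX (bd_derD bd)) Df !mulr0 mul0r addr0.
pose e' (i : nat) := if insub i is Some l then e l else 0.
have filZ : fil k (\sum_(i < N) x' i * a (e' i)).
  apply: fil_den_lower.
    apply: fil_sum => i _; rewrite mulrC; apply: filR; first exact: comp_ringl.
    by rewrite /x' ltn_ord; apply: yk; exact: leq_trans (ltn_ord i) Nn.
  move: eden; congr (den f _); rewrite mulr_sumr; apply: eq_bigr => i _.
  by rewrite /x' /e' ltn_ord valK /r; ring.
have [||| c [j jN cj] crel] := constants_disjoint_mod (bd_derD bd) (bd_Da bd) (bd_constE bd)
   (V := fil k) (x := e') _ _ Dx' _ filZ.
- by move=> e'' u; apply: filR; exact: comp_ringl.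
- exact: fil_D.
- by exists l => //; rewrite /e' valK.
have := ind k (fun i => if (i < N)%N then c i else 0) _ _ j (leq_trans jN Nn).
rewrite jN => h; move/eqP: cj; apply; apply: h => [i il _|]; first exact: gk.
move: crel; congr (fil k _).
rewrite (big_ord_widen n (fun i => x' i * a (iE (c i)))) // big_mkcond /=.
apply: eq_bigr => i _; rewrite /x'; case: ltnP => _; last by rewrite rmorph0 !mul0r.
by rewrite /y /cst /=; ring.
Qed.

(** Here the choice of [f] enters: up to pole order 1 the generator 1 suffices, so all later
    generators have order at least 2. *)
Lemma fil_span_const m w : (m <= 2)%N -> D w = 0 -> fil m w ->
  fil_span 1 (fun=> 1) (fun=> 0%N) m w.
Proof.
case: m => [|[|[|//]]] _ Dw fw; rewrite /fil_span.
- by exists (fun=> 0) => [i _|]; rewrite ?size_poly0 // big_ord1 evp0 mul0r; exact: fil0.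
- have [c ->] := RC (fil1 fw) Dw; exists (fun=> c%:P) => [i _|].
    exact: size_polyC_leq1.
  by rewrite big_ord1 evpC mulr1.
have [|c0 [c1 ->]] := simple_pole Dw; first by move=> i di; apply: fil1; exact: (@fil_den 1).
exists (fun=> c0%:P + c1 *: 'X) => [i _|]; last by rewrite big_ord1 evpD evpC evpZ evpX mulr1.
rewrite (leq_trans (size_polyD _ _)) // geq_max (leq_trans (size_polyC_leq1 _)) //=.
by rewrite (leq_trans (size_scale_leq _ _)) // size_polyX.
Qed.

(** Greedy construction: as long as some constant is not spanned, add one of least order. Its
    leading term is independent of the earlier ones, and [lead_indep_bound] stops the process. *)
Lemma adapted_basis : exists n x g,
  [/\ (0 < n)%N, x 0%N = 1 /\ g 0%N = 0%N,
      forall i, (i < n)%N -> (0 < i)%N -> (2 <= g i)%N,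
      (forall i, (i < n)%N -> D (x i) = 0 /\ fil (g i).+1 (x i)) /\ lead_indep n x g
    & forall m w, D w = 0 -> fil m w -> fil_span n x g m w].
Proof.
(* All constants in [fil m] with [m < kappa] are already spanned, and the orders used so far are
   below [kappa]. *)
pose inv n x g kappa := [/\ (0 < n)%N, x 0%N = 1 /\ g 0%N = 0%N,
      forall i, (i < n)%N -> (0 < i)%N -> (2 <= g i)%N,
      (forall i, (i < n)%N -> D (x i) = 0 /\ fil (g i).+1 (x i)) /\ lead_indep n x g
    & [/\ (3 <= kappa)%N, forall i, (i < n)%N -> (g i < kappa)%N &
       forall m w, (m < kappa)%N -> D w = 0 -> fil m w -> fil_span n x g m w]].
suff main r n x g kappa : inv n x g kappa -> (N <= n + r)%N -> exists n x g,
  [/\ (0 < n)%N, x 0%N = 1 /\ g 0%N = 0%N,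
      forall i, (i < n)%N -> (0 < i)%N -> (2 <= g i)%N,
      (forall i, (i < n)%N -> D (x i) = 0 /\ fil (g i).+1 (x i)) /\ lead_indep n x g
    & forall m w, D w = 0 -> fil m w -> fil_span n x g m w].
  apply: (main N 1%N (fun=> 1) (fun=> 0%N) 3%N); last by rewrite leq_addl.
  split=> //; first by move=> [|i].
    split=> [i _|].
      by split; [exact: drv1 (bd_derD bd) | exact/fil_ring/comp_ring1].
    move=> k c _; rewrite big_ord1 subn0 mulr1 => fk [|i] // _.
    apply: (fmorph_inj (cst)); rewrite rmorph0; apply: fil0.
    by apply: (@fil_cancelX 0 k); [exact: reg_const | rewrite mulrC].
  by split=> // m w m3; exact: fil_span_const.
elim: r n x g kappa => [|r IH] n x g kappa [n0 x0 g2 [xg ind] [kap gk comp]] Nr.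
  by have := lead_indep_bound xg ind; rewrite ltnNge -[n]addn0 Nr.
have [all | ] := pselect (forall m w, D w = 0 -> fil m w -> fil_span n x g m w).
  by exists n, x, g.
move=> nall; have exm : exists m, `[< exists w, [/\ D w = 0, fil m w & ~ fil_span n x g m w] >].
  apply: contrapT => nex; apply: nall => m w Dw fw; apply: contrapT => nsp.
  by apply: nex; exists m; apply/asboolP; exists w.
have [m /asboolP[w [Dw fw nsp]] mmin] := ex_minnP exm.
have mk : (kappa <= m)%N by rewrite leqNgt; apply/negP => mk; apply/nsp/comp.
have {}comp m' w' : (m' < m)%N -> D w' = 0 -> fil m' w' -> fil_span n x g m' w'.
  move=> mm Dw' fw'; apply: contrapT => nsp'; move: mm; rewrite ltnNge mmin //.
  by apply/asboolP; exists w'.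
have m0 : (0 < m)%N by rewrite (leq_trans _ mk) // (leq_trans _ kap).
have gm i : (i < n)%N -> (g i <= m.-1)%N.
  by move=> il; rewrite -ltnS prednK // (leq_trans (gk i il)).
pose x' i := if i == n then w else x i; pose g' i := if i == n then m.-1 else g i.
have x'n i : (i < n)%N -> x' i = x i by move=> il; rewrite /x' (ltn_eqF il).
have g'n i : (i < n)%N -> g' i = g i by move=> il; rewrite /g' (ltn_eqF il).
have x'N : x' n = w by rewrite /x' eqxx.
have g'N : g' n = m.-1 by rewrite /g' eqxx.
apply: (IH n.+1 x' g' m); last by rewrite addSnnS.
split=> //.
- by rewrite /x' /g' (ltn_eqF n0).
- move=> i; rewrite ltnS leq_eqVlt => /orP[/eqP -> _|il i0'].
    by rewrite g'N -ltnS prednK // (leq_trans kap).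
  by rewrite g'n // g2.
- split=> [i|k c gc fk].
    rewrite ltnS leq_eqVlt => /orP[/eqP ->|il]; last by rewrite x'n // g'n //; exact: xg.
    by rewrite x'N g'N prednK.
  have sumE (F : nat -> W) : \sum_(i < n.+1) F i = \sum_(i < n) F i + F n.
    by rewrite big_ord_recr.
  have [cn|cn] := eqVneq (c n) 0.
    move=> i; rewrite ltnS leq_eqVlt => /orP[/eqP -> //|il].
    apply: (ind k c) => // [j jl cj|]; first by rewrite -g'n // gc // ltnW.
    move: fk; rewrite (sumE (fun i => cst (c i) * f ^+ (k - g' i) * x' i)) cn rmorph0 !mul0r addr0.
    by congr (fil k _); apply: eq_bigr => j _; rewrite x'n // g'n.
  exfalso; apply: nsp; have mk' : (m.-1 <= k)%N by rewrite -g'N gc.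
  (* A cancellation of leading terms involving [w] would bring [Z] down to [fil m.-1], where
     everything is spanned; then [w] would be spanned too. *)
  pose Z := \sum_(i < n) cst (c i) * f ^+ (m.-1 - g i) * x i + cst (c n) * w.
  have regZ : reg Z.
    apply: regD; last by apply: regM; [exact: reg_const | split=> //; exists m].
    apply: reg_sum => i _; have [Dxi fxi] := xg i (ltn_ord i).
    apply: regM; last by split=> //; eexists; exact: fxi.
    apply: regM; first exact: reg_const.
    split; last by eexists; exact: fil_fX.
    by rewrite (drvX (bd_derD bd)) Df mulr0.
  have fZ : fil m.-1 Z.
    apply: (@fil_cancelX _ (k - m.-1)) => //; rewrite subnKC //.
    move: fk; rewrite (sumE (fun i => cst (c i) * f ^+ (k - g' i) * x' i)).
    congr (fil k _); rewrite /Z mulrDr mulr_sumr x'N g'N; congr (_ + _); last by ring.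
    apply: eq_bigr => i _; rewrite x'n // g'n //.
    have -> : (k - g i = (k - m.-1) + (m.-1 - g i))%N by have := gm i (ltn_ord i); lia.
    by rewrite exprD; ring.
  have [p sp Zp] := comp _ _ (leq_trans (ltnSn _) (eq_leq (prednK m0))) regZ.1 fZ.
  exists (fun i => (c n)^-1 *: (p i - c i *: 'X^(m.-1 - g i))) => [i il|].
    rewrite (leq_trans (size_scale_leq _ _)) // (leq_trans (size_polyD _ _)) // geq_max size_polyN.
    rewrite (leq_trans (sp i il)) ?leq_sub2r ?leq_pred //.
    rewrite (leq_trans (size_scale_leq _ _)) // size_polyXn.
    by have := gm i il; move: m0; lia.
  apply: (mulfI (x := cst (c n))); first by rewrite fmorph_eq0.
  have -> : cst (c n) * w = Z - \sum_(i < n) cst (c i) * f ^+ (m.-1 - g i) * x i by rewrite /Z; ring.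
  rewrite Zp -sumrB mulr_sumr; apply: eq_bigr => i _.
  rewrite evpZ evpB evpZ evpXn.
  have -> : cst (c n) * (cst (c n)^-1 * (evp (p i) f - cst (c i) * f ^+ (m.-1 - g i)) * x i)
          = (cst (c n) * cst (c n)^-1) * ((evp (p i) f - cst (c i) * f ^+ (m.-1 - g i)) * x i) by ring.
  by rewrite -rmorphM divff // rmorph1; ring.
split=> //; first exact: leq_trans mk.
- move=> i; rewrite ltnS leq_eqVlt => /orP[/eqP ->|il]; first by rewrite g'N prednK.
  by rewrite g'n // -(prednK m0) ltnS gm.
- move=> m' w' mm Dw' fw'; have [p sp wp] := comp _ _ mm Dw' fw'.
  exists (fun i => if (i < n)%N then p i else 0) => [i|].
    rewrite ltnS leq_eqVlt => /orP[/eqP ->|il]; first by rewrite ltnn size_poly0.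
    by rewrite il g'n // sp.
  rewrite big_ord_recr /= ltnn evp0 mul0r addr0 wp; apply: eq_bigr => i _.
  by rewrite ltn_ord x'n.
Qed.

Lemma fil_evp m (p : {poly C}) : (size p <= m)%N -> fil m (evp p f).
Proof.
move=> sp; exists (map_poly cst p); first by rewrite size_map_poly.
by split=> // i; rewrite coef_map; exact: R_cst.
Qed.

(** In a relation over [C[f]] the terms of highest total order cancel among themselves, so their
    coefficients vanish by independence of leading terms; induction on that order finishes. *)
Lemma lead_indep_free n x g : (forall i, (i < n)%N -> D (x i) = 0 /\ fil (g i).+1 (x i)) ->
    lead_indep n x g ->
  forall p : nat -> {poly C}, \sum_(i < n) evp (p i) f * x i = 0 -> forall i, (i < n)%N -> p i = 0.
Proof.
move=> xg ind p rel.
suff H M (q : nat -> {poly C}) : (forall i, (i < n)%N -> (size (q i) <= M - g i)%N) ->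
    \sum_(i < n) evp (q i) f * x i = 0 -> forall i, (i < n)%N -> q i = 0.
  apply: (H (\sum_(i < n) (size (p i) + g i))%N) rel => i il.
  by rewrite (bigD1 (Ordinal il)) //=; lia.
elim: M q => [|M IH] q sq qrel i il.
  by apply/eqP; rewrite -size_poly_eq0 -leqn0 (leq_trans (sq i il)) // sub0n.
(* The test makes [c] vanish where [g j > M], as [lead_indep] demands. *)
pose c j := if (g j <= M)%N then (q j)`_(M - g j) else 0.
pose q' j := q j - c j *: 'X^(M - g j).
have sq' j : (j < n)%N -> (size (q' j) <= M - g j)%N.
  move=> jl; apply/leq_sizeP => l; rewrite /q' /c coefB coefZ coefXn.
  have := sq j jl; case: (leqP (g j) M) => gM sqj; rewrite ?mul0r ?subr0.
    rewrite leq_eqVlt => /orP[/eqP <-|ll]; first by rewrite eqxx mulr1 subrr.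
    rewrite (gtn_eqF ll) mulr0 subr0 nth_default // (leq_trans sqj) //; lia.
  by move=> _; rewrite nth_default // (leq_trans sqj) //; lia.
have qE j : q j = q' j + c j *: 'X^(M - g j) by rewrite subrK.
have c0 : forall j, (j < n)%N -> c j = 0.
  apply: (ind M) => [j jl|]; first by rewrite /c; case: ifP => //; rewrite eqxx.
  have -> : \sum_(j < n) cst (c j) * f ^+ (M - g j) * x j = - \sum_(j < n) evp (q' j) f * x j.
    apply/eqP; rewrite -addr_eq0 -big_split -[X in _ == X]qrel; apply/eqP.
    by apply: eq_bigr => j _; rewrite [in RHS]qE evpD evpZ evpXn /=; ring.
  apply: filN; apply: fil_sum => j _; have [Dxj fxj] := xg j (ltn_ord j).
  have sj := sq' j (ltn_ord j).
  have [qj0|qj0] := eqVneq (q' j) 0; first by rewrite qj0 evp0 mul0r; exact: fil_0.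
  have gM : (g j < M)%N.
    by rewrite ltnNge; apply/negP => Mg; move: sj; rewrite (eqP Mg) leqn0 size_poly_eq0 (negbTE qj0).
  rewrite (_ : M = (M - g j).-1 + (g j).+1)%N; last by lia.
  apply: filM => //; rewrite prednK ?subn_gt0 //; exact: fil_evp.
rewrite qE c0 // scale0r addr0; apply: (IH q') => //.
rewrite -[RHS]qrel; apply: eq_bigr => j _; by rewrite [in RHS]qE c0 // scale0r addr0.
Qed.
End Filtration.

(** * Trace duality *)

Section Duality.
Variables (C K E W : fieldType) (iK : {rmorphism C -> K}) (iE : {rmorphism C -> E}).
Variables (a : {rmorphism E -> W}) (b : {rmorphism K -> W}).
Variables (dK : K -> K) (dE : E -> E) (D d : W -> W).
Hypothesis bd : bidifferential iK iE a b dK dE D d.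
Hypotheses (closedC : GRing.closed_field_axiom C) (char0 : [pchar C] =i pred0).

Local Notation R := (comp_ring a b).
Local Notation den := (denominator a b).
Local Notation cst := (cst iE a).
Local Notation evp := (evp iE a).
Local Notation is_const := (is_const iE a).

Hypothesis RC : forall w, R w -> D w = 0 -> is_const w.
Variable f : W.
Hypotheses (Df : D f = 0) (fC : ~ is_const f).
Variables i0 i1 : W.
Hypotheses (den0 : den f i0) (den1 : den f i1) (i01 : i0 + f * i1 = 1).
Local Notation fil := (fil a b f).

Variables (n : nat) (x : nat -> W) (g : nat -> nat).
Hypotheses (n0 : (0 < n)%N) (x0 : x 0%N = 1) (g0 : g 0%N = 0%N).
Hypothesis g2 : forall i, (i < n)%N -> (0 < i)%N -> (2 <= g i)%N.
Hypothesis xg : forall i, (i < n)%N -> D (x i) = 0 /\ fil (g i).+1 (x i).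
Hypothesis free_x : forall p : nat -> {poly C}, \sum_(i < n) evp (p i) f * x i = 0 ->
  forall i, (i < n)%N -> p i = 0.
Hypothesis span_x : forall m w, D w = 0 -> fil m w -> fil_span iE a f n x g m w.

Definition evf : {poly C} -> W := horner_eval f \o map_poly cst.
HB.instance Definition _ := GRing.RMorphism.copy evf (horner_eval f \o map_poly cst).
Arguments evf : simpl never.
Lemma evfE p : evf p = evp p f. Proof. by []. Qed.
Lemma evf_inj : injective evf.
Proof.
move=> p q pq; apply/eqP; rewrite -subr_eq0; apply/eqP; apply: (evp_eq0 closedC fC).
by rewrite -evfE rmorphB /= pq subrr.
Qed.
Lemma evp_inj p q : evp p f = evp q f -> p = q. Proof. exact: evf_inj. Qed.

Lemma df_neq0 : d f != 0. Proof. exact: (df0 bd RC Df fC den0 den1 i01). Qed.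

Section Trace.
Variables (k : fieldType) (io : {rmorphism k -> W}).
Hypothesis ioP : forall w, frac_image evf w <-> exists c, io c = w.

Definition xbas (i : 'I_n) : W := x i.
Local Notation span := (in_span io xbas).
Local Notation tr := (ext_trace io xbas).

Lemma io_evp p : exists c, io c = evp p f.
Proof. exact: frac_image_ev ioP p. Qed.
Lemma D_io c : D (io c) = 0.
Proof.
have [P [Q [Q0 ->]]] := frac_imageP ioP c; rewrite /= !evfE.
by rewrite (drvM (bd_derD bd)) (drvV (bd_derD bd)) !(D_evp bd) // oppr0 !mul0r mulr0 addr0.
Qed.
Lemma char0_trace : [pchar k] =i pred0.
Proof.
move=> p; rewrite -(char0 p) !inE; congr (_ && _).
by rewrite -(fmorph_eq0 io) -(fmorph_eq0 iE) -(fmorph_eq0 a) !rmorph_nat.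
Qed.

Lemma xbas_indep (c : 'rV[k]_n) : lincomb io xbas c = 0 -> c = 0.
Proof.
move=> rel; have [P [Q [Q0 cE]]] := common_denominator evf_inj ioP (fun j => c 0 j).
pose p (i : nat) := if insub i is Some j then P j else 0.
have pE (j : 'I_n) : p j = P j by rewrite /p valK.
have pz : forall i, (i < n)%N -> p i = 0.
  apply: free_x; transitivity (evf Q * lincomb io xbas c); last by rewrite rel mulr0.
  rewrite mulr_sumr; apply: eq_bigr => i _; rewrite cE pE /= -evfE /xbas; field.
  by rewrite (ev_eq0 evf_inj).
apply/rowP => j; apply: (fmorph_inj io); rewrite mxE rmorph0 cE -pE pz //.
by rewrite rmorph0 mul0r.
Qed.

Lemma span_fil m w : D w = 0 -> fil m w ->
  exists2 c, w = lincomb io xbas c &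
    forall j : 'I_n, exists2 p : {poly C}, (size p <= m - g j)%N & io (c 0 j) = evp p f.
Proof.
move=> Dw fw; have [p sp ->] := span_x Dw fw.
have /choice[c Hc] (j : 'I_n) := io_evp (p j).
exists (\row_j c j) => [|j]; last by exists (p j); rewrite ?mxE ?Hc // sp.
by apply: eq_bigr => j _; rewrite mxE Hc.
Qed.

Lemma in_span_fil m w : D w = 0 -> fil m w -> span w.
Proof. by move=> Dw fw; have [c -> _] := span_fil Dw fw; exists c. Qed.
Lemma xbas_span1 : span 1.
Proof. by apply: (@in_span_fil 1); [exact: drv1 (bd_derD bd) | exact/fil_ring/comp_ring1]. Qed.
Lemma D_xbas i : D (xbas i) = 0. Proof. by have [] := xg (ltn_ord i). Qed.
Lemma xbas_spanM i j : span (xbas i * xbas j).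
Proof.
have [Di fi] := xg (ltn_ord i); have [Dj fj] := xg (ltn_ord j).
by apply: in_span_fil (filM fi fj); rewrite (drvM (bd_derD bd)) /xbas Di Dj mul0r mulr0 addr0.
Qed.
Lemma D_span w : span w -> D w = 0.
Proof.
move=> [c ->]; rewrite /lincomb (drv_sum (bd_derD bd)) big1 // => i _.
by rewrite (drvM (bd_derD bd)) D_io D_xbas mul0r mulr0 addr0.
Qed.
Lemma Ddf : D (d f) = 0. Proof. by rewrite (bd_comm bd) Df (drv0 (bd_derd bd)). Qed.
Let fdf : fil 3 (d f). Proof. exact: (fil_df bd den0 den1 i01). Qed.
Lemma span_df : span (d f). Proof. exact: in_span_fil Ddf fdf. Qed.

Lemma spanM u v : span u -> span v -> span (u * v). Proof. exact: (in_spanM xbas_spanM). Qed.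
Lemma span_dfV : span (d f)^-1. Proof. exact: (in_spanV xbas_indep xbas_span1 xbas_spanM span_df). Qed.

Lemma trD u v : span u -> span v -> tr (u + v) = tr u + tr v.
Proof. exact: (ext_traceD xbas_indep xbas_spanM). Qed.
Lemma trZ c u : span u -> tr (io c * u) = c * tr u.
Proof. exact: (ext_traceZ xbas_indep xbas_spanM). Qed.
Lemma tr0 : tr 0 = 0.
Proof. exact: (ext_trace0 xbas_indep xbas_span1 xbas_spanM). Qed.
Lemma tr_sum (I : finType) (F : I -> W) : (forall i, span (F i)) ->
  tr (\sum_i F i) = \sum_i tr (F i).
Proof. exact: (ext_trace_sum xbas_indep xbas_span1 xbas_spanM). Qed.
Lemma tr_lincomb u c : span u ->
  tr (u * lincomb io xbas c) = \sum_i c 0 i * tr (u * xbas i).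
Proof. exact: (ext_trace_lincomb xbas_indep xbas_span1 xbas_spanM). Qed.
Ltac span_tac := repeat first
  [assumption | exact: span_dfV | exact: span_df | exact: in_span_basis | apply: spanM].

(** The multiple of [d] with value 1 at [f]: it acts on [C(f)] as the ordinary derivative, so it
    preserves that field and commutes with the trace, which [d] itself need not do. *)
Definition dlog (w : W) : W := d w / d f.
Lemma dlog_der : derivation dlog.
Proof.
split=> u v; rewrite /dlog; first by rewrite (drvD (bd_derd bd)) mulrDl.
by rewrite (drvM (bd_derd bd)); ring.
Qed.
Lemma dlog_evp p : dlog (evp p f) = evp p^`() f.
Proof. by rewrite /dlog (d_evp bd) mulfK // df_neq0. Qed.

Lemma dlog_io : exists dk : k -> k, forall c, dlog (io c) = io (dk c).
Proof.
have /choice[dk dkP] : forall c, exists c', dlog (io c) = io c'; last by exists dk.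
move=> c; have [P [Q [Q0 ->]]] := frac_imageP ioP c.
have [c' c'E] := frac_image_ex ioP (P^`() * Q - P * Q^`()) (expf_neq0 2 Q0).
exists c'; rewrite c'E /= !evfE (drv_div dlog_der) ?dlog_evp; last by rewrite -evfE (ev_eq0 evf_inj).
by rewrite -!evfE rmorphB rmorphXn !rmorphM /=.
Qed.

Lemma span_d w : span w -> span (d w).
Proof.
have [dk dkE] := dlog_io => hw.
rewrite -[d w](divfK df_neq0); apply: spanM span_df.
apply: (in_span_drv dlog_der dkE) hw => i.
have [Di fi] := xg (ltn_ord i).
apply: spanM span_dfV; apply: in_span_fil (fil_deriv bd den0 den1 i01 fi).
by rewrite (bd_comm bd) Di (drv0 (bd_derd bd)).
Qed.

Definition dual_form (y w : W) : k := tr (y * w / d f).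
(* [y] stands for the functional [w |-> tr (y * w / d f)]; the bound on its degree
   says that it has no pole over the poles of [f]. *)
Definition dual_set (y : W) : Prop := span y /\ forall m w, D w = 0 -> fil m w ->
  exists2 p : {poly C}, (size p <= m - 2)%N & io (dual_form y w) = evp p f.

Lemma dual_formD y u v : span y -> span u -> span v ->
  dual_form y (u + v) = dual_form y u + dual_form y v.
Proof.
move=> hy hu hv; rewrite /dual_form mulrDr mulrDl trD //; span_tac.
Qed.
Lemma dual_formZ y c u : span y -> span u -> dual_form y (io c * u) = c * dual_form y u.
Proof.
move=> hy hu; rewrite /dual_form -trZ //; first by congr tr; ring.
span_tac.
Qed.

(** By differentiating a trace, the form of [d y] is given by the derivative of [p0] minus [p1]. The
    bounds on [p0] and [p1] alone miss the required size by one; [fil_deriv_lead] makes the top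
    coefficients cancel. *)
Lemma dual_set_d y : dual_set y -> dual_set (d y).
Proof.
move=> [hy Hy]; split; first exact: span_d.
case=> [|k'] w Dw fw.
  exists 0; first by rewrite size_poly0.
  by rewrite (fil0 fw) /dual_form mulr0 mul0r tr0 // rmorph0 evp0.
have hw := in_span_fil Dw fw.
have Ddw : D (d w) = 0 by rewrite (bd_comm bd) Dw (drv0 (bd_derd bd)).
have Dfw : D (d f * w) = 0 by rewrite (drvM (bd_derD bd)) Ddf Dw mul0r mulr0 addr0.
have ffw : fil k'.+3 (d f * w) by exact: (filM fdf fw).
have fdw := fil_deriv bd den0 den1 i01 fw.
have fu := fil_deriv_lead bd den0 den1 i01 fw.
set u := f * d w - k'%:R * d f * w in fu.
have Du : D u = 0.
  rewrite /u (drvB (bd_derD bd)) -mulrA !(drvM (bd_derD bd)) (drv_nat (bd_derD bd)).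
  by rewrite Df Ddw Ddf Dw !(mul0r, mulr0, addr0) subrr.
have [p0 sp0 e0] := Hy _ _ Dfw ffw.
have [p1 sp1 e1] := Hy _ _ Ddw fdw.
have [p2 sp2 e2] := Hy _ _ Du fu.
have [dk dkE] := dlog_io.
have form_d : io (dual_form (d y) w) = evp (p0^`() - p1) f.
  rewrite evpB -dlog_evp -e0 -e1 dkE -rmorphB; congr (io _).
  have hyw : span (y * w) by exact: spanM.
  have -> : dual_form y (d f * w) = tr (y * w).
    by rewrite /dual_form; congr tr; field; exact: df_neq0.
  rewrite -(ext_trace_drv xbas_indep xbas_spanM dlog_der dkE) //; last first.
    by move=> i; apply: spanM span_dfV; apply: span_d; exact: in_span_basis.
  have -> : dlog (y * w) = d y * w / d f + y * d w / d f.
    by rewrite /dlog (drvM (bd_derd bd)) mulrDl.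
  rewrite trD ?addrK //; span_tac; exact: span_d.
exists (p0^`() - p1); last exact: form_d.
have rel : 'X * p1 = k'%:R *: p0 + p2.
  apply: evp_inj; rewrite evpM evpX evpD evpZ -e0 -e1 -e2 rmorph_nat.
  have [cf cfE] := io_evp 'X; rewrite evpX in cfE.
  have [ck ckE] := io_evp (k'%:R)%:P; rewrite evpC rmorph_nat in ckE.
  have su : span u by exact: in_span_fil Du fu.
  have sdw : span (d w) by exact: span_d.
  have sfw : span (d f * w) by exact: spanM span_df hw.
  rewrite -{1}cfE -ckE -!rmorphM -rmorphD; congr (io _).
  rewrite -!dual_formZ // -dual_formD //; last exact: in_spanZ.
  by congr dual_form; rewrite cfE ckE /u; ring.
(* The polynomial [p0] has degree at most [k'], so the Euler-type expression in parentheses loses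
   its coefficient of degree [k']. *)
have Xq : (p0^`() - p1) * 'X = ('X * p0^`() - k'%:R *: p0) - p2.
  by rewrite mulrBl -[p1 * 'X]mulrC rel; ring.
have sX : (size ((p0^`() - p1) * 'X)%R <= k')%N.
  rewrite Xq (leq_trans (size_polyD _ _)) // geq_max size_polyN; apply/andP; split; last first.
    by move: sp2; rewrite !subSS subn0.
  apply/leq_sizeP => j kj; rewrite coefB coefXM coefZ coef_deriv.
  case: j kj => [|j] /= kj; first by move: kj; rewrite leqn0 => /eqP ->; rewrite mul0r subrr.
  move: kj; rewrite leq_eqVlt => /orP[/eqP <-|kj]; first by rewrite mulr_natl subrr.
  by rewrite nth_default ?mul0rn ?mulr0 ?subrr // (leq_trans sp0).
have [->|q0] := eqVneq (p0^`() - p1) 0; first by rewrite size_poly0.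
by move: sX; rewrite size_mulX //; lia.
Qed.

Lemma dual_basis : exists z : 'I_n -> W, (forall j, span (z j)) /\
  forall i j, tr (z j * xbas i) = (i == j)%:R.
Proof.
have /choice[z Hz] j : exists z, span z /\ forall i, tr (z * xbas i) = (i == j)%:R.
  have [z zs zE] := ext_trace_dual xbas_indep xbas_span1 xbas_spanM char0_trace (delta_mx 0 j).
  by exists z; split=> // i; rewrite zE mxE eqxx.
by exists z; split=> [j|i j]; have [? ] := Hz j.
Qed.

Section DualBasis.
Variable z : 'I_n -> W.
Hypotheses (zs : forall j, span (z j)) (zE : forall i j, tr (z j * xbas i) = (i == j)%:R).

Lemma tr_z_lincomb j c : tr (z j * lincomb io xbas c) = c 0 j.
Proof.
rewrite tr_lincomb // (bigD1 j) //= zE eqxx mulr1 big1 ?addr0 // => i ij.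
by rewrite zE (negbTE ij) mulr0.
Qed.

Lemma z_neq0 j : z j != 0.
Proof.
apply/eqP => zj0; have := zE j j; rewrite zj0 mul0r tr0 // eqxx => /esym/eqP.
by rewrite oner_eq0.
Qed.

(** The form attached to [d f * z j] reads off the [j]-th coordinate, whose size is at most
    [m - g j]. *)
Lemma dual_set_z (j : 'I_n) : (2 <= g j)%N -> dual_set (d f * z j).
Proof.
move=> gj; split; first exact: spanM span_df (zs j).
move=> m w Dw fw; have [c wE /(_ j)[p sp pE]] := span_fil Dw fw.
exists p; first by rewrite (leq_trans sp) // leq_sub2l.
rewrite -pE; congr (io _); rewrite -(tr_z_lincomb j c) -wE /dual_form; congr tr.
by field; exact: df_neq0.
Qed.

Lemma dual_expansion y : span y ->
  y = \sum_j io (dual_form y (xbas j)) * (d f * z j).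
Proof.
move=> hy; apply/eqP; rewrite -subr_eq0; set s := \sum_j _.
suff: (y - s) / d f = 0.
  by move/eqP; rewrite mulf_eq0 invr_eq0 (negbTE df_neq0) orbF.
have sE : s / d f = \sum_j io (dual_form y (xbas j)) * z j.
  by rewrite mulr_suml; apply: eq_bigr => j _; field; exact: df_neq0.
have hydf : span (y / d f) by exact: spanM span_dfV.
have hs : span (s / d f) by rewrite sE; apply: in_span_sum => j _; exact: in_spanZ.
rewrite mulrBl; apply: (ext_trace_nondeg xbas_indep xbas_span1 xbas_spanM char0_trace).
  by apply: in_spanD => //; exact: in_spanN.
move=> i; have sb := in_span_basis io xbas i.
rewrite mulrBl trD; [|exact: spanM|apply: in_spanN; exact: spanM].
rewrite -[- (_ * _)]mulN1r -(rmorphN1 io) trZ //; last exact: spanM.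
rewrite mulN1r sE mulr_suml tr_sum //; last first.
  by move=> j; apply: spanM => //; exact: in_spanZ.
rewrite (bigD1 i) //= big1 ?addr0 => [|j ji].
  rewrite -[io _ * z i * _]mulrA trZ; last exact: spanM.
  by rewrite zE eqxx mulr1 /dual_form; apply/eqP; rewrite subr_eq0 mulrAC.
rewrite -[io _ * z j * _]mulrA trZ; last exact: spanM.
by rewrite zE eq_sym (negbTE ji) mulr0.
Qed.

(** The common denominators of all of [dual_set] form an ideal of [R], stable under [d] because
    [dual_set] is. By simplicity it contains 1, so [dual_set] lies in [R], where constants of [D]
    belong to [C]. *)
Lemma dual_set_const y : dual_set y -> is_const y.
Proof.
move=> Zy; apply: RC; last by apply: D_span; have [] := Zy.
pose J : set W := [set r | R r /\ forall y, dual_set y -> R (r * y)].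
suff : J 1 by move=> [_ /(_ y Zy)]; rewrite mul1r.
apply: (comp_ring_simple (bd_ab bd) (bd_derd bd) (bd_da bd) (bd_db bd) (bd_constK bd)).
- move=> u v [Ru Ju] [Rv Jv]; split=> [|y' Zy']; first exact: comp_ringD.
  by rewrite mulrDl; apply: comp_ringD; [exact: Ju | exact: Jv].
- move=> r u Rr [Ru Ju]; split=> [|y' Zy']; first exact: comp_ringM.
  by rewrite -mulrA; apply: comp_ringM => //; exact: Ju.
- by move=> u [].
- move=> u [Ru Ju]; split=> [|y' Zy']; first exact: (R_d bd).
  have -> : d u * y' = d (u * y') - u * d y' by rewrite (drvM (bd_derd bd)) addrK.
  by apply: comp_ringB; [exact/(R_d bd)/Ju | exact/Ju/dual_set_d].
have [r1 [Rr1 r10 r1z]] := comp_common_denominator (fun j => bd_frac bd (d f * z j)).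
have [u [v [Ru Rv v0 fE]]] := bd_frac bd f.
pose M := (\sum_(j < n) g j)%N.
(* A uniform denominator for [dual_expansion]: [r1] serves the dual basis, and [v ^+ M] the
   coefficients, polynomials in [f] of size at most [M]. *)
exists (v ^+ M * r1); last by rewrite mulf_neq0 // expf_neq0.
split=> [|y' [sy Zy']]; first by apply: comp_ringM => //; exact: comp_ringX.
rewrite (dual_expansion sy) mulr_sumr; apply: comp_ring_sum => j _.
have [Dj fj] := xg (ltn_ord j).
have [p sp pE] := Zy' _ _ Dj fj; rewrite pE.
have -> : v ^+ M * r1 * (evp p f * (d f * z j)) = (v ^+ M * evp p f) * (r1 * (d f * z j)) by ring.
apply: comp_ringM => //.
have gM : (g j <= M)%N by rewrite /M (bigD1 j) //= leq_addr.
rewrite /evp (horner_coef_wide _ (n := M)); last by rewrite size_map_poly (leq_trans sp) //; lia.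
rewrite mulr_sumr; apply: comp_ring_sum => l _; rewrite coef_map mulrCA.
apply: comp_ringM; first exact: R_cst.
have -> : v ^+ M * f ^+ l = v ^+ (M - l) * u ^+ l.
  rewrite -{1}(subnK (ltnW (ltn_ord l))) exprD fE expr_div_n.
  by field; rewrite expf_neq0.
by apply: comp_ringM; exact: comp_ringX.
Qed.

Lemma dual_basis_const (j : 'I_n) : (0 < j)%N -> exists2 c : C, c != 0 & z j = cst c / d f.
Proof.
move=> j0; have [c cE] := dual_set_const (dual_set_z (g2 (ltn_ord j) j0)).
have zc : z j = cst c / d f by rewrite -cE [d f * _]mulrC mulfK // df_neq0.
exists c => //; apply: contraNneq (z_neq0 j) => c0.
by rewrite zc c0 rmorph0 mul0r.
Qed.

(** All [z j] with [j > 0] are nonzero [C]-multiples of the inverse of [d f]; two of them would be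
    proportional, against duality. *)
Lemma dual_rank_le2 : (n <= 2)%N.
Proof.
rewrite leqNgt; apply/negP => n2.
pose j1 := Ordinal (ltnW n2); pose j2 := Ordinal n2.
have [c1 c10 z1] := @dual_basis_const j1 isT; have [c2 c20 z2] := @dual_basis_const j2 isT.
have := zE j1 j2; have [cc ccE] := io_evp (c2 / c1)%:P; rewrite evpC in ccE.
have -> : z j2 * xbas j1 = io cc * (z j1 * xbas j1).
  rewrite z1 z2 ccE rmorphM fmorphV /=; field.
  by rewrite df_neq0 fmorph_eq0 c10.
rewrite trZ //; last by apply: spanM => //; exact: in_span_basis.
rewrite zE eqxx mulr1 /= => cc0.
have : io cc == 0 by rewrite cc0 rmorph0.
by rewrite ccE fmorph_eq0 mulf_eq0 invr_eq0 (negbTE c10) (negbTE c20).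
Qed.

(** The inverse of [d f] is proportional to the dual element of [x 1], which is orthogonal to
    [x 0 = 1]. *)
Lemma trace_dfV : n = 2 -> tr (d f)^-1 = 0.
Proof.
move=> n2; have n1 : (1 < n)%N by rewrite n2.
pose j0 := Ordinal n0; pose j1 := Ordinal n1.
have [c c0 z1] := @dual_basis_const j1 isT.
have xb0 : xbas j0 = 1 by rewrite /xbas /= x0.
have [cc ccE] := io_evp c%:P; rewrite evpC in ccE.
have {}z1 : z j1 = io cc / d f by rewrite z1 ccE.
have := zE j0 j1; rewrite xb0 mulr1 z1 trZ; last exact: span_dfV.
move=> /eqP; rewrite mulf_eq0 => /orP[/eqP cc0|/eqP //].
have : io cc == 0 by rewrite cc0 rmorph0.
by rewrite ccE fmorph_eq0 (negbTE c0).
Qed.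
End DualBasis.

(** In rank 1, [d f] is itself a polynomial in [f] of degree at most 2. In rank 2, the inverse of
    [d f] has trace 0, so its square lies in [C(f)]; the pole order of [d f ^+ 2] then bounds the
    degree. *)
Lemma quartic_dual : exists2 P : {poly C}, (size P <= 5)%N & d f ^+ 2 = evp P f.
Proof.
have [z [zs zE]] := dual_basis.
have := dual_rank_le2 zs zE; rewrite leq_eqVlt => /orP[/eqP n2|n1]; last first.
  have n1' : n = 1%N by apply/eqP; rewrite eqn_leq n0 -ltnS n1.
  have [p sp dfE] := span_x Ddf fdf.
  exists (p 0%N ^+ 2).
    rewrite expr2 (leq_trans (size_polyMleq _ _)) //.
    by have := sp 0%N n0; rewrite g0; lia.
  have sE : \sum_(i < n) evp (p i) f * x i = evp (p 0%N) f.
    by rewrite n1' big_ord1 x0 mulr1.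
  by rewrite {1}dfE sE !expr2 evpM.
have trV := trace_dfV zs zE n2.
have sV := span_dfV.
have [kap kapE] : exists c, d f ^+ 2 = io c.
  pose chi := char_poly (mulmat io xbas (d f)^-1).
  have sz : size chi = 3 by rewrite size_char_poly; congr _.+1.
  have chi1 : chi`_1 = 0.
    have := char_poly_trace (mulmat io xbas (d f)^-1) n0.
    by rewrite -/(tr _) trV oppr0 -/chi; move: chi {sz} => chi'; rewrite n2.
  have chi2 : chi`_2 = 1.
    by have /monicP := char_poly_monic (mulmat io xbas (d f)^-1); rewrite lead_coefE -/chi sz.
  have : (map_poly io chi).[(d f)^-1] = 0.
    by apply/rootP; exact: (mulmat_eigen xbas_span1 xbas_spanM).
  rewrite horner_coef size_map_poly sz !big_ord_recl big_ord0 !coef_map /= chi1 chi2.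
  set c := _`_0 => rel; exists (- c^-1).
  have e : ((d f)^-1) ^+ 2 = - io c.
    apply/eqP; rewrite -addr_eq0 -[X in _ == X]rel; apply/eqP.
    by rewrite rmorph0 rmorph1 /bump /= expr0; ring.
  rewrite rmorphN fmorphV -[io c]opprK -e invrN opprK exprVn invrK.
  by [].
have Ddf2 : D (d f ^+ 2) = 0 by rewrite (drvX (bd_derD bd)) Ddf mulr0.
have fdf2 : fil 5 (d f ^+ 2) by rewrite expr2; exact: (filM fdf fdf).
have [c cE cp] := span_fil Ddf2 fdf2.
have [p sp pE] := cp (Ordinal n0).
exists p; first by rewrite (leq_trans sp) // leq_subr.
rewrite -pE kapE; congr (io _).
have e0 : xbas (Ordinal n0) = 1 by rewrite /xbas /= x0.
have : lincomb io xbas (kap *: delta_mx 0 (Ordinal n0) - c) = 0.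
  by rewrite lincombD lincombN lincombZ lincomb_delta e0 mulr1 -kapE -cE subrr.
move=> /xbas_indep/rowP/(_ (Ordinal n0)); rewrite !mxE !eqxx mulr1 => /eqP.
by rewrite subr_eq0 => /eqP.
Qed.
End Trace.

Lemma quartic_dual_ex : exists2 P : {poly C}, (size P <= 5)%N & d f ^+ 2 = evp P f.
Proof.
have [k [io ioP]] := subfield_type_sub (frac_image_subfield evf_inj).
exact: quartic_dual ioP.
Qed.
End Duality.

Section CoreTheorem.
Variables (C K E W : fieldType) (iK : {rmorphism C -> K}) (iE : {rmorphism C -> E}).
Variables (a : {rmorphism E -> W}) (b : {rmorphism K -> W}).
Variables (dK : K -> K) (dE : E -> E) (D d : W -> W).
Hypothesis bd : bidifferential iK iE a b dK dE D d.
Hypotheses (closedC : GRing.closed_field_axiom C) (char0 : [pchar C] =i pred0).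
Variables (t : K) (n : nat) (bas : 'I_n -> K).
Hypothesis fr : finite_over_rational iK t bas.
Hypothesis transT : forall p : {poly E}, (map_poly a p).[b t] = 0 -> p = 0.

Theorem quartic_from_constant : (exists c, D c = 0 /\ ~ is_const iE a c) ->
  quartic_solution iE a D d.
Proof.
move=> newc.
have [[w [Rw Dw wC]]|RC'] := pselect (exists w, [/\ comp_ring a b w, D w = 0 & ~ is_const iE a w]).
  exact: (quartic_from_ring bd closedC Rw Dw wC).
have RC w : comp_ring a b w -> D w = 0 -> is_const iE a w.
  by move=> Rw Dw; apply: contrapT => wC; case: RC'; exists w.
have [k [io ioP]] := subfield_type_sub (frac_image_subfield (evT_inj transT)).
have comax := denominator_comaximal bd closedC char0 fr transT ioP.
have cofin := denominator_cofinite bd char0 fr transT ioP.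
have [f [Df fC fmin]] := minimal_pole_function cofin newc.
have [i0 [i1 [den0 den1 i01]]] := comax f.
have simple := simple_pole_space bd closedC comax cofin RC Df fC fmin den0 den1 i01.
have [N depN] := cofin f.
have [m [x [g [m0 [x0 g0] g2 [xg lead] span_x]]]] :=
  adapted_basis bd RC Df fC den0 den1 i01 depN simple.
have free := lead_indep_free xg lead.
have [P sP dfP] := quartic_dual_ex bd closedC char0 RC Df fC den0 den1 i01 m0 x0 g0 g2 xg free span_x.
by exists f, P.
Qed.
End CoreTheorem.

(** * Specialization of the coefficients *)

Lemma pseudo_division (A : comNzRingType) (p q : {poly A}) : q != 0 ->
  exists k s r, lead_coef q ^+ k *: p = s * q + r /\ (size (r : {poly A}) < size q)%N.
Proof.
move=> q0; have := Pdiv.ComRing.redivpP p q.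
by case=> k s r e /(_ q0) sr; exists k, s, r.
Qed.

Section PolyEval.
Variables (A B : comNzRingType) (f : {rmorphism A -> B}) (x : B).
Definition poly_eval : {poly A} -> B := horner_eval x \o map_poly f.
HB.instance Definition _ := GRing.RMorphism.copy poly_eval (horner_eval x \o map_poly f).
Lemma poly_evalE p : poly_eval p = (map_poly f p).[x]. Proof. by []. Qed.
Lemma poly_evalC c : poly_eval c%:P = f c.
Proof. by rewrite poly_evalE map_polyC hornerC. Qed.
Lemma poly_evalX : poly_eval 'X = x.
Proof. by rewrite poly_evalE map_polyX hornerX. Qed.
Lemma poly_evalZ c p : poly_eval (c *: p) = f c * poly_eval p.
Proof. by rewrite -mul_polyC rmorphM /= poly_evalC. Qed.
End PolyEval.
Arguments poly_eval : simpl never.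

(** Top coefficients in the kernel of [f] are discarded, so that degrees before and after [f]
    agree. *)
Lemma poly_trim (A B : comNzRingType) (f : {rmorphism A -> B}) (p : {poly A}) :
  exists2 p' : {poly A}, map_poly f p' = map_poly f p & size p' = size (map_poly f p).
Proof.
pose p' := \poly_(i < size (map_poly f p)) p`_i.
have e : map_poly f p' = map_poly f p.
  apply/polyP => i; rewrite coef_map coef_poly; case: ltnP => [_|si]; first by rewrite coef_map.
  by rewrite raddf0 nth_default.
exists p' => //; apply/eqP; rewrite eqn_leq size_poly -{1}e.
by rewrite map_polyE (leq_trans (size_Poly _)) // size_map.
Qed.

Section Specialization.
Variables (C E : fieldType) (iE : {rmorphism C -> E}).
Hypotheses (closedC : GRing.closed_field_axiom C) (char0 : [pchar C] =i pred0).

(** A form of the Nullstellensatz for the image of [ev]: a [C]-valued point at which [q] does not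
    vanish. The last clause makes [h] fix [C] and, for [c = 0], factor through [ev]. *)
Definition specializable (A : comNzRingType) (ev : {rmorphism A -> E}) : Prop :=
  forall q, ev q != 0 -> exists h : {rmorphism A -> C}, h q != 0 /\
    forall p c, ev p = iE c -> h p = c.

(** Extends points along the adjunction of one element [x]. If [x] is transcendental, almost every
    value is admissible; if it is algebraic, [x] is sent to a root of the specialized minimal
    polynomial, once its leading coefficient and an eliminant of [q] are kept nonzero. *)
Lemma specializable_poly (A : comNzRingType) (ev : {rmorphism A -> E}) x :
  (forall c, exists p, ev p = iE c) -> specializable ev -> specializable (poly_eval ev x).
Proof.
move=> evC spA q qx.
have liftC (h : {rmorphism {poly A} -> C}) : (forall c p, ev p = iE c -> h p%:P = c) ->
    (forall p, poly_eval ev x p = 0 -> h p = 0) -> forall p c, poly_eval ev x p = iE c -> h p = c.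
  move=> hC h0 p c pc; have [p' p'E] := evC c.
  apply/eqP; rewrite -subr_eq0 -{1}(hC c p' p'E) -rmorphB; apply/eqP/h0.
  by rewrite rmorphB /= pc poly_evalC p'E subrr.
have [trans | ] := pselect (forall p, poly_eval ev x p = 0 -> map_poly ev p = 0).
  have : map_poly ev q != 0 by apply: contraNneq qx => e; rewrite /= poly_evalE e horner0.
  rewrite -lead_coef_eq0 lead_coefE coef_map => /spA[h [hq hC]].
  have hq0 : map_poly h q != 0.
    by apply: contraNneq hq => /polyP/(_ (size (map_poly ev q)).-1); rewrite coef_map coef0 => /eqP.
  have [c qc] : exists c, ~~ root (map_poly h q) c.
    pose s := [seq (i%:R : C) | i <- iota 0 (size (map_poly h q))].
    have us : uniq s.
      rewrite map_inj_uniq ?iota_uniq // => i j; wlog ij : i j / (i <= j)%N => [H e|].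
        by have [ij|/ltnW ji] := leqP i j; [exact: H | apply/esym/H].
      move=> /eqP; rewrite eq_sym -subr_eq0 -natrB // ((pcharf0P C).1 char0) subn_eq0 => ji.
      by apply/eqP; rewrite eqn_leq ij.
    have [sr|] := boolP (all (root (map_poly h q)) s).
      by have := max_poly_roots hq0 sr us; rewrite size_map size_iota ltnn.
    by move=> /allPn[c _ ?]; exists c.
  exists (poly_eval h c); split=> //; apply: liftC.
    by move=> d p pd; rewrite /= poly_evalC; exact: hC.
  move=> p /trans p0; rewrite /= poly_evalE; apply/eqP; suff -> : map_poly h p = 0 by rewrite horner0.
  apply/polyP => i; rewrite coef_map coef0; apply: hC.
  by move/polyP: p0 => /(_ i); rewrite coef_map coef0 rmorph0.
move=> /existsNP[P0 /not_implyP[P00 /eqP P01]].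
have exn : exists n, `[< exists P, [/\ poly_eval ev x P = 0, map_poly ev P != 0 & size P = n] >].
  by exists (size P0); apply/asboolP; exists P0.
have [n /asboolP[P [Px Pn0 sP]] nmin] := ex_minnP exn.
have small p : poly_eval ev x p = 0 -> (size p < n)%N -> map_poly ev p = 0.
  move=> px sp; apply/eqP; apply: contraLR sp => p0; rewrite -leqNgt nmin //.
  by apply/asboolP; exists p.
have lead_ev p : (p : {poly A}) != 0 -> size p = size (map_poly ev p) -> ev (lead_coef p) != 0.
  move=> p0 sp; rewrite lead_coefE {1}sp -coef_map -lead_coefE lead_coef_eq0.
  by rewrite -size_poly_eq0 -sp size_poly_eq0.
have map_le (p : {poly A}) : (size (map_poly ev p) <= size p)%N.
  by rewrite map_polyE (leq_trans (size_Poly _)) // size_map.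
have P0' : P != 0 by apply: contraNneq Pn0 => ->; rewrite rmorph0.
have sPE : size P = size (map_poly ev P).
  have [P' eP' sP'] := poly_trim ev P.
  apply/eqP; rewrite eqn_leq map_le andbT -sP' sP; apply: nmin.
  by apply/asboolP; exists P'; split=> //; rewrite ?poly_evalE eP'.
have lP : ev (lead_coef P) != 0 by exact: lead_ev.
have pv p q' : map_poly ev p = map_poly ev q' -> poly_eval ev x p = poly_eval ev x q'.
  by rewrite !poly_evalE => ->.
(* Since [q] is invertible modulo the minimal polynomial, some multiple of it has a nonzero value
   without [x]; it is a representative [w] of least degree among the multiples of [q]. *)
have [g [r [r0 gq]]] : exists g r, ev r != 0 /\ poly_eval ev x (g * q) = ev r.
  have exm : exists m, `[< exists w, [/\ poly_eval ev x w != 0,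
      exists g, poly_eval ev x (g * q) = poly_eval ev x w & size w = m] >].
    by exists (size q); apply/asboolP; exists q; split=> //; exists 1; rewrite mul1r.
  have [m /asboolP[w [wx [g gw] sw]] mmin] := ex_minnP exm.
  have smallw w' g' : poly_eval ev x (g' * q) = poly_eval ev x w' -> (size w' < m)%N -> poly_eval ev x w' = 0.
    move=> gw' sw'; apply/eqP; apply: contraLR sw' => w'0; rewrite -leqNgt mmin //.
    by apply/asboolP; exists w'; split=> //; exists g'.
  have [/size1_polyC wC|w1] := leqP (size w) 1.
    by exists g, w`_0; rewrite gw {2}wC poly_evalC; split=> //; rewrite -(poly_evalC ev x) -wC.
  exfalso.
  have w0 : w != 0 by apply: contraNneq wx => ->; rewrite /= poly_evalE rmorph0 horner0.
  have swE : size w = size (map_poly ev w).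
    have [w' ew' sw'] := poly_trim ev w.
    apply/eqP; rewrite eqn_leq map_le andbT -sw' sw; apply: mmin.
    by apply/asboolP; exists w'; rewrite (pv _ _ ew'); split=> //; exists g.
  have swP : (size w < size P)%N.
    have [k [s [r [e sr]]]] := pseudo_division w P0'.
    rewrite (leq_ltn_trans _ sr) // leqNgt sw; apply/negP => rm.
    have rx : poly_eval ev x r = ev (lead_coef P) ^+ k * poly_eval ev x w.
      by rewrite -rmorphXn -poly_evalZ e rmorphD rmorphM /= Px mulr0 add0r.
    have := smallw r ((lead_coef P ^+ k)%:P * g).
    rewrite -mulrA rmorphM /= poly_evalC gw rx rmorphXn => /(_ erefl rm) /eqP.
    by rewrite mulf_eq0 expf_eq0 (negbTE lP) andbF (negbTE wx).
  have [k [s [r [e sr]]]] := pseudo_division P w0.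
  have rx : poly_eval ev x r = - (poly_eval ev x s * poly_eval ev x w).
    apply/eqP; rewrite -addr_eq0 addrC -rmorphM -rmorphD /= -e poly_evalZ Px mulr0 //.
  have r0 : poly_eval ev x r = 0.
    by apply: (smallw _ (- s * g)); [rewrite -mulrA rmorphM /= gw rx rmorphN mulNr | rewrite -sw].
  have s0 : poly_eval ev x s = 0.
    by apply/eqP; move/eqP: r0; rewrite rx oppr_eq0 mulf_eq0 (negbTE wx) orbF.
  have lw : ev (lead_coef w) != 0 by exact: lead_ev.
  (* If [w] had positive degree, the cofactor [s] would vanish at [x] with a degree below that of
     [P]. *)
  have eE : map_poly ev s * map_poly ev w = ev (lead_coef w) ^+ k *: map_poly ev P - map_poly ev r.
    by rewrite -rmorphXn -map_polyZ e rmorphD rmorphM addrK.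
  have rP : (size (map_poly ev r) < size (map_poly ev P))%N.
    by rewrite (leq_ltn_trans (map_le r)) // -sPE (ltn_trans sr).
  have szE : size (map_poly ev s * map_poly ev w)%R = size P.
    by rewrite eE size_polyDl size_scale ?expf_neq0 // size_polyN.
  have es0 : map_poly ev s != 0.
    by apply: contraTneq P0' => e0; rewrite -size_poly_eq0 -szE e0 mul0r size_poly0.
  have ew0 : map_poly ev w != 0 by rewrite -size_poly_eq0 -swE size_poly_eq0.
  have [s' es' ss'] := poly_trim ev s.
  have : map_poly ev s' = 0.
    apply: small; first by rewrite (pv _ _ es').
    by rewrite ss' -sP -szE size_mul // -swE; move: w1; case: (size w) => [|[|v]] //= _; rewrite addnS /= addnS ltnS leq_addr.
  by move=> e0; move: es0; rewrite -es' e0 eqxx.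
(* The leading coefficient must survive so that pseudo-division by [P] can be undone after
   specialization; [r] must survive so that [q] does. *)
have [h [hlr hC]] : exists h : {rmorphism A -> C}, h (lead_coef P * r) != 0 /\ 
    forall p c, ev p = iE c -> h p = c.
  by apply: spA; rewrite rmorphM mulf_neq0.
move: hlr; rewrite rmorphM mulf_eq0 negb_or => /andP[hl hr].
have h0 p : ev p = 0 -> h p = 0 by move=> p0; apply: hC; rewrite rmorph0.
have hP : (1 < size (map_poly h P))%N.
  rewrite size_map_poly_id0 // ltnNge; apply/negP => /size1_polyC PC.
  have e : ev P`_0 = 0 by move: Px; rewrite PC poly_evalC -PC.
  by move: Pn0; rewrite PC map_polyC /= e polyC0 eqxx.
have [c Pc] := closed_root closedC hP.
have hker p : poly_eval ev x p = 0 -> poly_eval h c p = 0.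
  move=> px; have [k [s [u [e su]]]] := pseudo_division p P0'.
  have : map_poly ev u = 0.
    apply: small; last by rewrite -sP.
    have -> : u = lead_coef P ^+ k *: p - s * P by rewrite e addrC addKr.
    by rewrite rmorphB rmorphM /= poly_evalZ px Px !mulr0 subrr.
  move=> u0; have : poly_eval h c u = 0.
    rewrite poly_evalE; suff -> : map_poly h u = 0 by rewrite horner0.
    apply/polyP => i; rewrite coef_map coef0; apply: h0.
    by move/polyP: u0 => /(_ i); rewrite coef_map coef0.
  move=> uc; have : poly_eval h c (lead_coef P ^+ k *: p) = 0.
    by rewrite e rmorphD rmorphM /= uc [poly_eval h c P]poly_evalE (rootP Pc) mulr0 addr0.
  by move=> /eqP; rewrite poly_evalZ mulf_eq0 rmorphXn expf_eq0 (negbTE hl) andbF => /eqP.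
exists (poly_eval h c); split.
  have : poly_eval h c (g * q - r%:P) = 0.
    by apply: hker; rewrite rmorphB /= gq poly_evalC subrr.
  rewrite rmorphB rmorphM /= poly_evalC => /eqP; rewrite subr_eq0 => /eqP gqr.
  by apply: contraNneq hr => qc; rewrite -gqr qc mulr0.
apply: liftC; last exact: hker.
by move=> d p pd; rewrite /= poly_evalC; exact: hC.
Qed.
Lemma specializable_seq (s : seq E) : exists (A : comNzRingType) (ev : {rmorphism A -> E}),
  [/\ specializable ev, forall c, exists p, ev p = iE c & forall e, e \in s -> exists p, ev p = e].
Proof.
elim: s => [|x s [A [ev [spA evC evs]]]].
  exists C, iE; split=> // [q q0|c]; last by exists c.
  exists (idfun : {rmorphism C -> C}); split=> [|p c /fmorph_inj] //.
  by apply: contraNneq q0 => /= ->; rewrite rmorph0.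
exists ({poly A} : comNzRingType), (poly_eval ev x); split.
- exact: specializable_poly.
- by move=> c; have [p pc] := evC c; exists p%:P; rewrite /= poly_evalC.
- move=> e; rewrite inE => /orP[/eqP ->|/evs[p pe]]; first by exists 'X; exact: poly_evalX.
  by exists p%:P; rewrite /= poly_evalC.
Qed.
End Specialization.

Lemma const_free_span (C K : fieldType) (iK : {rmorphism C -> K}) n (x : 'I_n -> K) :
  exists m (y : 'I_m -> K) (T : 'I_n -> 'I_m -> C),
    (forall i, x i = \sum_j iK (T i j) * y j) /\
    forall c : 'I_m -> C, \sum_j iK (c j) * y j = 0 -> forall j, c j = 0.
Proof.
elim: n x => [|n IH] x; first by exists 0%N, x, (fun _ _ => 0); split=> [[]//|c _ []].
have [free|] := pselect (forall c : 'I_n.+1 -> C, \sum_j iK (c j) * x j = 0 -> forall j, c j = 0).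
  exists n.+1, x, (fun i j => (i == j)%:R); split=> // i.
  rewrite (bigD1 i) //= eqxx rmorph1 mul1r big1 ?addr0 // => j ji.
  by rewrite eq_sym (negbTE ji) rmorph0 mul0r.
move=> /existsNP[c /not_implyP[crel /existsNP[j0 /eqP cj0]]].
have [m [y [T [xE free]]]] := IH (fun i => x (lift j0 i)).
pose u j := \sum_i - (c (lift j0 i) / c j0) * T i j.
exists m, y, (fun i j => if unlift j0 i is Some i' then T i' j else u j); split=> // i.
case: unliftP => [i' ->|->]; first exact: xE.
have -> : x j0 = \sum_i iK (- (c (lift j0 i) / c j0)) * x (lift j0 i).
  apply: (mulfI (x := iK (c j0))); first by rewrite fmorph_eq0.
  move/eqP: crel; rewrite (bigD1_ord j0) //= addr_eq0 => /eqP ->.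
  rewrite mulr_sumr -sumrN; apply: eq_bigr => i' _.
  by rewrite mulrA -rmorphM mulrN [c j0 * _]mulrC divfK // rmorphN mulNr.
under eq_bigr => i' _ do rewrite xE mulr_sumr.
rewrite exchange_big; apply: eq_bigr => j _.
by rewrite rmorph_sum mulr_suml; apply: eq_bigr => i' _; rewrite mulrA -rmorphM.
Qed.

Section SpecializeConstant.
Variables (C K E W : fieldType) (iK : {rmorphism C -> K}) (iE : {rmorphism C -> E}).
Variables (a : {rmorphism E -> W}) (b : {rmorphism K -> W}).
Variables (dK : K -> K) (dE : E -> E) (D d : W -> W).
Hypothesis bd : bidifferential iK iE a b dK dE D d.
Hypotheses (closedC : GRing.closed_field_axiom C) (char0 : [pchar C] =i pred0).

Lemma dK_der : derivation dK.
Proof.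
split=> x y; apply: (fmorph_inj b); rewrite -(bd_db bd).
  by rewrite !rmorphD /= (drvD (bd_derd bd)) !(bd_db bd).
by rewrite rmorphD !rmorphM /= (drvM (bd_derd bd)) !(bd_db bd).
Qed.

Section Specialize.
Variables (A : comNzRingType) (ev : {rmorphism A -> E}) (h : {rmorphism A -> C}).
Hypothesis evC : forall c, exists p, ev p = iE c.
Hypothesis hC : forall p c, ev p = iE c -> h p = c.

(** Application of [h] to the [E]-coefficients, as a relation on expressions; that it does not
    depend on the expression is [spec_fun], a consequence of linear disjointness. *)
Definition spec (w : W) (k : K) : Prop := exists s : seq (A * K),
  w = \sum_(p <- s) a (ev p.1) * b p.2 /\ k = \sum_(p <- s) iK (h p.1) * p.2.

Lemma spec_fun w k k' : spec w k -> spec w k' -> k = k'.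
Proof.
move=> [s [-> ->]] [s' [e ->]].
pose t := s ++ [seq (- p.1, p.2) | p <- s'].
have sumt (V : nzRingType) (F : A -> V) (G : K -> V) : {morph F : x / - x} ->
    \sum_(p <- t) F p.1 * G p.2 = \sum_(p <- s) F p.1 * G p.2 - \sum_(p <- s') F p.1 * G p.2.
  move=> FN; rewrite big_cat big_map -sumrN; congr (_ + _).
  by apply: eq_bigr => p _; rewrite FN mulNr.
apply/eqP; rewrite -subr_eq0 -(sumt K (fun p => iK (h p)) id) => [|p]; last by rewrite !rmorphN.
have := sumt W (fun p => a (ev p)) b; rewrite e subrr => rel.
have {}rel := rel (fun p => _); have {}rel : \sum_(p <- t) a (ev p.1) * b p.2 = 0.
  by apply: rel => p; rewrite !rmorphN.
rewrite (big_nth (0, 0)) big_mkord; apply/eqP.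
apply: (comp_functional (bd_ab bd) (bd_derd bd) (bd_da bd) (bd_db bd) (bd_constK bd)
  (e := fun i => ev (nth (0, 0) t i).1) (y := fun i => iK (h (nth (0, 0) t i).1))).
  move=> c crel.
  have /choice[q qE] i : exists q, ev q = iE (c i) by exact: evC.
  transitivity (iK (h (\sum_(i < size t) (nth (0, 0) t i).1 * q i))).
    rewrite !rmorph_sum; apply: eq_bigr => i _.
    by rewrite !rmorphM /= (hC (qE i)).
  rewrite (@hC _ 0) ?rmorph0 // rmorph_sum -[RHS]crel; apply: eq_bigr => i _.
  by rewrite rmorphM /= qE.
by rewrite -[RHS]rel (big_nth (0, 0)) big_mkord.
Qed.

Lemma specD u x v y : spec u x -> spec v y -> spec (u + v) (x + y).
Proof. by move=> [s [-> ->]] [t [-> ->]]; exists (s ++ t); rewrite !big_cat. Qed.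
Lemma spec_tensor p x : spec (a (ev p) * b x) (iK (h p) * x).
Proof. by exists [:: (p, x)]; rewrite !big_seq1. Qed.
Lemma spec0 : spec 0 0. Proof. by exists [::]; rewrite !big_nil. Qed.
Lemma spec_sum I (r : seq I) (F : I -> W) (G : I -> K) :
  (forall i, spec (F i) (G i)) -> spec (\sum_(i <- r) F i) (\sum_(i <- r) G i).
Proof. by move=> H; elim/big_ind2: _ => //; [exact: spec0 | move=> *; exact: specD]. Qed.
Lemma specM u x v y : spec u x -> spec v y -> spec (u * v) (x * y).
Proof.
move=> [s [-> ->]] [t [-> ->]]; rewrite !mulr_suml; apply: spec_sum => p.
rewrite !mulr_sumr; apply: spec_sum => q.
have := spec_tensor (p.1 * q.1) (p.2 * q.2); rewrite !rmorphM /=.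
have -> : a (ev p.1) * a (ev q.1) * (b p.2 * b q.2) = a (ev p.1) * b p.2 * (a (ev q.1) * b q.2) by ring.
by have -> : iK (h p.1) * iK (h q.1) * (p.2 * q.2) = iK (h p.1) * p.2 * (iK (h q.1) * q.2) by ring.
Qed.
Lemma spec_const c : spec (cst iE a c) (iK c).
Proof.
have [p pc] := evC c; have := spec_tensor p 1.
by rewrite pc (hC pc) rmorph1 !mulr1.
Qed.
Lemma spec1 : spec 1 1.
Proof. by have := spec_const 1; rewrite !rmorph1. Qed.
Lemma specN u x : spec u x -> spec (- u) (- x).
Proof.
move=> h1; have := specM (spec_const (-1)) h1.
by rewrite !rmorphN1 !mulN1r.
Qed.
Lemma specX u x n : spec u x -> spec (u ^+ n) (x ^+ n).
Proof. by move=> ux; elim: n => [|n IH]; rewrite ?expr0 ?exprS; [exact: spec1|exact: specM]. Qed.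
Lemma spec_d u x : spec u x -> spec (d u) (dK x).
Proof.
move=> [s [-> ->]]; exists [seq (p.1, dK p.2) | p <- s]; rewrite !big_map; split.
  rewrite (drv_sum (bd_derd bd)); apply: eq_bigr => p _.
  by rewrite (drvM (bd_derd bd)) (bd_da bd) mul0r add0r (bd_db bd).
rewrite (drv_sum dK_der); apply: eq_bigr => p _; rewrite (drvM dK_der).
have -> : dK (iK (h p.1)) = 0.
  by apply: (fmorph_inj b); rewrite -(bd_db bd) -(bd_ab bd) (bd_da bd) rmorph0.
by rewrite mul0r add0r.
Qed.
End Specialize.

(** Write [f = u / v] in coordinates along [C]-independent elements [y] of [K]. Nonconstancy of [f]
    gives a nonzero 2 by 2 minor of the coordinates; a point that keeps it nonzero keeps the
    quotient outside [C]. *)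
Theorem quartic_specialization : quartic_solution iE a D d -> exists (t : K) (P : {poly C}),
  [/\ ~ (exists c, t = iK c), (size P <= 5)%N & dK t ^+ 2 = (map_poly iK P).[t]].
Proof.
move=> [f [P [Df fC sP dfE]]].
have [u [v [[su uE] [sv vE] v0 fE]]] := bd_frac bd f.
pose s := su ++ sv.
have [m [y [T [xE free]]]] := const_free_span iK (fun i : 'I_(size s) => (nth (0, 0) s i).2).
have coords p : p \in s -> exists r : 'I_m -> C, p.2 = \sum_j iK (r j) * y j.
  move=> /(nthP (0, 0))[i si <-]; exists (T (Ordinal si)); exact: (xE (Ordinal si)).
have [|U UE] := @comp_sum_coords _ _ _ _ iK iE a b (bd_ab bd) m y su.
  by move=> p ps; apply: coords; rewrite mem_cat ps.
have [|V VE] := @comp_sum_coords _ _ _ _ iK iE a b (bd_ab bd) m y sv.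
  by move=> p ps; apply: coords; rewrite mem_cat ps orbT.
(* If all minors vanished, [f] would lie in [a E]; being a constant of [D] it would lie in [C]. *)
have [i [j minor]] : exists i j, U i * V j - U j * V i != 0.
  apply: contrapT => nominor.
  have [j Vj] : exists j, V j != 0.
    apply: contrapT => V0; move/eqP: v0; apply; rewrite vE VE big1 // => j _.
    have -> : V j = 0 by apply/eqP; apply: contraT => Vj; case: V0; exists j.
    by rewrite rmorph0 mul0r.
  have fa : f = a (U j / V j).
    rewrite fE; apply: (canLR (mulfK v0)); rewrite uE vE UE VE mulr_sumr.
    apply: eq_bigr => i _; rewrite mulrA -rmorphM; congr (a _ * _).
    have : U i * V j - U j * V i = 0 by apply/eqP; apply: contraT => h; case: nominor; exists i, j.
    by move=> /eqP; rewrite subr_eq0 => /eqP e; rewrite mulrAC -e mulfK.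
  have [c cE] : exists c, U j / V j = iE c.
    by apply: (bd_constE bd); apply: (fmorph_inj a); rewrite rmorph0 -(bd_Da bd) -fa.
  by apply: fC; exists c; rewrite fa cE.
have [A [ev [spA evC evUV]]] := specializable_seq iE closedC char0 (codom U ++ codom V).
have /choice[pU pUE] l : exists p, ev p = U l by apply: evUV; rewrite mem_cat codom_f.
have /choice[pV pVE] l : exists p, ev p = V l by apply: evUV; rewrite mem_cat codom_f orbT.
have [|h [hminor hC]] := spA (pU i * pV j - pU j * pV i).
  by rewrite rmorphB !rmorphM /= !pUE !pVE.
pose u' := \sum_l iK (h (pU l)) * y l; pose v' := \sum_l iK (h (pV l)) * y l.
have su' : spec ev h u u'.
  by rewrite uE UE; apply: spec_sum => l; rewrite -pUE; exact: spec_tensor.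
have sv' : spec ev h v v'.
  by rewrite vE VE; apply: spec_sum => l; rewrite -pVE; exact: spec_tensor.
have minor0 c1 c2 : iK c1 * u' + iK c2 * v' = 0 -> c1 = 0 /\ c2 = 0.
  move=> rel; have {}rel l : c1 * h (pU l) + c2 * h (pV l) = 0.
    apply: (free (fun l => c1 * h (pU l) + c2 * h (pV l))); rewrite -[RHS]rel /u' /v' !mulr_sumr -big_split.
    by apply: eq_bigr => l' _; rewrite /= rmorphD !rmorphM /=; ring.
  have e1 : c1 * h (pU i * pV j - pU j * pV i) = 0.
    rewrite rmorphB !rmorphM /=.
    have -> : c1 * (h (pU i) * h (pV j) - h (pU j) * h (pV i)) =
      (c1 * h (pU i) + c2 * h (pV i)) * h (pV j) - (c1 * h (pU j) + c2 * h (pV j)) * h (pV i) by ring.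
    by rewrite !rel !mul0r subrr.
  have e2 : c2 * h (pU i * pV j - pU j * pV i) = 0.
    rewrite rmorphB !rmorphM /=.
    have -> : c2 * (h (pU i) * h (pV j) - h (pU j) * h (pV i)) =
      (c1 * h (pU j) + c2 * h (pV j)) * h (pU i) - (c1 * h (pU i) + c2 * h (pV i)) * h (pU j) by ring.
    by rewrite !rel !mul0r subrr.
  by split; apply/eqP; [move/eqP: e1|move/eqP: e2]; rewrite mulf_eq0 (negbTE hminor) orbF.
have v'0 : v' != 0.
  apply/eqP => v'0; have [] := minor0 0 1; first by rewrite v'0 mulr0 rmorph0 mul0r addr0.
  by move=> _ /eqP; rewrite oner_eq0.
exists (u' / v'), P; split=> //.
  move=> [c uc]; have [] := minor0 1 (- c).
    rewrite -[u'](divfK v'0) uc rmorph1 rmorphN; ring.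
  by move=> /eqP; rewrite oner_eq0.
(* Degree at most 4 is exactly what lets multiplication by [v ^+ 4] clear all denominators, which
   turns the equation into one inside the ring, where [spec] applies. *)
have eW : (d u * v - u * d v) ^+ 2 = \sum_(k < 5) cst iE a P`_k * u ^+ k * v ^+ (4 - k).
  have -> : (d u * v - u * d v) ^+ 2 = d f ^+ 2 * v ^+ 4.
    by rewrite fE (drv_div (bd_derd bd)) //; field.
  rewrite dfE /evp (horner_coef_wide _ (n := 5)) ?size_map_poly // mulr_suml.
  apply: eq_bigr => k _; rewrite coef_map fE expr_div_n.
  have -> : v ^+ 4 = v ^+ k * v ^+ (4 - k) by rewrite -exprD subnKC // leq_ord.
  by rewrite /=; field; exact: expf_neq0.
have eK : (dK u' * v' - u' * dK v') ^+ 2 = \sum_(k < 5) iK P`_k * u' ^+ k * v' ^+ (4 - k).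
  apply: (spec_fun evC hC (w := (d u * v - u * d v) ^+ 2)).
    apply: specX => //; apply: specD; first exact/specM/sv'/spec_d.
    exact/specN/specM/spec_d.
  rewrite eW; apply: spec_sum => k; apply: specM; last exact: specX.
  by apply: specM; [exact: spec_const | exact: specX].
rewrite (drv_div dK_der) // (horner_coef_wide _ (n := 5)) ?size_map_poly // expr_div_n eK mulr_suml.
apply: eq_bigr => k _; rewrite coef_map expr_div_n.
have -> : (v' ^+ 2) ^+ 2 = v' ^+ k * v' ^+ (4 - k) by rewrite -exprM -exprD subnKC // leq_ord.
by rewrite /=; field; rewrite !expf_neq0.
Qed.
End SpecializeConstant.

(** * Autonomous equations of degree at most four *)

Section AutonomousEquation.
Variables (C K : fieldType) (iK : {rmorphism C -> K}) (dK : K -> K).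
Hypotheses (closedC : GRing.closed_field_axiom C) (char0 : [pchar C] =i pred0).
Hypotheses (dD : derivation dK) (dC : forall c, dK (iK c) = 0).

Definition weierstrass (t : K) : Prop := exists g2 g3 alpha : C,
  27%:R * g3 ^+ 2 - g2 ^+ 3 != 0 /\
  dK t ^+ 2 = iK alpha ^+ 2 * (4%:R * t ^+ 3 - iK g2 * t - iK g3).

Definition elementary_solution : Prop := exists t : K,
  ~ (exists c, t = iK c) /\
  [\/ dK t = 1, exists2 c, c != 0 & dK t = iK c * t | weierstrass t].

Lemma natC_neq0 n : (n.+1%:R : C) != 0.
Proof. by rewrite ((pcharf0P C).1 char0). Qed.
Lemma natK_neq0 n : (n.+1%:R : K) != 0.
Proof. by rewrite -(rmorph_nat iK) fmorph_eq0 natC_neq0. Qed.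

Lemma closed_sqrt (c : C) : exists m, m ^+ 2 = c.
Proof.
have [|m] := closed_root closedC (p := 'X^2 - c%:P); first by rewrite size_XnsubC.
by rewrite rootE !hornerE subr_eq0 => /eqP; exists m.
Qed.

Lemma nonconst_drv t x : dK t = x -> x != 0 -> ~ (exists c, t = iK c).
Proof. by move=> tx x0 [c tc]; move/eqP: x0; apply; rewrite -tx tc dC. Qed.

Lemma solution_drv1 t : dK t = 1 -> elementary_solution.
Proof.
move=> t1; exists t; split; last by constructor 1.
by apply: nonconst_drv t1 _; exact: oner_neq0.
Qed.
Lemma solution_exp t c : t != 0 -> c != 0 -> dK t = iK c * t -> elementary_solution.
Proof.
move=> t0 c0 tc; exists t; split; last by constructor 2; exists c.
by apply: nonconst_drv tc _; rewrite mulf_neq0 // fmorph_eq0.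
Qed.

Section NoNewConstants.
Hypothesis constK : forall x, dK x = 0 -> exists c, x = iK c.

Lemma drv_neq0 t : ~ (exists c, t = iK c) -> dK t != 0.
Proof. by move=> tC; apply/eqP => /constK. Qed.

Lemma drv_eq_double t x y : dK t != 0 -> dK t ^+ 2 = x -> dK x = 2%:R * y * dK t -> dK (dK t) = y.
Proof.
move=> t0 tx xy; have := drvX dD (dK t) 2; rewrite tx xy /= expr1 => e.
apply: (mulfI (mulf_neq0 (natK_neq0 1) t0)).
by rewrite -e; ring.
Qed.

(* [w = s' / (s - a)] satisfies the Riccati equation [w' = (w^2 - m^2) / 2] with
   [m^2 = k (a - b)]. *)
Lemma solution_double_root s a b k : ~ (exists c, s = iK c) -> k != 0 ->
  dK s ^+ 2 = iK k * (s - iK a) ^+ 2 * (s - iK b) -> elementary_solution.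
Proof.
move=> sC k0 sE; have ds := drv_neq0 sC.
have sa : s - iK a != 0.
  apply: contraNneq ds => sa; have : dK s ^+ 2 == 0 by rewrite sE sa expr0n mulr0 mul0r.
  by rewrite expf_eq0.
pose w := dK s / (s - iK a).
have k0' : iK k != 0 by rewrite fmorph_eq0.
have wE : w ^+ 2 = iK k * (s - iK b) by rewrite /w expr_div_n sE; field.
have w0 : w != 0 by rewrite mulf_neq0 ?invr_eq0.
have dsE : dK s = w * (s - iK a) by rewrite /w divfK.
move: w wE w0 dsE => w wE w0 dsE.
have [m mE] := closed_sqrt (k * (a - b)).
have mE' : iK m ^+ 2 = iK k * (iK a - iK b) by rewrite -rmorphXn mE rmorphM rmorphB.
have dw : 2%:R * dK w = w ^+ 2 - iK m ^+ 2.
  have := congr1 dK wE; rewrite (drvX dD) (drvM dD) (drvB dD) !dC mul0r add0r subr0 /= expr1 => e.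
  apply: (mulIf w0).
  transitivity (2%:R * w * dK w); first by ring.
  by rewrite e dsE wE mE'; ring.
have two := natK_neq0 1.
have dwE : dK w = (w ^+ 2 - iK m ^+ 2) / 2%:R by rewrite -dw; field.
have [m0|m0] := eqVneq m 0.
  apply: (@solution_drv1 (- (2%:R / w))).
  rewrite (drvN dD) (drv_div dD) // (drv_nat dD) mul0r sub0r dwE m0 rmorph0.
  by field; rewrite ?two ?w0.
have dwm : dK w != 0.
  rewrite dwE mulf_neq0 ?invr_eq0 // wE mE'.
  have -> : iK k * (s - iK b) - iK k * (iK a - iK b) = iK k * (s - iK a) by ring.
  exact: mulf_neq0.
have wp : w + iK m != 0.
  apply: contraNneq dwm => wm; rewrite dwE.
  have -> : w ^+ 2 - iK m ^+ 2 = (w - iK m) * (w + iK m) by ring.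
  by rewrite wm mulr0 mul0r.
have wm : w - iK m != 0.
  apply: contraNneq dwm => wm; rewrite dwE.
  have -> : w ^+ 2 - iK m ^+ 2 = (w - iK m) * (w + iK m) by ring.
  by rewrite wm mul0r mul0r.
apply: (@solution_exp ((w - iK m) / (w + iK m)) m) => //.
  by rewrite mulf_neq0 ?invr_eq0.
rewrite (drv_div dD) // (drvB dD) (drvD dD) dC dwE; field.
by rewrite two wp.
Qed.

(** A genuine cubic is shifted to Weierstrass form, or has a double root when the discriminant
    vanishes. In lower degree, [t] or [t'] satisfies a linear equation with constant
    coefficients. *)
Lemma solution_cubic t q3 q2 q1 q0 : ~ (exists c, t = iK c) ->
  dK t ^+ 2 = iK q3 * t ^+ 3 + iK q2 * t ^+ 2 + iK q1 * t + iK q0 -> elementary_solution.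
Proof.
move=> tC tE; have dt := drv_neq0 tC; have two := natK_neq0 1; have three := natK_neq0 2.
have shift c : ~ (exists c', t + iK c = iK c').
  by move=> [c' e]; apply: tC; exists (c' - c); rewrite rmorphB -e addrK.
have dshift c : dK (t + iK c) = dK t by rewrite (drvD dD) dC addr0.
have [q30|q30] := eqVneq q3 0; last first.
  have q30' : iK q3 != 0 by rewrite fmorph_eq0.
  have [c cE] : exists c, iK c = iK q2 / (3%:R * iK q3).
    by exists (q2 / (3%:R * q3)); rewrite fmorph_div rmorphM rmorph_nat.
  pose s := t + iK c.
  pose g2 := - (4%:R / q3) * (q1 - 3%:R * q3 * c ^+ 2).
  pose g3 := - (4%:R / q3) * (q0 - q1 * c + q2 * c ^+ 2 - q3 * c ^+ 3).
  have four := natK_neq0 3.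
  have sE : dK s ^+ 2 = iK q3 / 4%:R * (4%:R * s ^+ 3 - iK g2 * s - iK g3).
    rewrite dshift tE /s /g2 /g3.
    rewrite !(rmorphM, rmorphD, rmorphN, rmorphB, rmorphXn, fmorphV, rmorph_nat) cE.
    by field; rewrite ?q30' ?three ?four.
  have [g0|] := eqVneq (27%:R * g3 ^+ 2 - g2 ^+ 3) 0; last first.
    have [al alE] := closed_sqrt (q3 / 4%:R) => gg.
    exists s; split; first exact: shift.
    by constructor 3; exists g2, g3, al; rewrite -rmorphXn alE fmorph_div rmorph_nat.
  (* These are the values for which the cubic is [4 (s - a)^2 (s + 2 a)]; dividing them gives
     [a = - 3 g3 / (2 g2)]. *)
  have [a [aE1 aE2]] : exists a, g2 = 12%:R * a ^+ 2 /\ g3 = - (8%:R * a ^+ 3).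
    clear sE; move: g2 g3 g0 => g2 g3 g0.
    have g23 : g2 ^+ 3 = 27%:R * g3 ^+ 2 by apply/esym/eqP; rewrite -subr_eq0 g0.
    have [g20|g20] := eqVneq g2 0.
      exists 0; rewrite g20 !expr0n !mulr0 oppr0; split=> //; apply/eqP.
      move: g23; rewrite g20 expr0n => /esym/eqP.
      by rewrite mulf_eq0 (negbTE (natC_neq0 26)) /= expf_eq0.
    have n2 := natC_neq0 1; have n12 := natC_neq0 11; have n27 := natC_neq0 26.
    have e : g3 ^+ 2 = g2 ^+ 3 / 27%:R by rewrite g23 mulrC mulKf.
    pose a := - (3%:R * g3 / (2%:R * g2)).
    have a2 : a ^+ 2 = g2 / 12%:R.
      rewrite /a sqrrN expr_div_n !exprMn e.
      by field; rewrite ?n2 ?g20 ?n12 ?n27 ?(natC_neq0 3).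
    exists a; split; first by rewrite a2; field.
    by rewrite exprS a2 /a; field; rewrite ?n2 ?g20 ?n12.
  apply: (@solution_double_root s a (- (2%:R * a)) q3) => //; first exact: shift.
  rewrite sE aE1 aE2 !(rmorphM, rmorphN, rmorphXn, rmorph_nat).
  by field; rewrite ?four.
rewrite q30 rmorph0 mul0r add0r in tE.
have [q20|q20] := eqVneq q2 0; last first.
  have q20' : iK q2 != 0 by rewrite fmorph_eq0.
  have [c cE] : exists c, iK c = iK q1 / (2%:R * iK q2).
    by exists (q1 / (2%:R * q2)); rewrite fmorph_div rmorphM rmorph_nat.
  pose s := t + iK c; pose r := q0 - q2 * c ^+ 2.
  have ds : dK s != 0 by rewrite dshift.
  have sE : dK s ^+ 2 = iK q2 * s ^+ 2 + iK r.
    rewrite dshift tE /s /r !(rmorphM, rmorphB, rmorphXn) cE.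
    by field; rewrite ?two ?q20'.
  have d2s : dK (dK s) = iK q2 * s.
    apply: (drv_eq_double ds sE); rewrite (drvD dD) (drvM dD) !dC (drvX dD) /= expr1; ring.
  have [m mE] := closed_sqrt q2.
  have mE' : iK m ^+ 2 = iK q2 by rewrite -rmorphXn mE.
  have m0 : m != 0 by apply: contraNneq q20 => m0; rewrite -mE m0 expr0n.
  have s0 : s != 0 by apply: contraNneq ds => ->; rewrite (drv0 dD).
  (* As [s'' = m^2 s], the element [s' + m s] is an eigenvector of the derivation for [m]; if it is
     zero, [s] is one for [- m]. *)
  have [v0|v0] := eqVneq (dK s + iK m * s) 0.
    apply: (@solution_exp s (- m)); rewrite ?oppr_eq0 // rmorphN mulNr.
    by apply/eqP; rewrite -addr_eq0 v0.
  apply: (solution_exp v0 m0).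
  by rewrite (drvD dD) (drvM dD) dC d2s -mE'; ring.
rewrite q20 rmorph0 mul0r add0r in tE.
have [q10|q10] := eqVneq q1 0; last first.
  have q10' : iK q1 != 0 by rewrite fmorph_eq0.
  have d2t : dK (dK t) = iK q1 / 2%:R.
    by apply: (drv_eq_double dt tE); rewrite (drvD dD) (drvM dD) !dC; field.
  have twoC := natC_neq0 1.
  apply: (@solution_drv1 (iK (2%:R / q1) * dK t)).
  rewrite (drvM dD) dC d2t fmorph_div rmorph_nat; field.
  by rewrite two q10'.
rewrite q10 rmorph0 mul0r add0r in tE.
have [m mE] := closed_sqrt q0.
have dtm : dK t = iK m \/ dK t = iK (- m).
  have : dK t ^+ 2 == iK m ^+ 2 by rewrite tE -rmorphXn mE.
  by rewrite eqf_sqr => /orP[]/eqP ->; [left | right; rewrite rmorphN].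
have [m' dtm'] : exists m', dK t = iK m' by case: dtm; [exists m | exists (- m)].
have m'0 : iK m' != 0 by rewrite -dtm'.
apply: (@solution_drv1 (iK m'^-1 * t)).
by rewrite (drvM dD) dC dtm' fmorphV mul0r add0r mulVf.
Qed.

(** The substitution [u = 1 / (t - e)] moves a root [e] of [P] to infinity and lowers the degree to
    3. *)
Lemma solution_quartic t (P : {poly C}) : ~ (exists c, t = iK c) -> (size P <= 5)%N ->
  dK t ^+ 2 = (map_poly iK P).[t] -> elementary_solution.
Proof.
move=> tC sP tE.
have [sP1|sP1] := leqP (size P) 1.
  apply: (@solution_cubic t 0 0 0 P`_0) => //.
  by rewrite tE (size1_polyC sP1) map_polyC hornerC coefC rmorph0 !mul0r !add0r.
have [e /factor_theorem[P1 PE]] := closed_root closedC sP1.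
have te : t - iK e != 0.
  by apply/eqP => /eqP; rewrite subr_eq0 => /eqP te; apply: tC; exists e.
pose u := (t - iK e)^-1; pose R := P1 \Po ('X + e%:P).
have u0 : u != 0 by rewrite invr_eq0.
have sR : (size R <= 4)%N.
  rewrite size_comp_poly2 ?size_XaddC //.
  have [->|P10] := eqVneq P1 0; first by rewrite size_poly0.
  by move: sP; rewrite PE size_Mmonic ?monicXsubC // size_XsubC addn2.
apply: (@solution_cubic u R`_0 R`_1 R`_2 R`_3).
  move=> [c uc]; apply: tC; exists (c^-1 + e).
  by rewrite rmorphD fmorphV -uc invrK subrK.
have tu : t = iK e + u^-1 by rewrite invrK addrC subrK.
have RE : (map_poly iK P1).[t] = \sum_(k < 4) iK R`_k * u^-1 ^+ k.
  transitivity (map_poly iK R).[u^-1].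
    by rewrite map_comp_poly rmorphD /= map_polyX map_polyC horner_comp !hornerE -addrC -tu.
  rewrite (horner_coef_wide _ (n := 4)) ?size_map_poly //.
  by apply: eq_bigr => k _; rewrite coef_map.
have -> : dK u = - dK t * u ^+ 2.
  by rewrite /u (drvV dD) (drvB dD) dC subr0 exprVn.
have -> : (- dK t * u ^+ 2) ^+ 2 = dK t ^+ 2 * u ^+ 4 by ring.
rewrite tE PE rmorphM hornerM RE rmorphB /= map_polyX map_polyC hornerD hornerN hornerX hornerC.
rewrite -[t - iK e]invrK -/u !big_ord_recl big_ord0 /=.
by rewrite /bump /=; field.
Qed.
End NoNewConstants.

End AutonomousEquation.

(** * Differential fields from differential rings *)

Section DomainFraction.
Variables (R : comNzRingType).
Hypothesis domR : forall x y : R, x * y = 0 -> (x == 0) || (y == 0).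

Definition domain_of := (R : Type).
HB.instance Definition _ := GRing.ComNzRing.on domain_of.
Definition dom_unit : {pred domain_of} := fun x => `[< exists y, y * x = 1 >].
Definition dom_inv (x : domain_of) : domain_of :=
  if pselect (exists y, y * x = 1) is left h then projT1 (cid h) else x.
Lemma dom_mulV : {in dom_unit, left_inverse 1 dom_inv *%R}.
Proof.
move=> x /asboolP hx; rewrite /dom_inv; case: pselect => [h|//]; exact: (projT2 (cid h)).
Qed.
Lemma dom_unitPl x y : y * x = 1 -> dom_unit x.
Proof. by move=> yx; apply/asboolP; exists y. Qed.
Lemma dom_inv_out : {in [predC dom_unit], dom_inv =1 id}.
Proof.
move=> x /negP hx; rewrite /dom_inv; case: pselect => [h|//]; case: hx; exact/asboolP.
Qed.
HB.instance Definition _ :=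
  GRing.ComNzRing_hasMulInverse.Build domain_of dom_mulV dom_unitPl dom_inv_out.
HB.instance Definition _ := GRing.ComUnitRing_isIntegral.Build domain_of domR.

Lemma domain_fraction : exists (M : fieldType) (f : {rmorphism R -> M}),
  injective f /\ forall m, exists u v, f v != 0 /\ m = f u / f v.
Proof.
pose f : domain_of -> {fraction domain_of} := @tofrac _.
exists ({fraction domain_of} : fieldType), (f : {rmorphism domain_of -> {fraction domain_of}}).
split=> [x y /eqP|m]; first by rewrite /= tofrac_eq => /eqP.
elim/quotW: m => x; exists (x.1 : R), (x.2 : R); rewrite /= tofrac_eq0 denom_ratioP; split=> //.
apply: (canRL (mulfK _)); first by rewrite tofrac_eq0 denom_ratioP.
rewrite /= -[RHS]/(@tofrac domain_of x.1) -[X in _ * X]/(@tofrac domain_of x.2).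
unlock tofrac; rewrite -[LHS]FracField.pi_mul; apply/eqmodP => /=.
rewrite FracField.equivfE /FracField.mulf !numden_Ratio ?oner_neq0 ?mulr1 ?denom_ratioP //.
by rewrite mulrC.
Qed.
End DomainFraction.

Section PrimeFraction.
Variables (R : comNzRingType) (P : set R).
Hypotheses (P0 : P 0) (P1 : ~ P 1) (PD : forall x y, P x -> P y -> P (x + y)).
Hypotheses (PM : forall x y, P y -> P (x * y)) (Pprime : forall x y, P (x * y) -> P x \/ P y).

Definition ideal_mem : {pred R} := fun x => `[< P x >].
Lemma ideal_mem_closed : idealr_closed ideal_mem.
Proof.
split; first exact/asboolP.
  by apply/negP => /asboolP.
by move=> a u v /asboolP Pu /asboolP Pv; apply/asboolP/PD => //; exact: PM.
Qed.
HB.instance Definition _ := isIdealr.Build R ideal_mem ideal_mem_closed.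

Lemma ideal_mem_prime : prime_idealr_closed ideal_mem.
Proof.
by move=> u v /asboolP /Pprime[] h; apply/orP; [left | right]; apply/asboolP.
Qed.
HB.instance Definition _ := isPrimeIdealrClosed.Build R ideal_mem ideal_mem_prime.

Lemma ideal_quot_domain (x y : {ideal_quot ideal_mem}) : x * y = 0 -> (x == 0) || (y == 0).
Proof.
exact: Quotient.rquot_IdomainAxiom.
Qed.

Lemma prime_fraction : exists (M : fieldType) (f : {rmorphism R -> M}),
  (forall x, f x = 0 <-> P x) /\ forall m, exists u v, f v != 0 /\ m = f u / f v.
Proof.
have [M [f [f_inj fracf]]] := domain_fraction ideal_quot_domain.
exists M, (f \o \pi_({ideal_quot ideal_mem})%qT : {rmorphism R -> M}); split=> [x|m].
  have e : (x \in ideal_mem) = (\pi_({ideal_quot ideal_mem})%qT x == 0).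
    by rewrite -[x in LHS]subr0 Quotient.idealrBE rmorph0.
  have Pe : P x <-> x \in ideal_mem by split=> [h|/asboolP//]; apply/asboolP.
  rewrite Pe e; split=> [/= h|/eqP /= ->]; last by rewrite rmorph0.
  by apply/eqP/f_inj; rewrite rmorph0.
have [u [v [v0 ->]]] := fracf m.
by exists (repr u), (repr v); rewrite /= !reprK.
Qed.
End PrimeFraction.

Section ExtendDerivation.
Variables (A : comNzRingType) (W : fieldType) (ev : {rmorphism A -> W}) (de : A -> W).
Hypotheses (deD : forall x y, de (x + y) = de x + de y).
Hypotheses (deM : forall x y, de (x * y) = de x * ev y + ev x * de y).
Hypotheses (de0 : forall x, ev x = 0 -> de x = 0).
Hypothesis frac_ev : forall w, exists u v, ev v != 0 /\ w = ev u / ev v.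

Lemma extend_derivation : exists d : W -> W, derivation d /\ forall x, d (ev x) = de x.
Proof.
have deB x y : de (x - y) = de x - de y.
  have dN z : de (- z) = - de z.
    apply/eqP; rewrite -addr_eq0 -deD addNr; apply/eqP/de0; exact: rmorph0.
  by rewrite deD dN.
have /choice[num /choice[den H]] := frac_ev.
pose d w := (de (num w) * ev (den w) - ev (num w) * de (den w)) / ev (den w) ^+ 2.
have dE u v : ev v != 0 -> d (ev u / ev v) = (de u * ev v - ev u * de v) / ev v ^+ 2.
  move=> v0; rewrite /d; have [] := H (ev u / ev v).
  move: (num _) (den _) => n m m0 nm.
  have e : ev (n * v - u * m) = 0.
    by rewrite rmorphB !rmorphM /=; apply/eqP; rewrite subr_eq0 -eqr_div // nm.
  have := de0 e; rewrite deB !deM => {}e.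
  have nE : ev n = ev u * ev m / ev v by apply: (canRL (mulfK v0)); apply/esym/eqP; rewrite -eqr_div // nm.
  have dnE : de n = (de u * ev m + ev u * de m - ev n * de v) / ev v.
    apply: (canRL (mulfK v0)); apply/eqP; rewrite -subr_eq0 -[X in _ == X]e; apply/eqP; ring.
  by rewrite dnE nE; field; rewrite m0 v0.
have dev x : d (ev x) = de x.
  have e : ev x = ev x / ev 1 by rewrite rmorph1 divr1.
  rewrite e dE ?rmorph1 ?oner_neq0 // expr1n !divr1 mulr1.
  suff -> : de 1 = 0 by rewrite mulr0 subr0.
  by apply: (addrI (de 1)); rewrite addr0 -{3}[1]mulr1 deM rmorph1 mulr1 mul1r.
exists d; split=> //; split=> x y.
  have [u [v [v0 ->]]] := frac_ev x; have [u' [v' [v'0 ->]]] := frac_ev y.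
  have -> : ev u / ev v + ev u' / ev v' = ev (u * v' + u' * v) / ev (v * v').
    by rewrite rmorphD !rmorphM /=; field; rewrite v0 v'0.
  rewrite !dE //; last by rewrite rmorphM mulf_neq0.
  by rewrite rmorphD !rmorphM /= deD !deM; field; rewrite v0 v'0.
have [u [v [v0 ->]]] := frac_ev x; have [u' [v' [v'0 ->]]] := frac_ev y.
have -> : ev u / ev v * (ev u' / ev v') = ev (u * u') / ev (v * v').
  by rewrite !rmorphM /=; field; rewrite v0 v'0.
rewrite !dE //; last by rewrite rmorphM mulf_neq0.
by rewrite !rmorphM /= !deM; field; rewrite v0 v'0.
Qed.
End ExtendDerivation.

Lemma Zorn_above (T : Type) (G : set (set T)) (A0 : set T) : G A0 ->
  (* Chains are assumed nonempty here; in the proof the empty set is adjoined to the ordered family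
     to provide the union of the empty chain. *)
  (forall F : set (set T), F `<=` G -> total_on F subset -> F !=set0 -> G (\bigcup_(X in F) X)) ->
  exists A, [/\ G A, A0 `<=` A & forall B, G B -> A `<=` B -> B `<=` A].
Proof.
move=> GA0 chain; pose Q := [set A : set T | A = set0 \/ (G A /\ A0 `<=` A)].
have [F FQ Ftot|A [[A0'|[GA AA0]] Amax]] := @Zorn_bigcup T Q.
- have [F0|] := pselect (forall X, F X -> X = set0).
    by left; apply/seteqP; split=> // x [X /F0 ->].
  move=> /existsNP[X /not_implyP[FX X0]]; right.
  pose F' := F `&` [set X | X <> set0].
  have F'G Y : F' Y -> G Y /\ A0 `<=` Y by move=> [/FQ[]//].
  have -> : \bigcup_(X in F) X = \bigcup_(X in F') X.
    apply/seteqP; split=> x [Y FY Yx]; exists Y => //; last by case: FY.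
    by split=> // Y0; move: Yx; rewrite Y0.
  split; last by move=> x A0x; exists X => //; have [_] := F'G X (conj FX X0); apply.
  apply: chain; last by exists X.
    by move=> Y /F'G[].
  by move=> Y Z [FY _] [FZ _]; exact: Ftot.
- have [A00|A00] := pselect (A0 = set0).
    exists set0; rewrite -{1}A00; split=> // [|B GB _ x Bx]; first by rewrite A00.
    exfalso; apply: (Amax B); last by right; rewrite A00; split.
    by rewrite A0'; split=> [|/(_ x Bx)].
  exfalso; apply: (Amax A0); last by right; split.
  rewrite A0'; split=> // A0s; apply: A00; apply/seteqP; split=> //.
- exists A; split=> // B GB AB x Bx; apply: contrapT => Ax.
  apply: (Amax B); last by right; split=> //; exact: subset_trans AB.
  by split=> // /(_ x Bx).
Qed.

Section DiffFieldOf.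
Variables (M : fieldType) (d : M -> M) (dD : derivation d).
Definition diff_field_sort := (fun _ : derivation d => M : Type) dD.
HB.instance Definition _ := GRing.Field.on diff_field_sort.
HB.instance Definition _ := Field_isDifferential.Build diff_field_sort dD.1 dD.2.

Lemma diff_field_of : exists (N : diffFieldType) (f : {rmorphism M -> N}),
  bijective f /\ forall x, der (f x) = f (d x).
Proof.
exists (diff_field_sort : diffFieldType), (idfun : {rmorphism M -> M}); split=> //.
by exists id.
Qed.
End DiffFieldOf.

Section DifferentialQuotient.
Variables (R : comNzRingType) (D : R -> R) (S : set R).
Hypothesis dD : derivation D.
Hypothesis natR : forall n, exists u : R, u * n.+1%:R = 1.
Hypotheses (S1 : S 1) (S0 : ~ S 0) (SM : forall x y, S x -> S y -> S (x * y)).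

Definition diff_ideal (P : set R) : Prop :=
  [/\ P 0, forall x y, P x -> P y -> P (x + y), forall x y, P y -> P (x * y)
    & forall x, P x -> P (D x)].

(* Ritt's argument that the radical of a differential ideal is a differential ideal. *)
Lemma radical_diff_step (P : set R) x n k : diff_ideal P -> (k <= n)%N -> P (x ^+ n) ->
  P (x ^+ (n - k) * D x ^+ k.*2).
Proof.
move=> [P0 PD PM PDer] kn Pxn; elim: k kn => [|k IH] kn; first by rewrite subn0 mulr1.
have := IH (ltnW kn); set m := (n - k.+1)%N; have -> : (n - k = m.+1)%N by rewrite /m; lia.
move: k.*2 (doubleS k) => l -> Pl.
have [u un] := natR m.
have -> : x ^+ m * D x ^+ l.+2 =
    u * (D x * D (x ^+ m.+1 * D x ^+ l) + (- l%:R * D (D x)) * (x ^+ m.+1 * D x ^+ l)).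
  rewrite (drvM dD) !(drvX dD) /=.
  transitivity (u * m.+1%:R * (x ^+ m * D x ^+ l.+2)); first by rewrite un mul1r.
  by case: l {Pl} => [|l] /=; rewrite ?exprS ?expr0; ring.
by apply/PM/PD; [exact/PM/PDer | exact: PM].
Qed.

(** A differential ideal maximal among those avoiding [S] is prime: by maximality it equals its
    radical, its colon ideals are then differential, and maximality applies to them again. *)
Lemma diff_quotient : exists (M : diffFieldType) (f : {rmorphism R -> M}),
  (forall x, f (D x) = der (f x)) /\ forall s, S s -> f s != 0.
Proof.
have SX s n : S s -> S (s ^+ n).
  by move=> Ss; elim: n => [|n IH]; rewrite ?expr0 ?exprS //; exact: SM.
pose G := [set P : set R | diff_ideal P /\ forall s, S s -> ~ P s].
have [||P [[idP PS] _ Pmax]] := @Zorn_above R G [set 0].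
- split=> [|s Ss /= s0]; last by apply: S0; rewrite -s0.
  split=> //=; first by move=> x y -> ->; rewrite addr0.
    by move=> x y ->; rewrite mulr0.
  by move=> x ->; rewrite (drv0 dD).
- move=> F FG Ftot [X0 FX0]; split; last by move=> s Ss [X /FG[_ XS]]; exact: XS.
  split.
  - by exists X0 => //; have [[]] := FG X0 FX0.
  - move=> x y [X FX Xx] [Y FY Yy].
    have [XY|YX] := Ftot X Y FX FY.
      by exists Y => //; have [[_ h _ _] _] := FG Y FY; apply: h => //; exact: XY.
    by exists X => //; have [[_ h _ _] _] := FG X FX; apply: h => //; exact: YX.
  - by move=> x y [X FX Xy]; exists X => //; have [[_ _ h _] _] := FG X FX; exact: h.
  - by move=> x [X FX Xx]; exists X => //; have [[_ _ _ h] _] := FG X FX; exact: h.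
have [P0 PD PM PDer] := idP.
have PN x : P x -> P (- x) by rewrite -mulN1r; exact: PM.
have radical x n : P (x ^+ n) -> P x.
  pose Q := [set x | exists n, P (x ^+ n)].
  move=> Px; apply: (Pmax Q); [|by move=> y Py; exists 1%N|by exists n].
  split; last by move=> s Ss [m Pm]; apply: PS Pm; exact: SX.
  split.
  - by exists 1%N.
  - move=> y z [k Pk] [l Pl]; exists (k + l)%N; rewrite exprDn.
    elim/big_ind: _ => // i _; rewrite -mulr_natl; apply: (PM).
    have [ki|ik] := leqP k (k + l - i).
      by rewrite -(subnK ki) exprD mulrC mulrA; exact: PM.
    have li : (l <= i)%N by lia.
    by rewrite -(subnK li) exprD mulrA; exact: PM.
  - by move=> y z [k Pk]; exists k; rewrite exprMn; exact: PM.
  - move=> y [k Pk]; exists k.*2.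
    by have := radical_diff_step idP (leqnn k) Pk; rewrite subnn expr0 mul1r.
have deriv_div x y : P (x * y) -> P (x * D y).
  move=> Pxy; apply: (radical _ 2).
  (* Since [D (x * y)] is in the ideal, [x * D y] is congruent to [- y * D x], and its square is a
     multiple of [x * y]. *)
  have -> : (x * D y) ^+ 2 = (x * D y) * D (x * y) + (- D x * D y) * (x * y).
    by rewrite (drvM dD); ring.
  by apply: PD; [exact/PM/PDer | exact: PM].
have colon a : (forall s, S s -> ~ P (a * s)) -> forall x, P (a * x) -> P x.
  move=> aS x Pax; apply: (Pmax [set y | P (a * y)]) => //; last by move=> y; exact: PM.
  split=> //; split=> /= [|y z Py Pz|y z Pz|y Py]; first by rewrite mulr0.
  - by rewrite mulrDr; exact: PD.
  - by rewrite mulrCA; exact: PM.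
  - exact: deriv_div.
have prime x y : P (x * y) -> P x \/ P y.
  move=> Pxy; apply: contrapT => /not_orP[Px Py].
  have [s Ss Pys] : exists2 s, S s & P (y * s).
    apply: contrapT => nos; apply: Px; apply: (colon y); last by rewrite mulrC.
    by move=> s Ss Pys; apply: nos; exists s.
  apply: Py; apply: (colon s); last by rewrite mulrC.
  by move=> s' Ss' Pss'; apply: PS Pss'; exact: SM.
have [M [f [fP fracf]]] := prime_fraction P0 (PS 1 S1) PD PM prime.
have [|||d [dM df]] := @extend_derivation R M f (fun x => f (D x)) _ _ _ fracf.
- by move=> x y; rewrite (drvD dD) rmorphD.
- by move=> x y; rewrite (drvM dD) rmorphD !rmorphM.
- by move=> x /fP Px; apply/fP/PDer.
have [N [g [_ gd]]] := diff_field_of dM.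
exists N, (g \o f : {rmorphism R -> N}); split=> [x|s Ss] /=; first by rewrite gd df.
by rewrite fmorph_eq0; apply/eqP => /fP; exact: PS.
Qed.
End DifferentialQuotient.

(** * Generic conjugates *)

Section TensorSquare.
Variables (F E : diffFieldType) (p : diffMorphism F E).

Definition F_linear (phi : E -> E) : Prop :=
  (forall x y, phi (x + y) = phi x + phi y) /\ (forall c x, phi (p c * x) = p c * phi x).

Lemma F_linear_id : F_linear id. Proof. by []. Qed.
Lemma F_linear_mulr phi y : F_linear phi -> F_linear (fun x => phi (x * y)).
Proof. by move=> [phiD phiZ]; split=> [x z|c x]; rewrite ?mulrDl -?mulrA ?phiD ?phiZ. Qed.
(** Neither [der] composed with [phi] nor [phi] composed with [der] is [F]-linear, but their
    commutator is; this makes the derivation of tensors compatible with [teq]. *)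
Lemma F_linear_der phi : F_linear phi -> F_linear (fun x => der (phi x) - phi (der x)).
Proof.
move=> [phiD phiZ]; split=> [x z|c x]; first by rewrite !(phiD, derD); ring.
by rewrite !(derM, phiD, phiZ, derD) -!morph_der phiZ; ring.
Qed.
Lemma F_linear0 phi : F_linear phi -> phi 0 = 0.
Proof. by move=> [phiD _]; apply: (addrI (phi 0)); rewrite -phiD !addr0. Qed.

(* A formal sum of tensors is identified by the values it gives to all the [F]-linear
   maps of [E]. *)
Definition tval (s : seq (E * E)) (phi : E -> E) : E := \sum_(q <- s) q.1 * phi q.2.
Definition teq (s t : seq (E * E)) : bool :=
  `[< forall phi, F_linear phi -> tval s phi = tval t phi >].

Lemma teqP s t : reflect (forall phi, F_linear phi -> tval s phi = tval t phi) (teq s t).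
Proof. exact: asboolP. Qed.
Lemma teq_equiv : equiv_class_of teq.
Proof.
split=> [s|s t|s t u].
- exact/teqP.
- by apply/teqP/teqP => h phi hphi; rewrite h.
- by move=> /teqP h /teqP h'; apply/teqP => phi hphi; rewrite h // h'.
Qed.
Canonical teq_equivRel := EquivRelPack teq_equiv.
Definition tensor := {eq_quot teq}%qT.
HB.instance Definition _ := Choice.on tensor.
HB.instance Definition _ := EqQuotient.on tensor.

Definition tcls (s : seq (E * E)) : tensor := (\pi s)%qT.
Definition trep (x : tensor) : seq (E * E) := repr x.
Lemma trepK x : tcls (trep x) = x. Proof. exact: reprK. Qed.
Lemma tcls_eq s t : tcls s = tcls t <-> forall phi, F_linear phi -> tval s phi = tval t phi.
Proof.
split=> [/eqmodP/teqP//|h]; first by apply/eqmodP/teqP.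
Qed.
Lemma trepE s phi : F_linear phi -> tval (trep (tcls s)) phi = tval s phi.
Proof. by move=> hphi; have /tcls_eq := trepK (tcls s); apply. Qed.

Lemma tval_cat s t phi : tval (s ++ t) phi = tval s phi + tval t phi.
Proof. exact: big_cat. Qed.
Lemma tval1 a b phi : tval [:: (a, b)] phi = a * phi b.
Proof. exact: big_seq1. Qed.
Definition lopp (s : seq (E * E)) := [seq (- q.1, q.2) | q <- s].
Lemma tval_opp s phi : tval (lopp s) phi = - tval s phi.
Proof. by rewrite /tval big_map -sumrN; apply: eq_bigr => q _; rewrite mulNr. Qed.
Definition lmul (s t : seq (E * E)) := [seq (x.1 * y.1, x.2 * y.2) | x <- s, y <- t].
Lemma tval_mul s t phi : tval (lmul s t) phi = \sum_(y <- t) y.1 * tval s (fun x => phi (x * y.2)).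
Proof.
rewrite /tval /lmul big_allpairs_dep exchange_big; apply: eq_bigr => y _.
by rewrite mulr_sumr; apply: eq_bigr => x _ /=; ring.
Qed.
Lemma tval_mulC s t phi : tval (lmul s t) phi = tval (lmul t s) phi.
Proof.
rewrite /tval /lmul !big_allpairs_dep exchange_big; apply: eq_bigr => y _.
by apply: eq_bigr => x _ /=; rewrite mulrC [x.2 * _]mulrC [x.1 * _]mulrC mulrC.
Qed.
Definition lder (s : seq (E * E)) :=
  [seq (der q.1, q.2) | q <- s] ++ [seq (q.1, der q.2) | q <- s].
Lemma tval_der s phi :
  tval (lder s) phi = der (tval s phi) - tval s (fun x => der (phi x) - phi (der x)).
Proof.
rewrite /lder tval_cat /tval !big_map (drv_sum (der_derivation _)) -sumrB -big_split.
by apply: eq_bigr => q _ /=; rewrite derM; ring.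
Qed.

Definition tadd x y := tcls (trep x ++ trep y).
Definition topp x := tcls (lopp (trep x)).
Definition tmul x y := tcls (lmul (trep x) (trep y)).
Definition tder x := tcls (lder (trep x)).

Lemma tvalM_ext s s' t phi : (forall psi, F_linear psi -> tval s psi = tval s' psi) ->
  F_linear phi -> tval (lmul s t) phi = tval (lmul s' t) phi.
Proof.
move=> h hphi; rewrite !tval_mul; apply: eq_bigr => y _; rewrite h //.
exact: F_linear_mulr.
Qed.

Lemma taddE s t : tadd (tcls s) (tcls t) = tcls (s ++ t).
Proof. by apply/tcls_eq => phi hphi; rewrite !tval_cat !trepE. Qed.
Lemma toppE s : topp (tcls s) = tcls (lopp s).
Proof. by apply/tcls_eq => phi hphi; rewrite !tval_opp !trepE. Qed.
Lemma tmulE s t : tmul (tcls s) (tcls t) = tcls (lmul s t).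
Proof.
apply/tcls_eq => phi hphi; rewrite (@tvalM_ext _ s) //; last by move=> psi; exact: trepE.
by rewrite tval_mulC (@tvalM_ext _ t) 1?tval_mulC // => psi; exact: trepE.
Qed.
Lemma tderE s : tder (tcls s) = tcls (lder s).
Proof.
by apply/tcls_eq => phi hphi; rewrite !tval_der !trepE //; exact: F_linear_der.
Qed.

Lemma tensor_ind (Q : tensor -> Prop) : (forall s, Q (tcls s)) -> forall x, Q x.
Proof. by move=> H x; rewrite -(trepK x). Qed.

Lemma taddA : associative tadd.
Proof.
elim/tensor_ind=> s; elim/tensor_ind=> t; elim/tensor_ind=> u.
by rewrite !taddE catA.
Qed.
Lemma taddC : commutative tadd.
Proof.
elim/tensor_ind=> s; elim/tensor_ind=> t; rewrite !taddE.
by apply/tcls_eq => phi _; rewrite !tval_cat addrC.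
Qed.
Lemma tadd0 : left_id (tcls [::]) tadd.
Proof. by elim/tensor_ind=> s; rewrite taddE. Qed.
Lemma taddN : left_inverse (tcls [::]) topp tadd.
Proof.
elim/tensor_ind=> s; rewrite toppE taddE.
by apply/tcls_eq => phi _; rewrite tval_cat tval_opp addNr /tval big_nil.
Qed.
HB.instance Definition _ := GRing.isZmodule.Build tensor taddA taddC tadd0 taddN.
Lemma tcls_add s t : tcls s + tcls t = tcls (s ++ t). Proof. exact: taddE. Qed.
Lemma tcls_opp s : - tcls s = tcls (lopp s). Proof. exact: toppE. Qed.

Lemma tmulA : associative tmul.
Proof.
elim/tensor_ind=> s; elim/tensor_ind=> t; elim/tensor_ind=> u; rewrite !tmulE.
apply/tcls_eq => phi _; rewrite tval_mul {1}/lmul big_allpairs_dep exchange_big [RHS]tval_mul.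
apply: eq_bigr => y _; rewrite tval_mul mulr_sumr; apply: eq_bigr => z _ /=.
rewrite mulrA [y.1 * _]mulrC; congr (_ * _).
by apply: eq_bigr => x _; rewrite mulrA.
Qed.
Lemma tmulC : commutative tmul.
Proof.
elim/tensor_ind=> s; elim/tensor_ind=> t; rewrite !tmulE.
by apply/tcls_eq => phi _; exact: tval_mulC.
Qed.
Lemma tmul1 : left_id (tcls [:: (1, 1)]) tmul.
Proof.
elim/tensor_ind=> s; rewrite tmulE; apply/tcls_eq => phi _; rewrite tval_mul.
by apply: eq_bigr => y _; rewrite tval1 !mul1r.
Qed.
Lemma tmulD : left_distributive tmul +%R.
Proof.
elim/tensor_ind=> s; elim/tensor_ind=> t; elim/tensor_ind=> u.
rewrite tcls_add !tmulE tcls_add; apply/tcls_eq => phi _.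
rewrite tval_cat !tval_mul -big_split; apply: eq_bigr => y _.
by rewrite tval_cat mulrDr.
Qed.
Lemma tensor_nontrivial : tcls [:: (1, 1)] != 0.
Proof.
apply/eqP => /tcls_eq/(_ _ F_linear_id)/eqP.
by rewrite tval1 /tval big_nil mulr1 oner_eq0.
Qed.
HB.instance Definition _ := GRing.Zmodule_isComNzRing.Build tensor
  tmulA tmulC tmul1 tmulD tensor_nontrivial.
Lemma tcls_mul s t : tcls s * tcls t = tcls (lmul s t). Proof. exact: tmulE. Qed.

Lemma tder_derivation : derivation tder.
Proof.
split; elim/tensor_ind=> s; elim/tensor_ind=> t.
  rewrite tcls_add !tderE tcls_add; apply/tcls_eq => phi _.
  by rewrite tval_cat !tval_der !tval_cat derD; ring.
rewrite tcls_mul !tderE !tcls_mul tcls_add.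
apply/tcls_eq => phi hphi; have [phiD _] := hphi.
rewrite tval_cat /lmul /lder !tval_cat /tval !big_map !big_allpairs_dep !big_cat !big_map /= -!big_split /=.
apply: eq_bigr => x _; rewrite big_cat !big_map /= -!big_split /=.
apply: eq_bigr => y _; rewrite !derM phiD; ring.
Qed.

Definition tleft (e : E) : tensor := tcls [:: (e, 1)].
Definition tright (e : E) : tensor := tcls [:: (1, e)].
Lemma tcls_cons a b s : tcls ((a, b) :: s) = tleft a * tright b + tcls s.
Proof.
rewrite tcls_mul tcls_add; apply/tcls_eq => phi _.
by rewrite /tval /lmul /= !big_cons mulr1 mul1r.
Qed.
Lemma tleft_zmod : zmod_morphism tleft.
Proof.
move=> x y; rewrite tcls_opp tcls_add; apply/tcls_eq => phi _.
by rewrite tval_cat tval_opp !tval1 mulrBl.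
Qed.
Lemma tleft_monoid : monoid_morphism tleft.
Proof.
split=> // x y; rewrite tcls_mul; apply/tcls_eq => phi _.
by rewrite /lmul /= !tval1 mulr1.
Qed.
Lemma tright_zmod : zmod_morphism tright.
Proof.
move=> x y; rewrite tcls_opp tcls_add; apply/tcls_eq => phi hphi.
rewrite tval_cat tval_opp !tval1 !mul1r; have [phiD _] := hphi.
by apply: (addIr (phi y)); rewrite -phiD !subrK.
Qed.
Lemma tright_monoid : monoid_morphism tright.
Proof.
split=> // x y; rewrite tcls_mul; apply/tcls_eq => phi _.
by rewrite /lmul /= !tval1 mulr1.
Qed.
HB.instance Definition _ := GRing.isZmodMorphism.Build E tensor tleft tleft_zmod.
HB.instance Definition _ := GRing.isMonoidMorphism.Build E tensor tleft tleft_monoid.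
HB.instance Definition _ := GRing.isZmodMorphism.Build E tensor tright tright_zmod.
HB.instance Definition _ := GRing.isMonoidMorphism.Build E tensor tright tright_monoid.

Lemma tleft_right c : tleft (p c) = tright (p c).
Proof.
apply/tcls_eq => phi [_ phiZ]; rewrite !tval1 mul1r.
by rewrite -phiZ mulr1.
Qed.
Lemma tder_left e : tder (tleft e) = tleft (der e).
Proof.
rewrite tderE; apply/tcls_eq => phi hphi; rewrite /lder /= /tval !big_cons big_nil /=.
by rewrite (drv1 (der_derivation E)) (F_linear0 hphi) mulr0 !addr0.
Qed.
Lemma tder_right e : tder (tright e) = tright (der e).
Proof.
rewrite tderE; apply/tcls_eq => phi hphi; rewrite /lder /= /tval !big_cons big_nil /=.
by rewrite (drv1 (der_derivation E)) mul0r add0r.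
Qed.
End TensorSquare.

Section Functional.
Variables (F E : diffFieldType) (p : diffMorphism F E) (t : E).
Hypothesis trans : forall q : {poly F}, (map_poly p q).[t] = 0 -> q = 0.

(* Any maximal [F]-subspace containing the [t ^+ i], [i > 0], but not [1] is a hyperplane
   complementary to [F]. *)
Lemma F_linear_separating : exists2 phi, F_linear p phi &
  forall i, phi (t ^+ i) = (i == 0)%:R.
Proof.
pose G := [set V : set E | (forall x y, V x -> V y -> V (x + y)) /\
  (forall c x, V x -> V (p c * x)) /\ ~ V 1].
pose V0 := [set x | exists2 q : {poly F}, q`_0 = 0 & x = (map_poly p q).[t]].
have GV0 : G V0.
  split; last split.
  - move=> x y [q q0 ->] [r r0 ->]; exists (q + r); first by rewrite coefD q0 r0 addr0.
    by rewrite rmorphD hornerD.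
  - move=> c x [q q0 ->]; exists (c *: q); first by rewrite coefZ q0 mulr0.
    by rewrite map_polyZ hornerZ.
  - move=> [q q0 e]; have /trans/polyP/(_ 0%N) : (map_poly p (q - 1)).[t] = 0.
      by rewrite rmorphB rmorph1 hornerD hornerN -e hornerC subrr.
    by rewrite coefB q0 coefC coef0 sub0r => /eqP; rewrite oppr_eq0 oner_eq0.
have [F0 F0G Ftot [X0 FX0]|V [[VD [VZ V1]] V0V Vmax]] := Zorn_above GV0.
  split; last split; last by move=> [X /F0G[_ [_ ]]].
  - move=> x y [X FX Xx] [Y FY Yy].
    have [XY|YX] := Ftot X Y FX FY.
      by exists Y => //; have [h _] := F0G Y FY; apply: h => //; exact: XY.
    by exists X => //; have [h _] := F0G X FX; apply: h => //; exact: YX.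
  - by move=> c x [X FX Xx]; exists X => //; have [_ [h _]] := F0G X FX; exact: h.
have V00 : V 0 by apply: V0V; exists 0; rewrite ?coef0 // rmorph0 horner0.
have decomp x : exists c, V (x - p c).
  apply: contrapT => nox.
  have Vx : V x.
    apply: (Vmax [set y | exists c v, V v /\ y = v + p c * x]) => [|v Vv|]; last 2 first.
    - by exists 0, v; rewrite rmorph0 mul0r addr0.
    - by exists 1, 0; rewrite rmorph1 mul1r add0r.
    split; last split.
    - move=> y z [c [v [Vv ->]]] [c' [v' [Vv' ->]]]; exists (c + c'), (v + v').
      by split; [exact: VD | rewrite rmorphD; ring].
    - move=> c y [c' [v [Vv ->]]]; exists (c * c'), (p c * v).
      by split; [exact: VZ | rewrite rmorphM; ring].
    - move=> [c [v [Vv e]]]; apply: nox.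
      have c0 : c != 0.
        by apply: contra_notN V1 => /eqP c0; rewrite e c0 rmorph0 mul0r addr0.
      exists c^-1; have -> : x - p c^-1 = p (- c^-1) * v; last exact: VZ.
      have pc0 : p c != 0 by rewrite fmorph_eq0.
      apply: (mulfI pc0); rewrite mulrBr rmorphN fmorphV; move/eqP: e.
      by rewrite addrC -subr_eq => /eqP <-; field.
  by apply: nox; exists 0; rewrite rmorph0 subr0.
have uniq c : V (p c) -> c = 0.
  move=> Vc; apply/eqP; apply: contra_notT V1 => c0.
  by have := VZ c^-1 _ Vc; rewrite -rmorphM mulVf // rmorph1.
have VN x : V x -> V (- x) by rewrite -mulN1r -(rmorphN1 p); exact: VZ.
have /choice[f fP] := decomp.
have fE x c : V (x - p c) -> f x = c.
  move=> Vc; apply/eqP; rewrite -subr_eq0; apply/eqP/uniq; rewrite rmorphB.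
  have -> : p (f x) - p c = (x - p c) + - (x - p (f x)) by ring.
  by apply: VD => //; exact: VN.
exists (fun x => p (f x)).
  split=> [x y|c x]; rewrite -?rmorphD -?rmorphM; congr (p _); apply: fE.
    have -> : x + y - p (f x + f y) = (x - p (f x)) + (y - p (f y)) by rewrite rmorphD; ring.
    exact: VD.
  have -> : p c * x - p (c * f x) = p c * (x - p (f x)) by rewrite rmorphM; ring.
  exact: VZ.
case=> [|i]; first by rewrite expr0 (@fE _ 1) ?rmorph1 ?subrr.
rewrite (@fE _ 0) ?rmorph0 // subr0; apply: V0V.
by exists 'X^(i.+1); rewrite ?coefXn // map_polyXn hornerXn.
Qed.

(** In the tensor square of [E] over [F], nonzero polynomials over the left factor in the right copy
    of [t] form a multiplicative set without 0. A differential field in which they stay nonzero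
    makes the right copy of [t] transcendental over the left copy of [E]. *)
Theorem generic_extension : [pchar E] =i pred0 ->
  exists (M : diffFieldType) (j sigma : diffMorphism E M),
    (forall c, sigma (p c) = j (p c)) /\
    forall q : {poly E}, (map_poly j q).[sigma t] = 0 -> q = 0.
Proof.
move=> char0; have [phi hphi phit] := F_linear_separating.
pose ten := poly_eval (tleft p) (tright p t).
have tenE q : ten q = tcls p [seq (q`_i, t ^+ i) | i <- iota 0 (size q)].
  rewrite /ten poly_evalE (horner_coef_wide _ (n := size q)); last first.
    by rewrite map_polyE (leq_trans (size_Poly _)) // size_map.
  rewrite -(big_mkord xpredT (fun i => (map_poly (tleft p) q)`_i * tright p t ^+ i)) /index_iota subn0.
  elim: (iota _ _) => [|i s IH]; first by rewrite big_nil.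
  by rewrite big_cons IH coef_map /= tcls_cons rmorphXn.
have ten0 q : ten q = 0 -> q = 0.
  move=> q0; apply/eqP; apply: contraT => qn0.
  have exm : exists m, q`_m != 0 by exists (size q).-1; rewrite -lead_coefE lead_coef_eq0.
  have [m qm mmin] := ex_minnP exm.
  have t0 : t != 0.
    apply/eqP => t0; have /trans/eqP : (map_poly p 'X).[t] = 0 by rewrite map_polyX hornerX.
    by rewrite polyX_eq0.
  (* With [m] the least index of a nonzero coefficient, the shift by [t ^- m] makes [phi] return
     exactly that coefficient. *)
  move: q0; rewrite tenE => /tcls_eq/(_ (fun x => phi (x * t ^- m)) (F_linear_mulr _ hphi)).
  rewrite /tval big_nil big_map -[size q]subn0 -/(index_iota 0 (size q)) big_mkord.
  have ms : (m < size q)%N by rewrite ltnNge; apply: contra qm => /(nth_default 0) ->.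
  rewrite (bigD1 (Ordinal ms)) //= big1 ?addr0 => [|i im].
    by rewrite mulfV ?expf_neq0 // -(expr0 t) phit mulr1 => /eqP; rewrite (negbTE qm).
  have [lt|ge] := ltnP i m.
    have -> : q`_i = 0 by apply/eqP; apply: contraLR lt => qi; rewrite -leqNgt mmin.
    by rewrite mul0r.
  have -> : t ^+ i * t ^- m = t ^+ (i - m) by rewrite -{1}(subnK ge) exprD mulfK ?expf_neq0.
  rewrite phit subn_eq0.
  have -> : (i <= m)%N = false; last by rewrite mulr0.
  by apply/negbTE; rewrite -ltnNge ltn_neqAle ge andbT eq_sym.
pose S := [set x | exists2 q : {poly E}, q != 0 & x = ten q].
have [||||M [f [fder fS]]] := @diff_quotient _ _ S (tder_derivation p).
- move=> n; exists (tleft p n.+1%:R^-1); rewrite -(rmorph_nat (tleft p)) -rmorphM mulVf ?rmorph1 //.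
  by rewrite ((pcharf0P E).1 char0).
- by exists 1; rewrite ?oner_neq0 // /ten rmorph1.
- by move=> [q q0 /esym /ten0 qq0]; move: q0; rewrite qq0 eqxx.
- by move=> x y [q q0 ->] [r r0 ->]; exists (q * r); rewrite ?mulf_neq0 // /ten rmorphM.
pose j0 : {rmorphism E -> M} := f \o tleft p.
pose s0 : {rmorphism E -> M} := f \o tright p.
have jd : {morph j0 : x / der x} by move=> x; rewrite /j0 /= -fder tder_left.
have sd : {morph s0 : x / der x} by move=> x; rewrite /s0 /= -fder tder_right.
pose j : diffMorphism E M := HB.pack (j0 : E -> M) (GRing.RMorphism.on j0) (isDiffMorphism.Build E M j0 jd).
pose sigma : diffMorphism E M := HB.pack (s0 : E -> M) (GRing.RMorphism.on s0) (isDiffMorphism.Build E M s0 sd).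
exists M, j, sigma; split=> [c|q].
  by rewrite /= tleft_right.
move=> e; apply: contrapT => q0.
have : f (ten q) = 0; last by apply/eqP/fS; exists q => //; exact/eqP.
rewrite -[RHS]e /ten poly_evalE -horner_map -map_poly_comp /=.
by congr (_.[_]); apply: eq_map_poly.
Qed.
End Functional.

(** * Iterated strongly normal extensions *)

Lemma subfield0 (M : fieldType) (N : set M) : subfield N -> N 0.
Proof. by move=> [h1 hB _]; have := hB 1 1 h1 h1; rewrite subrr in_setE. Qed.
Lemma subfieldB (M : fieldType) (N : set M) x y : subfield N -> N x -> N y -> N (x - y).
Proof. by move=> [_ hB _] Nx Ny; apply: set_mem; apply: hB; exact: mem_set. Qed.
Lemma subfieldD (M : fieldType) (N : set M) x y : subfield N -> N x -> N y -> N (x + y).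
Proof.
move=> hN Nx Ny; rewrite -[y]opprK -[- y]sub0r.
by do 2!apply: subfieldB => //; exact: subfield0.
Qed.
Lemma subfield1 (M : fieldType) (N : set M) : subfield N -> N 1.
Proof. by move=> [h1 _ _]; move: h1; rewrite in_setE. Qed.
Lemma subfield_div (M : fieldType) (N : set M) x y : subfield N -> N x -> N y -> N (x / y).
Proof. by move=> [_ _ hd] Nx Ny; apply: set_mem; apply: hd; exact: mem_set. Qed.
Lemma subfieldM (M : fieldType) (N : set M) x y : subfield N -> N x -> N y -> N (x * y).
Proof.
move=> hN Nx Ny; rewrite -[y]invrK -[y^-1]div1r.
by do 2!apply: subfield_div => //; exact: subfield1.
Qed.
Lemma subfieldX (M : fieldType) (N : set M) x n : subfield N -> N x -> N (x ^+ n).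
Proof.
by move=> hN Nx; elim: n => [|n IH]; rewrite ?expr0 ?exprS; [exact: subfield1|exact: subfieldM].
Qed.

Lemma constants_subfield (M : diffFieldType) : subfield (@constants M).
Proof.
split; rewrite ?in_setE /constants /=; first exact: drv1 (der_derivation M).
  move=> x y; rewrite !in_setE /constants /= => dx dy.
  by rewrite (drvB (der_derivation M)) dx dy subrr.
move=> x y; rewrite !in_setE /constants /= => dx dy.
by rewrite derM (drvV (der_derivation M)) dx dy oppr0 !mul0r mulr0 addr0.
Qed.

Lemma sub_smallest_subfield (M : fieldType) (A N : set M) : subfield N -> A `<=` N ->
  smallest (@subfield M) A `<=` N.
Proof. by move=> hN AN x; apply. Qed.

Lemma diff_comp_morphism (K L M : diffFieldType) (f : diffMorphism K L) (g : diffMorphism L M) :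
  exists h : diffMorphism K M, forall x, h x = g (f x).
Proof.
pose h0 : {rmorphism K -> M} := g \o f.
have hd : {morph h0 : x / der x} by move=> x; rewrite /h0 /= !morph_der.
pose h : diffMorphism K M := HB.pack (h0 : K -> M) (GRing.RMorphism.on h0) (isDiffMorphism.Build K M h0 hd).
by exists h.
Qed.

Section Tower.
Variable C : diffFieldType.
Hypotheses (closedC : GRing.closed_field_axiom C) (char0 : [pchar C] =i pred0).

Lemma char0_morph (E : fieldType) (i : {rmorphism C -> E}) : [pchar E] =i pred0.
Proof. by move=> l; rewrite -(char0 l) !inE -(rmorph_nat i) fmorph_eq0. Qed.

Lemma closed_algebraic (E : fieldType) (i : {rmorphism C -> E}) (r : {poly C}) x :
  r != 0 -> (map_poly i r).[x] = 0 -> exists c, x = i c.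
Proof.
have [n] := ubnP (size r); elim: n r => // n IH r sr r0 rx.
have [sr1|sr1] := leqP (size r) 1.
  move: rx r0; rewrite (size1_polyC sr1) map_polyC hornerC polyC_eq0 => /eqP.
  by rewrite fmorph_eq0 => ->.
have [c /factor_theorem[q rE]] := closed_root closedC sr1.
have q0 : q != 0 by apply: contraNneq r0 => q0; rewrite rE q0 mul0r.
move/eqP: rx; rewrite rE rmorphM hornerM mulf_eq0 rmorphB /= map_polyX map_polyC !hornerE subr_eq0.
move=> /orP[/eqP qx|/eqP ->]; last by exists c.
by apply: (IH q) => //; move: sr; rewrite rE size_Mmonic ?monicXsubC // size_XsubC addn2 ltnS.
Qed.

(** A constant transcendental over the previous field would be moved by a generic conjugation, which
    strong normality forbids. An algebraic one has a minimal polynomial with constant coefficients,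
    so it is algebraic over [C]. *)
Theorem isn_constants (E : diffFieldType) (i : diffMorphism C E) : iterated_strongly_normal i ->
  forall e : E, der e = 0 -> exists c, e = i c.
Proof.
elim=> {E i} [E i iT e _|L E f g i _ IH [_ _ _ sn] iE e de0].
  have [c _ <-] : range i e by rewrite iT.
  by exists c.
have [trans|] := pselect (forall q : {poly L}, (map_poly g q).[e] = 0 -> q = 0).
  have charE := char0_morph i.
  have [M [j [sigma [agree transM]]]] := generic_extension trans charE.
  have [_ _ /(_ e de0) je] := sn M j sigma agree.
  have /transM/eqP : (map_poly j ('X - e%:P)).[sigma e] = 0.
    by rewrite rmorphB /= map_polyX map_polyC !hornerE je subrr.
  by rewrite polyXsubC_eq0.
move=> /existsNP[q /not_implyP[qe /eqP q0]].
have exn : exists n, `[< exists q : {poly L}, [/\ (map_poly g q).[e] = 0, q != 0 & size q = n] >].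
  by exists (size q); apply/asboolP; exists q.
have [n /asboolP[r0 [r0e r00 sr0]] nmin] := ex_minnP exn.
have small p : (map_poly g p).[e] = 0 -> (size (p : {poly L}) < n)%N -> p = 0.
  move=> pe sp; apply/eqP; apply: contraLR sp => p0; rewrite -leqNgt nmin //.
  by apply/asboolP; exists p.
pose r := (lead_coef r0)^-1 *: r0.
have lc0 : (lead_coef r0)^-1 != 0 by rewrite invr_eq0 lead_coef_eq0.
have rm : r \is monic by rewrite monicE lead_coefZ mulVf // lead_coef_eq0.
have sr : size r = n by rewrite size_scale.
have re : (map_poly g r).[e] = 0 by rewrite map_polyZ hornerZ r0e mulr0.
have n0 : (0 < n)%N by rewrite -sr size_poly_gt0 monic_neq0.
have dL := der_derivation L; have dE := der_derivation E.
have dr : map_poly der r = 0.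
  apply: small.
    have := congr1 der re; rewrite (drv_horner dE) de0 mulr0 addr0 (drv0 dE) => h.
    rewrite -[RHS]h; congr (_.[_]); apply/polyP => l.
    by rewrite [LHS]coef_map [in LHS]coef_map_id0 ?(drv0 dL) // [RHS]coef_map_id0 ?(drv0 dE) // coef_map /= morph_der.
  rewrite -(prednK n0) ltnS; apply/leq_sizeP => l; rewrite leq_eqVlt => /orP[/eqP <-|nl].
    by rewrite coef_map_id0 ?(drv0 dL) // -sr -/(lead_coef r) (monicP rm) (drv1 dL).
  by rewrite coef_map_id0 ?(drv0 dL) // nth_default ?(drv0 dL) // sr -(prednK n0).
have /choice[c cE] l : exists c, r`_l = f c.
  by apply: IH; move/polyP: dr => /(_ l); rewrite coef_map_id0 ?(drv0 dL) // coef0.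
have rE : r = map_poly f (\poly_(l < size r) c l).
  apply/polyP => l; rewrite coef_map coef_poly; case: ltnP => lr; first by rewrite cE.
  by rewrite raddf0 nth_default.
apply: (@closed_algebraic _ i (\poly_(l < size r) c l)).
  by rewrite -(map_poly_eq0 f) -rE monic_neq0.
rewrite -[RHS]re rE -map_poly_comp; congr (_.[_]).
by rewrite -rE; apply: eq_map_poly => x; rewrite /= iE.
Qed.

(** The ambient field [H] is independent of the stage [E] of the tower, so the induction can descend
    to the step where [t] ceases to be algebraic while the conjugates are still taken of the top
    field. *)
Theorem isn_generic (E : diffFieldType) (i : diffMorphism C E) : iterated_strongly_normal i ->
  forall (H : diffFieldType) (p : diffMorphism E H) (t : H),
    (exists2 q : {poly E}, q != 0 & (map_poly p q).[t] = 0) ->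
    (forall q : {poly C}, (map_poly (p \o i) q).[t] = 0 -> q = 0) ->
  exists (M : diffFieldType) (j sigma : diffMorphism H M),
    [/\ forall c, sigma (p (i c)) = j (p (i c)),
        forall q : {poly H}, (map_poly j q).[sigma t] = 0 -> q = 0
      & exists q : {poly M}, [/\ q != 0, q.[sigma t] = 0 &
          forall l, compositum (range j) (@constants M) q`_l]].
Proof.
elim=> {E i} [E i iT|L E f g i isn IH [_ _ _ sn] iE] H p t [q q0 qt] transC.
  have /choice[c cE] (e : E) : exists c, e = i c.
    have [c _ <-] : range i e by rewrite iT.
    by exists c.
  have qE : q = map_poly i (map_poly c q).
    have c0 : c 0 = 0 by apply: (fmorph_inj i); rewrite rmorph0; exact/esym/cE.
    by apply/polyP => l; rewrite coef_map coef_map_id0 //; exact: cE.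
  have := transC (map_poly c q); rewrite map_poly_comp -qE => /(_ qt) c0.
  by move: q0; rewrite qE c0 rmorph0 eqxx.
have [pg pgE] := diff_comp_morphism g p.
have [trans|] := pselect (forall r : {poly L}, (map_poly pg r).[t] = 0 -> r = 0); last first.
  move=> /existsNP[r /not_implyP[rt /eqP r0]].
  have [||M [j [sigma [agree transM alg]]]] := IH H pg t.
  - by exists r.
  - move=> s st; apply: transC; rewrite -[RHS]st; congr (_.[_]).
    by apply: eq_map_poly => c /=; rewrite pgE iE.
  exists M, j, sigma; split=> // c; have := agree c; by rewrite pgE -iE.
have charH : [pchar H] =i pred0 by exact: (char0_morph (p \o i)).
have [M [j [sigma [agree transM]]]] := generic_extension trans charH.
exists M, j, sigma; split=> //; first by move=> c; rewrite iE -pgE agree.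
have [jp jpE] := diff_comp_morphism p j; have [sp spE] := diff_comp_morphism p sigma.
have [|EsE _ _] := sn M jp sp; first by move=> x; rewrite jpE spE -pgE agree.
exists (map_poly sp q); split; first by rewrite map_poly_eq0.
  rewrite -(rmorph0 sigma) -qt -horner_map -map_poly_comp; congr (_.[_]).
  by apply: eq_map_poly => e; rewrite /= spE.
move=> l; rewrite coef_map.
(* The conjugate of the polynomial of [t] over [E] has coefficients in [sigma E], which strong
   normality places in the compositum of [j E] with constants. *)
have : compositum (range jp) (range sp) (sp q`_l).
  by move=> N [_ hN]; apply: hN; right; exists q`_l.
rewrite EsE => h N [hN sN]; apply: h; split=> // x [[e _ <-]|[_ hx]].
  by apply: sN; left; exists (p e) => //; rewrite jpE.
by apply: sN; right.
Qed.
End Tower.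

(** * The compositum of two conjugates *)

Lemma subfield_lift (A : comNzRingType) (W M : fieldType) (inc : {rmorphism W -> M})
    (f : {rmorphism A -> M}) : (forall x, exists w, inc w = f x) ->
  exists g : {rmorphism A -> W}, forall x, inc (g x) = f x.
Proof.
move=> /choice[g gE].
have gB : zmod_morphism g by move=> x y; apply: (fmorph_inj inc); rewrite rmorphB /= !gE rmorphB.
have gM : monoid_morphism g.
  by split=> [|x y]; apply: (fmorph_inj inc); rewrite ?rmorph1 ?rmorphM /= !gE ?rmorph1 ?rmorphM.
pose h : {rmorphism A -> W} := HB.pack g (GRing.isZmodMorphism.Build A W g gB)
  (GRing.isMonoidMorphism.Build A W g gM).
by exists h.
Qed.

Lemma map_deriv_derivation (R : comNzRingType) : derivation (map_poly (@deriv R)).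
Proof.
have cE (p : {poly {poly R}}) l : (map_poly (@deriv R) p)`_l = deriv p`_l.
  by rewrite coef_map_id0 // deriv0.
split=> p q; apply/polyP => l; first by rewrite !(cE, coefD) derivD.
rewrite cE coefD !coefM raddf_sum -big_split; apply: eq_bigr => m _.
by rewrite /= derivM !cE.
Qed.

Lemma poly2_ind (R : comNzRingType) (Q : {poly {poly R}} -> Prop) :
  (forall p q, Q p -> Q q -> Q (p + q)) -> (forall p q, Q p -> Q q -> Q (p * q)) ->
  (forall c, Q c%:P%:P) -> Q 'X%:P -> Q 'X -> forall p, Q p.
Proof.
move=> QD QM QC QX QY; have Q0 : Q 0 by have := QC 0; rewrite !polyC0.
elim/poly_ind=> [|p c IH] //; apply: (QD); first exact: QM.
elim/poly_ind: c => [|q c IHc]; first by rewrite polyC0.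
by rewrite polyCD polyCM; apply: (QD) => //; exact: QM.
Qed.

Section TwoVariables.
Variables (R : comNzRingType) (M : comNzRingType) (f : {rmorphism R -> M}) (x y : M).
Definition eval2 : {poly {poly R}} -> M := poly_eval (poly_eval f x) y.
HB.instance Definition _ := GRing.RMorphism.copy eval2 (poly_eval (poly_eval f x) y).
Arguments eval2 : simpl never.

Lemma eval2C c : eval2 c%:P%:P = f c.
Proof. by rewrite /eval2 poly_evalC /= poly_evalC. Qed.
Lemma eval2X : eval2 'X%:P = x.
Proof. by rewrite /eval2 poly_evalC /= poly_evalX. Qed.
Lemma eval2Y : eval2 'X = y.
Proof. by rewrite /eval2 poly_evalX. Qed.
Lemma eval2D p q : eval2 (p + q) = eval2 p + eval2 q. Proof. exact: rmorphD. Qed.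
Lemma eval2B p q : eval2 (p - q) = eval2 p - eval2 q. Proof. exact: rmorphB. Qed.
Lemma eval2M p q : eval2 (p * q) = eval2 p * eval2 q. Proof. exact: rmorphM. Qed.
Lemma eval2_0 : eval2 0 = 0. Proof. exact: rmorph0. Qed.
Lemma eval2_1 : eval2 1 = 1. Proof. exact: rmorph1. Qed.
Lemma eval2_ind (Q : M -> Prop) : (forall u v, Q u -> Q v -> Q (u + v)) ->
  (forall u v, Q u -> Q v -> Q (u * v)) -> (forall c, Q (f c)) -> Q x -> Q y ->
  forall p, Q (eval2 p).
Proof.
move=> QD QM Qf Qx Qy; apply: poly2_ind => [p q|p q|c||]; rewrite ?rmorphD ?rmorphM /=.
- exact: QD.
- exact: QM.
- by rewrite eval2C.
- by rewrite eval2X.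
- by rewrite eval2Y.
Qed.

(** The chain rule with prescribed values at [x] and [y] and no contribution of the coefficients:
    the candidate for the [E]-linear derivation before it is known to respect relations. *)
Definition drv2 (x' y' : M) (p : {poly {poly R}}) : M :=
  eval2 (map_poly (@deriv R) p) * x' + eval2 p^`() * y'.
Lemma drv2D x' y' p q : drv2 x' y' (p + q) = drv2 x' y' p + drv2 x' y' q.
Proof.
rewrite /drv2 (drvD (map_deriv_derivation R)) derivD !rmorphD /=; ring.
Qed.
Lemma drv2M x' y' p q : drv2 x' y' (p * q) = drv2 x' y' p * eval2 q + eval2 p * drv2 x' y' q.
Proof.
rewrite /drv2 (drvM (map_deriv_derivation R)) derivM !rmorphD !rmorphM /=; ring.
Qed.
Lemma drv2C x' y' c : drv2 x' y' c%:P%:P = 0.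
Proof.
rewrite /drv2 map_polyC /= !derivC !rmorph0; ring.
Qed.
Lemma drv2X x' y' : drv2 x' y' 'X%:P = x'.
Proof.
by rewrite /drv2 map_polyC /= derivX derivC eval2C rmorph1 rmorph0; ring.
Qed.
Lemma drv2Y x' y' : drv2 x' y' 'X = y'.
Proof.
rewrite /drv2 derivX rmorph1.
have -> : map_poly (@deriv R) 'X = 0.
  apply/polyP => l; rewrite coef_map_id0 ?deriv0 // coefX coef0.
  by case: eqP; rewrite ?deriv0 // -(derivC 1).
by rewrite rmorph0; ring.
Qed.
Lemma drv2_ind (d : M -> M) : derivation d -> (forall c, d (f c) = 0) ->
  forall p, d (eval2 p) = drv2 (d x) (d y) p.
Proof.
move=> dD df; apply: poly2_ind => [p q|p q|c||].
- by rewrite rmorphD /= (drvD dD) drv2D => -> ->.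
- by rewrite rmorphM /= (drvM dD) drv2M => -> ->.
- by rewrite eval2C df drv2C.
- by rewrite eval2X drv2X.
- by rewrite eval2Y drv2Y.
Qed.
End TwoVariables.
Arguments eval2 : simpl never.

Lemma eval2_map (R R' M : comNzRingType) (h : {rmorphism R -> R'}) (f : {rmorphism R' -> M}) x y p :
  eval2 f x y (map_poly (map_poly h) p) = eval2 (f \o h) x y p.
Proof.
rewrite /eval2 !poly_evalE -map_poly_comp; congr (_.[_]); apply: eq_map_poly => q /=.
by rewrite !poly_evalE -map_poly_comp.
Qed.

Lemma eval2_morph (R M M' : comNzRingType) (f : {rmorphism R -> M}) (h : {rmorphism M -> M'}) x y p :
  h (eval2 f x y p) = eval2 (h \o f) (h x) (h y) p.
Proof.
rewrite /eval2 !poly_evalE -horner_map -map_poly_comp; congr (_.[_]); apply: eq_map_poly => q /=.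
by rewrite !poly_evalE -horner_map -map_poly_comp.
Qed.

(** * The differential field generated by [t] over [C] *)

Section RationalExtension.
Variables (C E : diffFieldType) (i : diffMorphism C E).
Hypotheses (derC : forall c : C, der c = 0) (char0 : [pchar C] =i pred0).
Variable t : E.
Hypothesis transt : forall q : {poly C}, (map_poly i q).[t] = 0 -> q = 0.
Local Notation y := (der t).
Local Notation ct := (poly_eval i t).
Hypothesis algy : exists2 g : {poly {poly C}}, g != 0 & eval2 i t y g = 0.

Lemma ct_inj : injective ct.
Proof.
move=> p q pq; apply/eqP; rewrite -subr_eq0; apply/eqP/transt.
by rewrite -poly_evalE rmorphB /= pq subrr.
Qed.
Lemma ct_eq0 p : (ct p == 0) = (p == 0). Proof. exact: ev_eq0 ct_inj p. Qed.

Lemma der_i c : der (i c) = 0. Proof. by rewrite -morph_der derC rmorph0. Qed.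
Lemma char0C : forall n, (n.+1%:R : C) != 0.
Proof. by move=> n; rewrite ((pcharf0P C).1 char0). Qed.

(** In characteristic 0 a relation of least degree in [y] is separable, so implicit differentiation
    determines the derivative of [y]. *)
Lemma minimal_relation : exists n (g : {poly {poly C}}),
  [/\ (0 < n)%N, size g = n.+1, eval2 i t y g = 0,
      forall p, eval2 i t y p = 0 -> (size p <= n)%N -> p = 0 & eval2 i t y g^`() != 0].
Proof.
have [g0 g00 g0y] := algy.
have exn : exists n, `[< exists q : {poly {poly C}}, [/\ eval2 i t y q = 0, q != 0 & size q = n] >].
  by exists (size g0); apply/asboolP; exists g0.
have [n /asboolP[g [gy gn0 sg]] nmin] := ex_minnP exn.
have small p : eval2 i t y p = 0 -> (size (p : {poly {poly C}}) < n)%N -> p = 0.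
  move=> pe sp; apply/eqP; apply: contraLR sp => p0; rewrite -leqNgt nmin //.
  by apply/asboolP; exists p.
have n1 : (1 < n)%N.
  rewrite -sg ltnNge; apply/negP => /size1_polyC gC.
  move: gy gn0; rewrite gC /eval2 poly_evalC polyC_eq0 => /eqP.
  by rewrite ct_eq0 => ->.
exists n.-1, g; split.
- by case: n n1 {exn sg nmin small} => [|[]].
- by rewrite prednK // (ltn_trans _ n1).
- by [].
- by move=> p pe sp; apply: small => //; rewrite -(prednK (ltn_trans (ltnSn 0) n1)) ltnS.
apply: contraTneq isT => gy'0.
have /small g'0 : eval2 i t y g^`() = 0 by [].
have {}g'0 : g^`() = 0 by apply: g'0; rewrite -sg lt_size_deriv.
have := congr1 (fun p : {poly {poly C}} => p`_n.-2) g'0.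
rewrite coef0 coef_deriv.
have -> : n.-2.+1 = n.-1 by case: n n1 {exn sg nmin small} => [|[]].
move=> /eqP; rewrite -sg -/(lead_coef g) -mulr_natl mulf_eq0 lead_coef_eq0 (negbTE gn0) orbF.
rewrite -polyC_natr polyC_eq0 sg.
by case: (n) n1 => [|[|m]] // _; rewrite /= (negbTE (char0C m)).
Qed.

Lemma der_eval2 p : der (eval2 i t y p) = drv2 i t y y (der y) p.
Proof. exact: (drv2_ind t y (der_derivation E) der_i). Qed.

Section Span.
Variables (n : nat) (g : {poly {poly C}}).
Hypotheses (n0 : (0 < n)%N) (sg : size g = n.+1) (gy : eval2 i t y g = 0).
Hypothesis small : forall p, eval2 i t y p = 0 -> (size p <= n)%N -> p = 0.
Hypothesis g'y : eval2 i t y g^`() != 0.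
Variables (k : fieldType) (io : {rmorphism k -> E}).
Hypothesis ioP : forall w, frac_image ct w <-> exists c, io c = w.

Definition ybas (j : 'I_n) : E := y ^+ j.
Local Notation span := (in_span io ybas).

Lemma io_ct p : exists c, io c = ct p.
Proof. exact: frac_image_ev ioP p. Qed.

Lemma eval2_poly (P : 'I_n -> {poly C}) :
  eval2 i t y (\poly_(j < n) (if insub j is Some j' then P j' else 0)) = \sum_j ct (P j) * y ^+ j.
Proof.
rewrite /eval2 poly_evalE (horner_coef_wide _ (n := n)); last first.
  by rewrite map_polyE (leq_trans (size_Poly _)) // size_map size_poly.
by apply: eq_bigr => j _; rewrite coef_map coef_poly ltn_ord valK.
Qed.

Lemma ybas_free (P : 'I_n -> {poly C}) : \sum_j ct (P j) * y ^+ j = 0 -> forall j, P j = 0.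
Proof.
rewrite -eval2_poly => /small /(_ (size_poly _ _)) /polyP P0 j.
by have := P0 j; rewrite coef_poly ltn_ord valK coef0.
Qed.

Lemma ybas_indep (c : 'rV[k]_n) : lincomb io ybas c = 0 -> c = 0.
Proof.
move=> rel; have [P [Q [Q0 cE]]] := common_denominator ct_inj ioP (fun j => c 0 j).
have Pz : forall j, P j = 0.
  apply: ybas_free; transitivity (ct Q * lincomb io ybas c); last by rewrite rel mulr0.
  rewrite mulr_sumr; apply: eq_bigr => j _; rewrite cE /= /ybas; field.
  by rewrite ct_eq0.
apply/rowP => j; apply: (fmorph_inj io); rewrite mxE rmorph0 cE Pz.
by rewrite rmorph0 mul0r.
Qed.

Lemma span_yX m : (m < n)%N -> span (y ^+ m).
Proof. by move=> mn; exact: (in_span_basis io ybas (Ordinal mn)). Qed.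
Lemma span1y : span 1. Proof. by have := span_yX n0; rewrite expr0. Qed.

Lemma span_yn : span (y ^+ n).
Proof.
have ln : g`_n != 0.
  have : lead_coef g != 0 by rewrite lead_coef_eq0; apply: contra_eq_neq sg => ->; rewrite size_poly0.
  by rewrite lead_coefE sg.
have e : ct g`_n * y ^+ n = - \sum_(j < n) ct g`_j * y ^+ j.
  apply/eqP; rewrite -addr_eq0 addrC -[X in _ == X]gy /eval2 [poly_eval _ y _]poly_evalE.
  rewrite (horner_coef_wide _ (n := n.+1)); last first.
    by rewrite -sg map_polyE (leq_trans (size_Poly _)) // size_map.
  rewrite big_ord_recr /= coef_map; apply/eqP; congr (_ + _).
  by apply: eq_bigr => j _; rewrite coef_map.
have [c cE] := io_ct g`_n.
have -> : y ^+ n = io c^-1 * - \sum_(j < n) ct g`_j * y ^+ j.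
  by rewrite -e fmorphV cE mulKf // ct_eq0.
apply/in_spanZ/in_spanN/in_span_sum => j _.
by have [c' <-] := io_ct g`_j; apply/in_spanZ/span_yX.
Qed.

Lemma span_mulY u : span u -> span (y * u).
Proof.
move=> [c ->]; rewrite mulr_sumr; apply: in_span_sum => j _.
rewrite mulrCA; apply: in_spanZ; rewrite /ybas -exprS.
have := ltn_ord j; rewrite leq_eqVlt => /orP[/eqP ->|]; [exact: span_yn | exact: span_yX].
Qed.

Lemma ybas_spanM j l : span (ybas j * ybas l).
Proof.
rewrite /ybas; elim: (j : nat) => [|m IH]; first by rewrite expr0 mul1r; exact: in_span_basis.
by rewrite exprS -mulrA; exact: span_mulY.
Qed.

Lemma spanyM u v : span u -> span v -> span (u * v).
Proof. exact: (in_spanM ybas_spanM). Qed.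
Lemma spanyV u : span u -> span u^-1.
Proof. exact: (in_spanV ybas_indep span1y ybas_spanM). Qed.
Lemma span_ct p : span (ct p).
Proof. by have [c <-] := io_ct p; rewrite -[io c]mulr1; apply/in_spanZ/span1y. Qed.
Lemma span_t : span t. Proof. by have := span_ct 'X; rewrite poly_evalX. Qed.
Lemma span_y : span y.
Proof. by rewrite -[y]mulr1; apply/span_mulY/span1y. Qed.
Lemma span_i c : span (i c). Proof. by have := span_ct c%:P; rewrite poly_evalC. Qed.
Lemma span_eval2 p : span (eval2 i t y p).
Proof.
apply: eval2_ind => [u v|u v|c||]; [exact: in_spanD | exact: spanyM | exact: span_i |
  exact: span_t | exact: span_y].
Qed.
Lemma span_subfield : subfield span.
Proof.
split; first by rewrite in_setE; exact: span1y.
  move=> u v; rewrite !in_setE => hu hv; apply: in_spanD => //; exact: in_spanN.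
by move=> u v; rewrite !in_setE => hu hv; apply: spanyM => //; exact: spanyV.
Qed.

Lemma span_dery : span (der y).
Proof.
have e : eval2 i t y (map_poly (@deriv C) g) * y + eval2 i t y g^`() * der y = 0.
  by rewrite -[LHS]/(drv2 i t y y (der y) g) -der_eval2 gy (drv0 (der_derivation E)).
have -> : der y = - (eval2 i t y (map_poly (@deriv C) g) * y) / eval2 i t y g^`().
  by apply: (canRL (mulfK g'y)); apply/eqP; rewrite -addr_eq0 addrC [der y * _]mulrC e.
apply: spanyM; last exact/spanyV/span_eval2.
by apply/in_spanN/spanyM; [exact: span_eval2 | exact: span_y].
Qed.

Lemma span_frac u : span u -> exists p q, eval2 i t y q != 0 /\ u = eval2 i t y p / eval2 i t y q.
Proof.
move=> [c ->]; have [P [Q [Q0 cE]]] := common_denominator ct_inj ioP (fun j => c 0 j).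
exists (\poly_(j < n) (if insub j is Some j' then P j' else 0)), Q%:P.
have eQ : eval2 i t y Q%:P = ct Q by rewrite /eval2 poly_evalC.
rewrite eQ ct_eq0; split=> //; rewrite eval2_poly mulr_suml; apply: eq_bigr => j _.
by rewrite cE /ybas mulrAC.
Qed.

Lemma span_der u : span u -> span (der u).
Proof.
have dp p : span (der (eval2 i t y p)).
  rewrite der_eval2; apply: in_spanD; apply: spanyM; try exact: span_eval2.
    exact: span_y.
  exact: span_dery.
move=> /span_frac[p [q [q0 ->]]]; rewrite (drv_div (der_derivation E)) //.
apply: spanyM; last by apply: spanyV; rewrite expr2; apply: spanyM; exact: span_eval2.
by apply: in_spanD; [|apply: in_spanN]; apply: spanyM => //; exact: span_eval2.
Qed.
End Span.

(** Passing to the field generated by [t] and [t'] provides an explicit basis over [C(t)], the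
    powers of [t'] below the degree of its minimal relation. *)
Theorem rational_extension : exists (K : fieldType) (v : {rmorphism K -> E})
    (iK : {rmorphism C -> K}) (dK : K -> K) (tK : K) n (bas : 'I_n -> K) (g : {poly {poly C}}),
  [/\ [/\ forall c, v (iK c) = i c, forall x, v (dK x) = der (v x) & v tK = t],
      finite_over_rational iK tK bas,
      forall x, exists p q, eval2 i t y q != 0 /\ v x = eval2 i t y p / eval2 i t y q
    & eval2 i t y g = 0 /\ eval2 i t y g^`() != 0].
Proof.
have [n [g [n0 sg gy small g'y]]] := minimal_relation.
have [k [io ioP]] := subfield_type_sub (frac_image_subfield ct_inj).
have [K [v vP]] := subfield_type_sub (span_subfield n0 sg gy small ioP).
have [iK iKE] : exists iK : {rmorphism C -> K}, forall c, v (iK c) = i c.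
  by apply: subfield_lift => c; apply/vP; exact: (span_i n0).
have /choice[dK dKE] x : exists x', v x' = der (v x).
  by apply/vP; apply: (span_der n0 sg gy small g'y ioP); apply/vP; exists x.
have [tK tKE] : exists x, v x = t by apply/vP; exact: (span_t n0).
have /choice[bas basE] (j : 'I_n) : exists x, v x = ybas j.
  by apply/vP; exact: in_span_basis.
have evK q : v (map_poly iK q).[tK] = ct q.
  by rewrite -horner_map -map_poly_comp tKE poly_evalE; congr (_.[_]); apply: eq_map_poly.
exists K, v, iK, dK, tK, n, bas, g; split=> //; last first.
  by move=> x; apply: (span_frac ioP); apply/vP; exists x.
split=> [x|P Prel].
  have [c cE] : in_span io (@ybas n) (v x) by apply/vP; exists x.
  have [P [Q [Q0 cQ]]] := common_denominator ct_inj ioP (fun j => c 0 j).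
  exists P, Q; split=> //; apply: (fmorph_inj v).
  rewrite rmorphM evK cE rmorph_sum /lincomb mulr_suml; apply: eq_bigr => j _.
  rewrite rmorphM /= evK basE cQ; field; by rewrite ct_eq0.
apply: (ybas_free small); rewrite -[RHS](rmorph0 v) -Prel rmorph_sum.
by apply: eq_bigr => j _; rewrite rmorphM /= evK basE.
Qed.
End RationalExtension.

Lemma ratio_subfield (A : comNzRingType) (M : fieldType) (ev : {rmorphism A -> M}) :
  subfield [set w | exists u v, ev v != 0 /\ w = ev u / ev v].
Proof.
split; rewrite ?in_setE.
- by exists 1, 1; rewrite rmorph1 oner_neq0 divr1.
- move=> w w'; rewrite !in_setE => -[u [v [v0 ->]]] [u' [v' [v'0 ->]]].
  exists (u * v' - u' * v), (v * v'); rewrite rmorphM mulf_neq0 //; split=> //.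
  by rewrite rmorphB !rmorphM /=; field; rewrite v0 v'0.
- move=> w w'; rewrite !in_setE => -[u [v [v0 ->]]] [u' [v' [v'0 ->]]].
  have [u'0|u'0] := eqVneq (ev u') 0.
    by exists 0, 1; rewrite u'0 rmorph1 rmorph0 oner_neq0 !mul0r invr0 mulr0.
  exists (u * v'), (v * u'); rewrite rmorphM mulf_neq0 //; split=> //.
  by rewrite !rmorphM /=; field; rewrite v0 v'0 u'0.
Qed.

Lemma derivation_comp_zero (K E W : fieldType) (a : {rmorphism E -> W}) (b : {rmorphism K -> W})
    (d : W -> W) : derivation d -> (forall e, d (a e) = 0) -> (forall x, d (b x) = 0) ->
  (forall w, comp_frac a b w) -> forall w, d w = 0.
Proof.
move=> dD da db fr w; have [u [v [[s ->] [s' ->] v0 ->]]] := fr w.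
have d0 r : d (comp_sum a b r) = 0.
  rewrite /comp_sum (drv_sum dD) big1 // => p _.
  by rewrite (drvM dD) da db mul0r mulr0 addr0.
by rewrite (drv_div dD) // !d0 mul0r mulr0 subr0 mul0r.
Qed.

(** * The two derivations on the compositum *)

Section GenericPoint.
Variables (C E M : diffFieldType) (i : diffMorphism C E) (j sigma : diffMorphism E M).
Hypotheses (closedC : GRing.closed_field_axiom C) (char0 : [pchar C] =i pred0).
Hypotheses (derC : forall c : C, der c = 0) (constE : forall e : E, der e = 0 -> exists c, e = i c).
Hypothesis agree : forall c, sigma (i c) = j (i c).
Variable t : E.
Hypothesis transM : forall q : {poly E}, (map_poly j q).[sigma t] = 0 -> q = 0.
Local Notation y := (der t).

Variables (K : fieldType) (v : {rmorphism K -> E}) (iK : {rmorphism C -> K}) (dK : K -> K) (tK : K).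
Hypotheses (v_iK : forall c, v (iK c) = i c) (v_dK : forall x, v (dK x) = der (v x)) (v_t : v tK = t).
Hypothesis v_frac : forall x, exists p q, eval2 i t y q != 0 /\ v x = eval2 i t y p / eval2 i t y q.
Variable g : {poly {poly C}}.
Hypotheses (gy : eval2 i t y g = 0) (g'y : eval2 i t y g^`() != 0).

Local Notation ev := (eval2 j (sigma t) (sigma y)).
Local Notation dev := (drv2 j (sigma t) (sigma y) (sigma y) (sigma (der y))).
Local Notation lift := (map_poly (map_poly i)).

Lemma ev_lift p : ev (lift p) = sigma (eval2 i t y p).
Proof.
rewrite eval2_map eval2_morph /eval2 !poly_evalE; congr (_.[_]); apply: eq_map_poly => q.
by rewrite /= !poly_evalE; congr (_.[_]); apply: eq_map_poly => c /=; rewrite agree.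
Qed.

Lemma dev_lift p : dev (lift p) = sigma (der (eval2 i t y p)).
Proof.
rewrite (der_eval2 i derC) /drv2 rmorphD !rmorphM /= -!ev_lift deriv_map; congr (ev _ * _ + _).
apply/polyP => l; rewrite coef_map_id0 ?deriv0 // !coef_map /=.
by rewrite deriv_map.
Qed.

Lemma ev_polyC_eq0 (q : {poly E}) : (ev q%:P == 0) = (q == 0).
Proof.
have e : ev q%:P = (map_poly j q).[sigma t] by rewrite /eval2 poly_evalC.
apply/eqP/eqP => [|->]; first by rewrite e => /transM.
by rewrite polyC0 eval2_0.
Qed.

(* A relation of least degree in [y] between the conjugates of [t] and [y] over [E] divides
   [g], which has no double root at [y]; hence [dev] kills it as it kills [g]. *)
Lemma dev_ker p : ev p = 0 -> dev p = 0.
Proof.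
have exn : exists n, `[< exists q : {poly {poly E}}, [/\ ev q = 0, q != 0 & size q = n] >].
  exists (size (lift g)); apply/asboolP; exists (lift g); split=> //.
    by rewrite ev_lift gy rmorph0.
  by apply: contraNneq g'y => lg0; rewrite -(fmorph_eq0 sigma) /= -ev_lift -deriv_map lg0 deriv0 eval2_0.
have [n /asboolP[q0 [q0e q00 sq0]] nmin] := ex_minnP exn.
have small r : ev r = 0 -> (size (r : {poly {poly E}}) < size q0)%N -> r = 0.
  rewrite sq0 => re sr; apply/eqP; apply: contraLR sr => r0; rewrite -leqNgt nmin //.
  by apply/asboolP; exists r.
have l0 k : ev (lead_coef q0 ^+ k)%:P != 0.
  by rewrite ev_polyC_eq0 expf_neq0 // lead_coef_eq0.
have divide r : ev r = 0 -> exists k s, (lead_coef q0 ^+ k)%:P * r = s * q0.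
  move=> re; have [k [s [u [e su]]]] := pseudo_division r q00.
  exists k, s; rewrite mul_polyC e (small u) ?addr0 //.
  have -> : u = (lead_coef q0 ^+ k)%:P * r - s * q0 by rewrite mul_polyC e addrC addKr.
  by rewrite eval2B !eval2M re q0e !mulr0 subrr.
have dq0 : dev q0 = 0.
  have [k [s e]] := divide (lift g) (etrans (ev_lift g) (etrans (congr1 sigma gy) (rmorph0 sigma))).
  have ge : ev (lift g) = 0 by rewrite ev_lift gy rmorph0.
  have dge : dev (lift g) = 0 by rewrite dev_lift gy (drv0 (der_derivation E)) rmorph0.
  have /eqP := congr1 dev e; rewrite !drv2M ge dge q0e !mulr0 !add0r eq_sym mulf_eq0 => /orP[/eqP se|/eqP //].
  have := congr1 (fun p => ev p^`()) e.
  rewrite !derivM !eval2D !eval2M derivC eval2_0 ge q0e se !mulr0 !mul0r !add0r deriv_map.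
  move=> /eqP; rewrite mulf_eq0 (negbTE (l0 k)) /= ev_lift fmorph_eq0.
  by rewrite (negbTE g'y).
move=> /[dup] pe /divide[k [s e]].
have /eqP := congr1 dev e; rewrite !drv2M pe q0e dq0 !mulr0 !add0r.
by rewrite mulf_eq0 (negbTE (l0 k)) => /eqP.
Qed.

(** [W] is the field generated by [j E] and the conjugates of [t] and [t']. It is closed under the
    derivation of [M], which gives [D], while [dev] passes to fractions by [dev_ker], which gives
    [d]. *)
Theorem bidifferential_extension : exists (W : fieldType) (inc : {rmorphism W -> M})
    (a : {rmorphism E -> W}) (b : {rmorphism K -> W}) (D d : W -> W),
  [/\ forall e, inc (a e) = j e, forall x, inc (b x) = sigma (v x),
      forall w, inc (D w) = der (inc w) & bidifferential iK i a b dK der D d].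
Proof.
pose N := [set w | exists u v, ev v != 0 /\ w = ev u / ev v].
have hN : subfield N := ratio_subfield _.
have [W [inc incP]] := subfield_type_sub hN.
have Nev p : N (ev p) by exists p, 1; rewrite eval2_1 oner_neq0 divr1.
have Nv x : N (sigma (v x)).
  have [p [q [q0 ->]]] := v_frac x; exists (lift p), (lift q).
  by rewrite !ev_lift fmorph_div fmorph_eq0.
have yE : y = v (dK tK) by rewrite v_dK v_t.
have y'E : der y = v (dK (dK tK)) by rewrite v_dK -yE.
have [evW evWE] : exists f : {rmorphism {poly {poly E}} -> W}, forall p, inc (f p) = ev p.
  by apply: subfield_lift => p; apply/incP; exact: Nev.
have [b bE] : exists b : {rmorphism K -> W}, forall x, inc (b x) = sigma (v x).
  by apply: (subfield_lift (f := sigma \o v)) => x; apply/incP/Nv.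
have [a aE] : exists a : {rmorphism E -> W}, forall e, inc (a e) = j e.
  by apply: subfield_lift => e; apply/incP; rewrite -(eval2C j (sigma t) (sigma y)); exact: Nev.
have Nder w : N w -> N (der w).
  have Nd p : N (ev p) /\ N (der (ev p)).
    apply: (@eval2_ind _ _ j (sigma t) (sigma y) (fun w => N w /\ N (der w))) => [z1 z2 [N1 N1'] [N2 N2']|z1 z2 [N1 N1'] [N2 N2']|c||].
    - by rewrite derD; split; exact: subfieldD.
    - by rewrite derM; split; [exact: subfieldM | apply: subfieldD => //; exact: subfieldM].
    - by rewrite -morph_der -!(eval2C j (sigma t) (sigma y)); split; exact: Nev.
    - by rewrite -morph_der yE -v_t; split; exact: Nv.
    - by rewrite -morph_der y'E yE; split; exact: Nv.
  move=> [p [q [q0 ->]]]; rewrite (drv_div (der_derivation M)) //.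
  apply: subfield_div => //; last by apply: subfieldX; have [] := Nd q.
  by apply: subfieldB => //; apply: subfieldM; have [] := Nd p; have [] := Nd q.
have /choice[D DE] w : exists w', inc w' = der (inc w) by apply/incP/Nder/incP; exists w.
have DD : derivation D.
  split=> z1 z2; apply: (fmorph_inj inc); first by rewrite rmorphD /= !DE rmorphD derD.
  by rewrite rmorphD !rmorphM /= !DE rmorphM derM.
have /choice[de deE] p : exists w, inc w = dev p.
  apply/incP; apply: subfieldD => //; apply: subfieldM => //; try exact: Nev.
    by rewrite yE; exact: Nv.
  by rewrite y'E; exact: Nv.
have fracW w : exists p q, evW q != 0 /\ w = evW p / evW q.
  have [p [q [q0 e]]] : N (inc w) by apply/incP; exists w.
  exists p, q; rewrite -(fmorph_eq0 inc) evWE; split=> //.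
  by apply: (fmorph_inj inc); rewrite fmorph_div /= !evWE.
have [|||d [dD dE]] := @extend_derivation _ _ evW de _ _ _ fracW.
- by move=> p q; apply: (fmorph_inj inc); rewrite rmorphD /= !deE drv2D.
- by move=> p q; apply: (fmorph_inj inc); rewrite rmorphD !rmorphM /= !deE !evWE drv2M.
- move=> p pe; apply: (fmorph_inj inc); rewrite deE rmorph0 dev_ker //.
  by rewrite -evWE pe rmorph0.
have aev e : a e = evW e%:P%:P by apply: (fmorph_inj inc); rewrite aE evWE eval2C.
have da e : d (a e) = 0.
  by rewrite aev dE; apply: (fmorph_inj inc); rewrite deE drv2C rmorph0.
have Da e : D (a e) = a (der e) by apply: (fmorph_inj inc); rewrite DE !aE morph_der.
have Db x : D (b x) = b (dK x).
  by apply: (fmorph_inj inc); rewrite DE !bE -morph_der v_dK.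
have db x : d (b x) = b (dK x).
  rewrite -Db; apply/eqP; rewrite -subr_eq0; apply/eqP.
  have [p [q [q0 vx]]] := v_frac x.
  have bx : b x = evW (lift p) / evW (lift q).
    by apply: (fmorph_inj inc); rewrite bE fmorph_div /= !evWE !ev_lift vx fmorph_div.
  have same r : d (evW (lift r)) = D (evW (lift r)).
    by rewrite dE; apply: (fmorph_inj inc); rewrite deE DE evWE dev_lift ev_lift morph_der.
  have q0' : evW (lift q) != 0 by rewrite -(fmorph_eq0 inc) evWE ev_lift fmorph_eq0.
  by rewrite bx (drv_div dD) // (drv_div DD) // !same subrr.
have fr w : comp_frac a b w.
  have cr p : comp_ring a b (evW p).
    apply: (@poly2_ind _ (fun p => comp_ring a b (evW p))) => [p1 q1|p1 q1|c||].
    - by rewrite rmorphD; exact: comp_ringD.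
    - by rewrite rmorphM; exact: comp_ringM.
    - by rewrite -aev; exact: comp_ringl.
    - have -> : evW 'X%:P = b tK; last exact: comp_ringr.
      by apply: (fmorph_inj inc); rewrite evWE bE eval2X v_t.
    - have -> : evW 'X = b (dK tK); last exact: comp_ringr.
      by apply: (fmorph_inj inc); rewrite evWE bE eval2Y yE.
  by have [p [q [q0 ->]]] := fracW w; exists (evW p), (evW q); split.
exists W, inc, a, b, D, d; split=> //; split=> //.
- by move=> c; apply: (fmorph_inj inc); rewrite aE bE v_iK agree.
(* The commutator of [D] and [d] is a derivation that vanishes on both [E] and [K], hence on their
   compositum. *)
- move=> w; apply/eqP; rewrite -subr_eq0; apply/eqP.
  apply: (@derivation_comp_zero _ _ _ a b (fun w => D (d w) - d (D w))) w => //.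
  + split=> z1 z2; first by rewrite !(drvD dD, drvD DD); ring.
    by rewrite !(drvM dD, drvM DD, drvD dD, drvD DD); ring.
  + by move=> e; rewrite da Da da (drv0 DD) subrr.
  + by move=> x; rewrite db !Db db subrr.
- move=> x dx; have [|c xc] := constE (e := v x); first by rewrite -v_dK dx rmorph0.
  by exists c; apply: (fmorph_inj v); rewrite v_iK.
Qed.
End GenericPoint.

(** * A constant outside [C] in the compositum *)

Section NewConstant.
Variables (C E M K W : fieldType) (iK : {rmorphism C -> K}) (iE : {rmorphism C -> E}).
Variables (a : {rmorphism E -> W}) (b : {rmorphism K -> W}) (D : W -> W).
Variables (inc : {rmorphism W -> M}) (dM : M -> M) (tK : K).
Hypotheses (dMD : derivation dM) (incD : forall w, inc (D w) = dM (inc w)).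
Hypotheses (transT : forall p : {poly E}, (map_poly a p).[b tK] = 0 -> p = 0).
Hypothesis constE : forall c, dM (inc (a (iE c))) = 0.
Variables (Kc : fieldType) (ic : {rmorphism Kc -> M}).
Hypothesis icP : forall x, dM x = 0 <-> exists c, ic c = x.

(** If [D] had no constants beyond [C], the field [W] and the constants of [M] would be linearly
    disjoint over [C]. The relation [q] would then split into relations over [E] alone, against
    transcendence. *)
Lemma new_constant (q : {poly M}) : q != 0 -> q.[inc (b tK)] = 0 ->
  (forall l, comp_frac (inc \o a) ic q`_l) -> exists c, D c = 0 /\ ~ is_const iE a c.
Proof.
move=> q0 qt qF; apply: contrapT => noc.
have constW w : D w = 0 -> exists c, w = cst iE a c.
  by move=> Dw; apply: contrapT => wC; apply: noc; exists w.
have [r [_ r0 rq]] := comp_common_denominator (fun l : 'I_(size q) => qF l).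
have /choice[s sE] (l : 'I_(size q)) : exists s, r * q`_l = comp_sum (inc \o a) ic s by exact: rq.
have [iKc iKcE] : exists f : {rmorphism C -> Kc}, forall c, ic (f c) = inc (a (iE c)).
  by apply: (subfield_lift (f := inc \o a \o iE)) => c; apply/icP/constE.
pose S := flatten (codom s).
have [m [y [T [xE free]]]] := const_free_span iKc (fun l : 'I_(size S) => (nth (0, 0) S l).2).
have coords p : p \in S -> exists r : 'I_m -> C, p.2 = \sum_j iKc (r j) * y j.
  move=> /(nthP (0, 0))[l si <-]; exists (T (Ordinal si)); exact: (xE (Ordinal si)).
have ab c : (inc \o a) (iE c) = ic (iKc c) by rewrite iKcE.
have /choice[U UE] (l : 'I_(size q)) : exists U : 'I_m -> E, r * q`_l = \sum_j inc (a (U j)) * ic (y j).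
  rewrite sE; apply: (comp_sum_coords ab) => p ps; apply: coords.
  by apply/flattenP; exists (s l) => //; exact: codom_f.
(* The component of the relation along the constant [y k], an element of [W]. *)
pose x (k : 'I_m) := (map_poly a (\poly_(l < size q) (if insub l is Some l' then U l' k else 0))).[b tK].
have rel : \sum_k ic (y k) * inc (x k) = 0.
  transitivity (r * q.[inc (b tK)]); last by rewrite qt mulr0.
  rewrite horner_coef mulr_sumr.
  under [RHS]eq_bigr => l _ do rewrite mulrA UE mulr_suml.
  rewrite exchange_big; apply: eq_bigr => k _.
  rewrite /x (horner_coef_wide _ (n := size q)); last first.
    by rewrite map_polyE (leq_trans (size_Poly _)) // size_map size_poly.
  rewrite rmorph_sum mulr_sumr; apply: eq_bigr => l _.
  by rewrite coef_map coef_poly ltn_ord valK rmorphM rmorphXn /=; ring.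
have [k0 xk0] : exists k, x k != 0.
  apply: contrapT => x0; move/eqP: q0; apply; apply/polyP => l; rewrite coef0.
  have [lq|ql] := ltnP l (size q); last exact: nth_default.
  apply: (mulfI r0); rewrite mulr0 (UE (Ordinal lq)) big1 // => k _.
  have xk : x k = 0 by apply/eqP; apply: contraT => xk; case: x0; exists k.
  have := transT xk => /polyP/(_ l); rewrite coef_poly lq coef0.
  have -> : insub l = Some (Ordinal lq) by rewrite insubT.
  by move=> ->; rewrite !rmorph0 mul0r.
have [||||c [k ck] crel] := @constants_disjoint_fin C W M (cst iE a) inc D dM dMD _ constW _
    (fun k => ic (y k)) x.
- by move=> w; rewrite incD.
- by move=> k; apply/icP; exists (y k).
- exact: rel.
- by exists k0.
case/eqP: ck; apply: (free c); apply: (fmorph_inj ic); rewrite rmorph0 -[RHS]crel rmorph_sum.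
by apply: eq_bigr => l _; rewrite rmorphM /= iKcE mulrC.
Qed.
End NewConstant.

Lemma alg_independent1 (C E : fieldType) (i : {rmorphism C -> E}) (t : 'I_1 -> E) :
  alg_independent i t -> forall q : {poly C}, (map_poly i q).[t ord0] = 0 -> q = 0.
Proof.
move=> ind q qt; pose p := \sum_(k < size q) q`_k *: 'X_[C, U_(ord0) *+ k] : {mpoly C[1]}.
have p0 : p = 0.
  apply: ind; rewrite -[RHS]qt /p (horner_coef_wide _ (n := size q)) ?size_map_poly // raddf_sum.
  apply: eq_bigr => k _; rewrite /= mmapZ mmapX coef_map /mmap1 big_ord1 mulmnE mnm1E eqxx mul1n.
  by [].
apply/polyP => l; rewrite coef0; have [lq|ql] := ltnP l (size q); last exact: nth_default.
have := congr1 (mcoeff (U_(ord0) *+ l)%MM) p0; rewrite mcoeff0 => pl; rewrite -[RHS]pl.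
rewrite /p raddf_sum (bigD1 (Ordinal lq)) //= mcoeffZ mcoeffX eqxx mulr1 big1 ?addr0 // => k kl.
rewrite mcoeffZ mcoeffX; have [e|_] := eqVneq; last by rewrite mulr0.
have /mnmP/(_ ord0) := e; rewrite !mulmnE !mnm1E eqxx !mul1n => kl'.
by case/eqP: kl; apply: val_inj.
Qed.

Lemma algebraic_relation (C E : fieldType) (i : {rmorphism C -> E}) (t y : E) (A : set E) :
  (forall q : {poly C}, (map_poly i q).[t] = 0 -> q = 0) -> A `<=` [set t] ->
  algebraic_over (smallest (@subfield E) (range i `|` A)) y ->
  exists2 g : {poly {poly C}}, g != 0 & eval2 i t y g = 0.
Proof.
move=> transt At [p [pA p0 py]].
have ct_inj : injective (poly_eval i t).
  move=> u v uv; apply/eqP; rewrite -subr_eq0; apply/eqP/transt.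
  by rewrite -poly_evalE rmorphB /= uv subrr.
have [k [io ioP]] := subfield_type_sub (frac_image_subfield ct_inj).
have sub : smallest (@subfield E) (range i `|` A) `<=` frac_image (poly_eval i t).
  apply: sub_smallest_subfield; first exact: frac_image_subfield.
  move=> x [[c _ <-]|/At ->]; [exists c%:P, 1 | exists 'X, 1]; rewrite oner_neq0 rmorph1 divr1; split=> //.
    by rewrite /= poly_evalC.
  by rewrite /= poly_evalX.
have /choice[c cE] (l : 'I_(size p)) : exists c, io c = p`_l.
  by move: pA; rewrite qualifE => /allP pl; apply/ioP/sub/set_mem/pl/mem_nth.
have [P [Q [Q0 PQ]]] := common_denominator ct_inj ioP c.
have PE (l : 'I_(size p)) : poly_eval i t (P l) = poly_eval i t Q * p`_l.
  by rewrite -cE PQ mulrC divfK // (ev_eq0 ct_inj).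
exists (\poly_(l < size p) (if insub l is Some l' then P l' else 0)).
  have sp : ((size p).-1 < size p)%N by rewrite prednK ?size_poly_gt0.
  apply: contraNneq p0 => /polyP/(_ (size p).-1).
  rewrite coef_poly sp coef0 insubT => P0.
  have := PE (Ordinal sp); rewrite P0 rmorph0 => /esym/eqP.
  by rewrite mulf_eq0 (ev_eq0 ct_inj) (negbTE Q0) -lead_coefE lead_coef_eq0.
rewrite /eval2 poly_evalE (horner_coef_wide _ (n := size p)); last first.
  by rewrite map_polyE (leq_trans (size_Poly _)) // size_map size_poly.
transitivity (poly_eval i t Q * p.[y]); last by rewrite (rootP py) mulr0.
rewrite horner_coef mulr_sumr; apply: eq_bigr => l _.
by rewrite coef_map coef_poly ltn_ord valK /= PE mulrA.
Qed.

Theorem corollary6p4 (C : diffFieldType)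
    (C_closed : GRing.closed_field_axiom C)
    (C_char0 : [pchar C] =i pred0)
    (C_der0 : forall c : C, der c = 0)
    (E : diffFieldType) (i : diffMorphism C E)
    (E_isn : iterated_strongly_normal i)
    (K : set E) (K_diff : diff_subfield K) (C_sub_K : range i `<=` K)
    (K_trdeg : trdeg_eq i K 1) :
  exists t : E,
    [/\ K t, ~ range i t
      & [\/ der t = 1,
            exists2 c : C, c != 0 & der t = i c * t
          | weierstrass_solution i t]].
Proof.
have [s [sK sind salg]] := K_trdeg; have [hK K_der] := K_diff.
pose t := s ord0; have Kt : K t by apply: sK; exists ord0.
have transt : forall q : {poly C}, (map_poly i q).[t] = 0 -> q = 0 by exact: alg_independent1.
have algy : exists2 g : {poly {poly C}}, g != 0 & eval2 i t (der t) g = 0.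
  apply: (algebraic_relation transt _ (salg _ (K_der _ Kt))).
  by move=> _ [l _ <-]; rewrite /= ord1.
have constE := isn_constants C_closed C_char0 E_isn.
have [K' [v [iK [dK [tK [n [bas [g [[v_iK v_dK v_t] fr v_frac [gy g'y]]]]]]]]]] :=
  rational_extension C_der0 C_char0 transt algy.
(* The descent through the tower starts with the ambient field [E] itself, over which [t] is
   algebraic of degree 1. *)
have [id_E idE] : exists f : diffMorphism E E, forall x, f x = x.
  pose f : diffMorphism E E := HB.pack (idfun : E -> E) (GRing.RMorphism.on (idfun : E -> E))
    (isDiffMorphism.Build E E idfun (fun=> erefl)).
  by exists f.
have [||M [j [sigma [agree transM [q [q0 qt qF]]]]]] := isn_generic C_char0 E_isn (p := id_E) (t := t).
- exists ('X - t%:P); first by rewrite polyXsubC_eq0.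
  by rewrite rmorphB /= map_polyX map_polyC !hornerE /= idE subrr.
- move=> q qt; apply: transt; rewrite -[RHS]qt; congr (_.[_]).
  by apply: eq_map_poly => c /=; rewrite idE.
have {}agree c : sigma (i c) = j (i c) by have := agree c; rewrite !idE.
have [W [inc [a [b [D [d [aE bE DE bd]]]]]]] :=
  bidifferential_extension C_der0 constE agree transM v_iK v_dK v_t v_frac gy g'y.
have bt : inc (b tK) = sigma t by rewrite bE v_t.
have transT (p : {poly E}) : (map_poly a p).[b tK] = 0 -> p = 0.
  move=> /(congr1 inc); rewrite rmorph0 -horner_map -map_poly_comp bt => e; apply: transM.
  by rewrite -[RHS]e; congr (_.[_]); apply: eq_map_poly => x /=; rewrite aE.
have [Kc [ic icP]] := subfield_type_sub (@constants_subfield M).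
have newc : exists c, D c = 0 /\ ~ is_const i a c.
  apply: (new_constant (der_derivation M) DE transT _ icP q0).
  - by move=> c; rewrite aE -morph_der -morph_der C_der0 !rmorph0.
  - by rewrite bt.
  - move=> l; apply: (qF l); split; first exact: comp_frac_subfield.
    have fr1 w : comp_ring (inc \o a) ic w -> comp_frac (inc \o a) ic w.
      by move=> w1; exists w, 1; rewrite oner_neq0 divr1; split=> //; exact: comp_ring1.
    move=> w [[e _ <-]|/icP[c <-]]; apply: fr1; last exact: comp_ringr.
    by rewrite -aE; exact: (comp_ringl (inc \o a)).
have qs := quartic_from_constant bd C_closed C_char0 fr transT newc.
have [u [P [uC sP uE]]] := quartic_specialization bd C_closed C_char0 qs.
have dC c : dK (iK c) = 0 by apply: (fmorph_inj v); rewrite v_dK v_iK -morph_der C_der0 !rmorph0.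
have [x [xC xE]] := solution_quartic C_closed C_char0 (dK_der bd) dC (bd_constK bd) uC sP uE.
exists (v x); split.
- have KE p : K (eval2 i t (der t) p).
    apply: eval2_ind => [z1 z2|z1 z2|c||]; [exact: subfieldD|exact: subfieldM| |exact: Kt|exact: K_der].
    by apply: C_sub_K; exists c.
  have [p [r [_ ->]]] := v_frac x; exact: subfield_div.
- by move=> [c _ xc]; apply: xC; exists c; apply: (fmorph_inj v); rewrite v_iK.
case: xE => [x1|[c c0 xc]|[g2 [g3 [al [disc xE]]]]].
- by constructor 1; rewrite -v_dK x1 rmorph1.
- by constructor 2; exists c => //; rewrite -v_dK xc rmorphM /= v_iK.
- constructor 3; exists g2, g3, al; split=> //.
  have := congr1 v xE.
  by rewrite !(rmorphM, rmorphB, rmorphXn, rmorph_nat) /= v_dK !v_iK.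
Qed.
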